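(* Let $\rho>0$ and let $(x_t)_{t\ge 0}$ be the point-measure-valued process on $[0,1]$ describing the priority levels of the customers present in the single server preemptive priority queue with arrival rate $\rho$, unit-mean exponential service times and i.i.d. $U([0,1])$ priority levels. Let $\mathcal{B}([0,1])$ denote the Borel $\sigma$-algebra of $[0,1]$ and fix $B\in\mathcal{B}([0,1])$. Then, as $t\to\infty$, $x_t(B)$ converges weakly to a random variable $x(B)$ with mean $$\mu(B)=\mathbb{E}[x(B)]=\int_B m(p)\,dp,$$ where $m:[0,1]\to(0,\infty]$ is defined by $$m(p)=\begin{cases}\dfrac{\rho}{(1-(1-p)\rho)^2}, & (1-p)\rho<1,\\[2mm] \infty, & (1-p)\rho\ge 1.\end{cases}$$
   Context: The model: a single server queue with an infinite buffer. Customers arrive according to a Poisson process with rate $\rho>0$ (no upper bound on $\rho$ is assumed, so the queue need not be stable). Customers have i.i.d. exponential service times with unit mean. Customers have i.i.d. priority levels uniformly distributed on $[0,1]$, independent of all other random quantities in the model. Scheduling is preemptive by priority: at every time the server serves the customer with the highest priority level among those in the system, interrupting the service of another customer if necessary; an interrupted customer waits in the queue until it again has the highest priority level of all customers in the system, at which point its service continues (by memorylessness its residual service time is still exponential with unit mean). A customer leaves when its service is completed. The number of customers in the system is finite at every time $t$, including $t=0$, and all customers (including any present at time $0$) have i.i.d. priority levels uniformly distributed on $[0,1]$, independent of all other random quantities in the model, and i.i.d. exponential service times with unit mean. State: for $B\in\mathcal{B}([0,1])$, $x_t(B)$ is the number of customers in the system at time $t$ with priority level in $B$; i.e. if the customers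 present at time $t$ have priority levels $p_1,\dots,p_N$, then $x_t=\sum_{i=1}^N\delta_{p_i}$, where $\delta_z$ is the Dirac measure at $z$. Random variables and expectations are allowed to take the value $+\infty$; weak convergence is that of random variables with values in $\{0,1,2,\dots\}\cup\{\infty\}$ (so weak convergence to the constant $\infty$ means divergence to infinity in probability). *)

(* Defs.v *)
From HB Require Import structures.
From mathcomp Require Import all_boot all_order all_algebra.
From mathcomp Require Import all_classical all_reals all_analysis.
From mathcomp Require Import measurable_realfun.

Set Implicit Arguments.
Unset Strict Implicit.
Unset Printing Implicit Defensive.

Import Order.TTheory GRing.Theory Num.Theory.
Import numFieldNormedType.Exports.

Local Open Scope classical_set_scope.
Local Open Scope ring_scope.

Definition mutually_independent d (T : measurableType d) (R : realType)
    (P : probability T R) (I : choiceType) (F : I -> set (set T)) : Prop :=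
  forall (J : seq I) (A : I -> set T), uniq J ->
    (forall i, i \in J -> F i (A i)) ->
    P (\bigcap_(i in [set` J]) A i) = (\prod_(i <- J) P (A i))%E.

Definition events_of d d' (T : measurableType d) (T' : measurableType d')
    (X : T -> T') : set (set T) :=
  preimage_set_system setT X measurable.

(* A customer in the system: (priority level, residual service time). *)
Definition job (R : realType) : Type := (R * R)%type.

Definition higher_priority (R : realType) : rel (job R) :=
  fun c c' => c'.1 <= c.1.

(* [tau] units of service spent on the jobs of [l] in the order of the list. *)
Fixpoint serve (R : realType) (tau : R) (l : seq (job R)) : seq (job R) :=
  match l with
  | [::] => [::]
  | c :: l' => if c.2 <= tau then serve (tau - c.2) l'
               else (c.1, c.2 - tau) :: l'
  end.

(* The system after a period of length [tau] without arrivals.  During such a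
   period the job of highest priority is always the first one of the sorted
   list; preemption takes place when an arrival changes the order. *)
Definition run (R : realType) (tau : R) (l : seq (job R)) : seq (job R) :=
  serve tau (sort (@higher_priority R) l).

(* [inl i] is the i-th customer of those present at time 0, and [inr k] is the
   k-th customer arriving after time 0. *)
Definition customer : Type := (nat + nat)%type.

(* Of the customers [inl i], only those with
   [i < init_num w] exist. *)
Record queue_input d (T : measurableType d) (R : realType)
    (P : probability T R) := QueueInput {
  init_num : {RV P >-> nat} ;
  gap : nat -> {RV P >-> R} ; (* interarrival times *)
  service : customer -> {RV P >-> R} ;
  priority : customer -> {RV P >-> R}
}.

(* [None] indexes the initial number. *)
Definition input_events d (T : measurableType d) (R : realType)
    (P : probability T R) (q : queue_input P)
    (i : option (nat + (customer + customer))) : set (set T) :=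
  match i with
  | None => events_of (init_num q)
  | Some (inl k) => events_of (gap q k)
  | Some (inr (inl c)) => events_of (service q c)
  | Some (inr (inr c)) => events_of (priority q c)
  end.

(* Arrivals form a Poisson process of rate [rho] (independent exponential
   interarrival times); the law of the initial number is arbitrary. *)
Record queue_laws d (T : measurableType d) (R : realType)
    (P : probability T R) (rho : R) (q : queue_input P) : Prop := QueueLaws {
  gap_law : forall k (A : set R), measurable A ->
    distribution P (gap q k) A = exponential_prob rho A ;
  service_law : forall c (A : set R), measurable A ->
    distribution P (service q c) A = exponential_prob 1 A ;
  priority_law : forall c (A : set R), measurable A ->
    distribution P (priority q c) A = uniform_prob (@ltr01 R) A ;
  inputs_independent : mutually_independent P (input_events q)
}.

(* The time of the n-th arrival (counted from 1), and 0 for n = 0. *)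
Definition arrival_time d (T : measurableType d) (R : realType)
    (P : probability T R) (q : queue_input P) (n : nat) (w : T) : R :=
  \sum_(k < n) gap q k w.

Fixpoint jobs_after d (T : measurableType d) (R : realType)
    (P : probability T R) (q : queue_input P) (n : nat) (w : T) :
    seq (job R) :=
  match n with
  | 0%N => [seq (priority q (inl i) w, service q (inl i) w)
           | i <- iota 0 (init_num q w)]
  | k.+1 => (priority q (inr k) w, service q (inr k) w)
              :: run (gap q k w) (jobs_after q k w)
  end.

(* The number of arrivals up to time t.  The set below is a singleton for
   almost all w, and always has at most one element; when it is empty, the
   value is 0. *)
Definition num_arrivals d (T : measurableType d) (R : realType)
    (P : probability T R) (q : queue_input P) (t : R) (w : T) : nat :=
  xget 0%N [set n : nat |
    (forall k, (k < n)%N -> arrival_time q k.+1 w <= t) /\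
    t < arrival_time q n.+1 w].

Definition jobs_at d (T : measurableType d) (R : realType)
    (P : probability T R) (q : queue_input P) (t : R) (w : T) :
    seq (job R) :=
  let n := num_arrivals q t w in
  run (t - arrival_time q n w) (jobs_after q n w).

(* The state x_t, as the sum of the Dirac measures at the priority levels of
   the customers in the system. *)
Definition queue_state d (T : measurableType d) (R : realType)
    (P : probability T R) (q : queue_input P) (t : R) (w : T)
    (B : set R) : \bar R :=
  (\sum_(c <- jobs_at q t w) \d_(c.1) B)%E.

Definition extended_nats (R : realType) : set (\bar R) :=
  [set y | y = +oo%E \/ exists n : nat, y = (n%:R)%:E].

Definition extended_nat_rv d (T : measurableType d) (R : realType)
    (X : T -> \bar R) : Prop :=
  measurable_fun setT X /\ forall w, extended_nats (X w).

(* The topology on {0, 1, 2, ..., +oo} is the one induced by \bar R. *)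
Definition converges_weakly d (T : measurableType d) d'
    (T' : measurableType d') (R : realType)
    (P : probability T R) (X : R -> T -> \bar R)
    (Q : probability T' R) (Y : T' -> \bar R) : Prop :=
  [/\ forall t, 0 <= t -> extended_nat_rv (X t),
      extended_nat_rv Y &
      forall f : \bar R -> R,
        {within @extended_nats R, continuous f} ->
        (exists M : R, forall y, extended_nats y -> `|f y| <= M) ->
        'E_P[f \o X t]%E @[t --> +oo] --> 'E_Q[f \o Y]%E].

Definition mean_density (R : realType) (rho p : R) : \bar R :=
  if (1 - p) * rho < 1 then (rho / (1 - (1 - p) * rho) ^+ 2)%:E else +oo%E.

(* Main.v *)
(* By memorylessness, the priorities present at time t have the law of the
   uniformized chain (arrival with probability rho / (1 + rho), departure of
   the top customer otherwise) after a Poisson((1 + rho) t) number of steps.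
   The chain is monotone in the set of customers, so, started from the empty
   system, the tails P(x(B) >= k) increase to limits. Starting instead with m
   random customers changes nothing in the limit: from the empty system, the
   first m steps are all arrivals with positive probability c, so the limit L
   of a tail satisfies L >= c L' + (1 - c) L for the limsup L' from m customers.
   On [p, 1] the count is a birth-death chain whose balance equations give a
   geometric limit with ratio a = (1 - p) rho, or the value infinity if a >= 1.
   The limiting mean is a measure in B; its values a / (1 - a) on the intervals
   [p, 1] determine it as the measure of density m where (1 - p) rho < 1, and
   below that point any non-null set accumulates infinitely many customers. *)
From Stdlib Require List.
Require Import Defs.
From HB Require Import structures.
From mathcomp Require Import all_boot all_order all_algebra.
From mathcomp Require Import all_classical all_reals all_analysis.
From mathcomp Require Import measurable_realfun ring lra.

Set Implicit Arguments.
Unset Strict Implicit.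
Unset Printing Implicit Defensive.

Import Order.TTheory GRing.Theory Num.Theory.
Import numFieldNormedType.Exports.

Local Open Scope classical_set_scope.
Local Open Scope ring_scope.

(** * Measurability of operations on lists *)

(** The queue is given pathwise, by lists of jobs that are sorted and served, so the Markov property
    has to be derived. Residual services are averaged out by [avg]: the order of jobs depends on
    priorities alone, so sorting, service and arrivals keep the residual services i.i.d.
    exponential, and only a list of priorities remains. Integrating the inputs out one at a time, on
    the event of exactly [n] arrivals, produces convolutions of powers of time; beta integrals turn
    them into sums over words of arrivals and departures, and summing over [n] gives the exponential
    series of [evolve]. No stationary law is constructed. Tails from the empty system converge by
    monotonicity, so one-step identities of the chain become balance equations in the limit. These
    leave the probability of an empty ray undetermined, since mass may escape to infinity. The drift
    of the mean count bounds it on one side, nonnegativity of all tails on the other. Below the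
    critical priority the balance forces every tail to 1, because a customer there is served only
    when the higher ones are absent. *)

Definition seq_display (d : measure_display) : measure_display.
Proof. exact: d. Qed.

(** Lists of all lengths form one space, so the length is a coordinate of its own; reading past the
    end of a list returns [point]. *)
Definition seq_cylinders d (E : measurableType d) : set (set (seq E)) :=
  [set C | (exists n, C = [set l | size l = n]) \/
     exists i (A : set E), measurable A /\ C = [set l | A (nth point l i)]].

Section seq_measurable.
Context d (E : measurableType d).

HB.instance Definition _ := isPointed.Build (seq E) [::].
HB.instance Definition _ := @isMeasurable.Build (seq_display d) (seq E)
  <<s @seq_cylinders _ E >> (@sigma_algebra0 _ setT (@seq_cylinders _ E))
  (@sigma_algebraC _ (@seq_cylinders _ E))
  (@sigma_algebra_bigcup _ setT (@seq_cylinders _ E)).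

Lemma measurable_size : measurable_fun [set: seq E] (@size E).
Proof.
move=> _ A _; rewrite setTI.
rewrite [X in measurable X](_ : _ =
    \bigcup_(n in A) [set l : seq E | size l = n]); last first.
  by apply/seteqP; split=> [l Al|l [n An /= ->]//]; exists (size l).
apply: bigcup_measurable => n _.
by apply: sub_sigma_algebra; left; exists n.
Qed.

Lemma measurable_nth i :
  measurable_fun [set: seq E] (fun l : seq E => nth point l i).
Proof.
move=> _ A mA; rewrite setTI.
by apply: sub_sigma_algebra; right; exists i, A.
Qed.

Context d' (T : measurableType d').

Lemma measurable_fun_seq (L : T -> seq E) :
  measurable_fun setT (fun t => size (L t)) ->
  (forall i, measurable_fun setT (fun t => nth point (L t) i)) ->
  measurable_fun setT L.
Proof.
move=> mS mN; apply: (measurability (@seq_cylinders _ E)) => // _ [C HC <-].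
rewrite setTI; case: HC => [[n ->]|[i [A [mA ->]]]].
  rewrite -[X in measurable X]setTI.
  exact: (mS measurableT [set n]).
rewrite -[X in measurable X]setTI.
exact: (mN i measurableT A mA).
Qed.

Lemma measurable_fun_cons (X : T -> E) (L : T -> seq E) :
  measurable_fun setT X -> measurable_fun setT L ->
  measurable_fun setT (fun t => X t :: L t).
Proof.
move=> mX mL; apply: measurable_fun_seq => /= [|[|i]] //.
  apply: (@measurableT_comp _ _ _ _ _ _ succn) => //.
  exact: (measurableT_comp measurable_size mL).
exact: (measurableT_comp (measurable_nth i) mL).
Qed.

Lemma measurable_fun_seq_of (Xs : seq (T -> E)) :
  (forall X, List.In X Xs -> measurable_fun setT X) ->
  measurable_fun setT (fun t => [seq X t | X <- Xs]).
Proof.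
elim: Xs => [_|X Xs IH mXs] /=; first exact: measurable_cst.
apply: measurable_fun_cons; first by apply: mXs; left.
by apply: IH => Y HY; apply: mXs; right.
Qed.

End seq_measurable.

(** A function may be selected by a random index, since preimages are countable unions over the
    values of the index. This covers the random initial number, list lengths and the number of
    arrivals. *)
Lemma measurable_fun_glue d d' (T : measurableType d) (S : measurableType d')
    (N : T -> nat) (F : nat -> T -> S) :
  measurable_fun setT N -> (forall n, measurable_fun setT (F n)) ->
  measurable_fun setT (fun t => F (N t) t).
Proof.
move=> mN mF _ A mA; rewrite setTI.
rewrite [X in measurable X](_ : _ =
    \bigcup_n (N @^-1` [set n] `&` F n @^-1` A)); last first.
  by apply/seteqP; split=> [t At|t [n _ [/= <-]]//]; exists (N t).
apply: bigcup_measurable => n _; apply: measurableI; rewrite -[X in measurable X]setTI.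
  exact: mN.
exact: mF.
Qed.

(* Measurability of an operation on lists is checked on lists of fixed length
   whose entries are measurable functions. *)
Lemma measurable_fun_on_seq d d' d'' (T : measurableType d)
    (E : measurableType d') (S : measurableType d'') (F : T -> seq E -> S) :
  (forall Xs : seq (T * seq E -> E),
     (forall X, List.In X Xs -> measurable_fun setT X) ->
     measurable_fun setT (fun p : T * seq E => F p.1 [seq X p | X <- Xs])) ->
  measurable_fun setT (fun p : T * seq E => F p.1 p.2).
Proof.
move=> HF.
pose nths n : seq (T * seq E -> E) :=
  [seq (fun p : T * seq E => nth point p.2 i) | i <- iota 0 n].
have nthsE (p : T * seq E) n : n = size p.2 -> [seq X p | X <- nths n] = p.2.
  by move=> ->; rewrite /nths -map_comp -[RHS](mkseq_nth point).
pose G n (p : T * seq E) := F p.1 [seq X p | X <- nths n].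
rewrite (_ : (fun p => _) = (fun p : T * seq E => G (size p.2) p)); last first.
  by apply/funext => p /=; rewrite /G nthsE.
apply: (@measurable_fun_glue _ _ _ _ (fun p : T * seq E => size p.2) G).
  exact: (measurableT_comp (@measurable_size _ E) measurable_snd).
move=> n; apply: HF => X; rewrite /nths => /(List.in_map_iff _ _ _)[i [<- _]].
exact: (measurableT_comp (@measurable_nth _ E i) measurable_snd).
Qed.

Section insertion_sort.
Variables (E : Type) (leE : rel E).

Fixpoint insert x s :=
  if s is y :: s' then if leE x y then x :: s else y :: insert x s' else [:: x].

Hypotheses (leE_total : total leE) (leE_tr : transitive leE).

Lemma merge1 x s : merge leE [:: x] s = insert x s.
Proof. by elim: s => //= y s <-. Qed.

(** Merging is associative, so the stack of pending runs kept by the merge sort collapses at any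
    moment into a single merge ([big]), and merging in a singleton is insertion. Insertion sort
    recurses on the list, which is what the proofs of measurability and of [avg_sort] follow. *)
Lemma sort_foldr s : sort leE s = foldr insert [::] s.
Proof.
pose big := foldr (fun s acc => merge leE acc s) [::].
have mergel0 t : merge leE [::] t = t by [].
have merger0 u : merge leE u [::] = u by case: u.
have mA := mergeA leE_total leE_tr.
have pop ss t : merge_sort_pop leE t ss = merge leE (big ss) t.
  elim: ss t => [|s1 ss IH] t //=.
  by rewrite IH -mA.
have push ss t : big (merge_sort_push leE t ss) = merge leE (big ss) t.
  elim: ss t => [|[|x s1] ss IH] t //=.
    by rewrite /= merger0.
  by rewrite IH mA.
rewrite sortE -[RHS]mergel0 -[X in merge _ X _]/(big [::]).
elim: s [::] => [|x s IH] ss; first exact: pop.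
rewrite [LHS]/= IH push -mA; congr merge.
exact: merge1.
Qed.

End insertion_sort.

Section measurable_sort.
Context d (E : measurableType d) (leE : rel E).
Hypotheses (leE_total : total leE) (leE_tr : transitive leE).
Hypothesis leE_meas : measurable_fun setT (fun p : E * E => leE p.1 p.2).

Lemma measurable_fun_insert d' (T : measurableType d') (X : T -> E) (L : T -> seq E) :
  measurable_fun setT X -> measurable_fun setT L ->
  measurable_fun setT (fun t => insert leE (X t) (L t)).
Proof.
move=> mX mL.
have H : measurable_fun setT (fun p : T * seq E => insert leE (X p.1) p.2).
  apply: (measurable_fun_on_seq (F := fun t l => insert leE (X t) l)).
  have mX1 : measurable_fun setT (fun p : T * seq E => X p.1).
    exact: measurableT_comp mX measurable_fst.
  elim=> [_|Y Xs IH mXs] /=.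
    by apply: measurable_fun_cons => //; exact: measurable_cst.
  have mY : measurable_fun setT Y by apply: mXs; left.
  have mXs' : forall Z, List.In Z Xs -> measurable_fun setT Z.
    by move=> Z HZ; apply: mXs; right.
  apply: measurable_fun_ifT.
  - apply: (measurableT_comp leE_meas
      (g := fun p : T * seq E => (X p.1, Y p))).
    exact: measurable_fun_pair.
  - apply: measurable_fun_cons => //; apply: measurable_fun_cons => //.
    exact: measurable_fun_seq_of.
  - by apply: measurable_fun_cons => //; exact: IH.
apply: (measurableT_comp H (g := fun t => (t, L t))).
exact: measurable_fun_pair.
Qed.

Lemma measurable_sort : measurable_fun setT (sort leE).
Proof.
have H : measurable_fun setT (fun p : unit * seq E => sort leE p.2).
  apply: (measurable_fun_on_seq (F := fun _ : unit => sort leE)).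
  move=> Xs mXs; under eq_fun do rewrite sort_foldr//.
  elim: Xs mXs => [_|Y Xs IH mXs] /=; first exact: measurable_cst.
  apply: measurable_fun_insert; first by apply: mXs; left.
  by apply: IH => Z HZ; apply: mXs; right.
apply: (measurableT_comp H (g := fun l => (tt, l))).
exact: measurable_fun_pair.
Qed.

End measurable_sort.

Lemma measurable_behead_seq d (E : measurableType d) :
  measurable_fun [set: seq E] behead.
Proof.
apply: measurable_fun_seq => [|i]; first under eq_fun do rewrite size_behead.
  apply: (@measurableT_comp _ _ _ _ _ _ predn) => //.
  exact: measurable_size.
by under eq_fun do rewrite nth_behead; exact: measurable_nth.
Qed.

Section measurable_run.
Context (R : realType).

Lemma higher_priority_total : total (@higher_priority R).
Proof. by move=> x y; rewrite /higher_priority le_total. Qed.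

Lemma higher_priority_trans : transitive (@higher_priority R).
Proof. by move=> y x z /[swap]; exact: le_trans. Qed.

Lemma measurable_higher_priority :
  measurable_fun setT (fun p : (R * R) * (R * R) => higher_priority p.1 p.2).
Proof.
rewrite /higher_priority; apply: measurable_fun_ler.
  exact: measurableT_comp measurable_fst measurable_snd.
exact: measurableT_comp measurable_fst measurable_fst.
Qed.

Context d (T : measurableType d).

Lemma measurable_fun_serve (tau : T -> R) (L : T -> seq (R * R)) :
  measurable_fun setT tau -> measurable_fun setT L ->
  measurable_fun setT (fun t => serve (tau t) (L t) : seq (R * R)).
Proof.
move=> mtau mL.
have H : measurable_fun setT
    (fun p : (R * T) * seq (R * R) => serve p.1.1 p.2 : seq (R * R)).
  apply: (measurable_fun_on_seq
    (F := fun (x : R * T) l => serve x.1 l : seq (R * R))) => Xs.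
  have ms0 : measurable_fun setT (fun p : (R * T) * seq (R * R) => p.1.1).
    exact: measurableT_comp measurable_fst measurable_fst.
  (* The remaining service budget changes along the recursion and depends on the earlier entries, so
     the induction needs an arbitrary measurable budget [s]. *)
  suff serveXs s : measurable_fun setT s ->
    (forall X, List.In X Xs -> measurable_fun setT X) ->
    measurable_fun setT (fun p : (R * T) * seq (R * R) =>
      serve (s p) [seq X p | X <- Xs] : seq (R * R)) by exact: serveXs.
  elim: Xs s => [|Y Xs IH] s ms mXs /=; first exact: measurable_cst.
  have mY : measurable_fun setT Y by apply: mXs; left.
  have mY1 : measurable_fun setT (fun p => (Y p).1).
    exact: measurableT_comp measurable_fst mY.
  have mY2 : measurable_fun setT (fun p => (Y p).2).
    exact: measurableT_comp measurable_snd mY.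
  have mXs' : forall Z, List.In Z Xs -> measurable_fun setT Z.
    by move=> Z HZ; apply: mXs; right.
  apply: measurable_fun_ifT.
  - exact: measurable_fun_ler.
  - by apply: IH => //; exact: measurable_funB.
  - apply: measurable_fun_cons; last exact: measurable_fun_seq_of.
    by apply: measurable_fun_pair => //; exact: measurable_funB.
apply: (measurableT_comp H (g := fun t => ((tau t, t), L t))).
by do 2 apply: measurable_fun_pair => //.
Qed.

Lemma measurable_fun_run (tau : T -> R) (L : T -> seq (R * R)) :
  measurable_fun setT tau -> measurable_fun setT L ->
  measurable_fun setT (fun t => run (tau t) (L t) : seq (R * R)).
Proof.
move=> mtau mL; apply: measurable_fun_serve => //.
apply: measurableT_comp mL; apply: measurable_sort.
- exact: higher_priority_total.
- exact: higher_priority_trans.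
- exact: measurable_higher_priority.
Qed.

End measurable_run.

(** * Uniform and exponential laws *)

Section density.
Local Open Scope ereal_scope.
Context d (T : measurableType d) (R : realType).
Variables (nu mu : {measure set T -> \bar R}) (g : T -> R).
Hypotheses (mg : measurable_fun setT g) (g0 : forall x, (0 <= g x)%R).
Hypothesis nuE : forall A, measurable A -> nu A = \int[mu]_(x in A) (g x)%:E.

Import HBNNSimple.

Let integral_density_nnsfun (f : {nnsfun T >-> R}) :
  \int[nu]_x (f x)%:E = \int[mu]_x ((f x)%:E * (g x)%:E).
Proof.
under [LHS]eq_integral do rewrite fimfunE -fsumEFin//.
rewrite [LHS]ge0_integral_fsum//; last 2 first.
  - by move=> r; exact/measurable_EFinP/measurableT_comp.
  - by move=> n x _; rewrite EFinM nnfun_muleindic_ge0.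
under [RHS]eq_integral.
  move=> x xD; rewrite fimfunE -fsumEFin// ge0_mule_fsuml; last first.
    by move=> r; rewrite EFinM nnfun_muleindic_ge0.
  over.
rewrite [RHS]ge0_integral_fsum//; last 2 first.
  - move=> r; apply: emeasurable_funM; last exact/measurable_EFinP.
    exact/measurable_EFinP/measurableT_comp.
  - move=> n x _; rewrite mule_ge0//; last by rewrite lee_fin.
    by rewrite EFinM nnfun_muleindic_ge0.
apply: eq_fsbigr => r; rewrite inE => -[x _ <-].
under [RHS]eq_integral do rewrite EFinM -muleA.
under [LHS]eq_integral do rewrite EFinM.
have mE : measurable (f @^-1` [set f x]) by exact: measurable_funPTI.
rewrite ge0_integralZl//; last 2 first.
  - exact/measurable_EFinP.
  - by rewrite lee_fin.
rewrite ge0_integralZl//; last 3 first.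
  - apply: emeasurable_funM; exact/measurable_EFinP.
  - by move=> y _; rewrite mule_ge0// lee_fin.
  - by rewrite lee_fin.
congr (_ * _); rewrite integral_indic// setIT nuE// integral_mkcond.
apply: eq_integral => y _; rewrite patchE indicE.
by case: ifPn => yE; rewrite ?mul1e ?mul0e.
Qed.

(** Indicators are settled by [nuE], simple functions by linearity, and the general case by monotone
    convergence. *)
Lemma integral_density (f : T -> \bar R) :
  measurable_fun setT f -> (forall x, 0 <= f x) ->
  \int[nu]_x f x = \int[mu]_x (f x * (g x)%:E).
Proof.
move=> mf f0.
pose f_ := nnsfun_approx measurableT mf.
have f_lim x : EFin (f_ n x) @[n --> \oo] --> f x by exact: cvg_nnsfun_approx.
transitivity (lim (\int[nu]_x (f_ n x)%:E @[n --> \oo])).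
  rewrite -monotone_convergence//=.
  - by apply: eq_integral => x _; exact/esym/cvg_lim.
  - by move=> n; exact/measurable_EFinP/measurable_funTS.
  - by move=> n ? _; rewrite lee_fin.
  - by move=> ? _ ? ? mn; rewrite lee_fin; exact/lefP/nd_nnsfun_approx.
under eq_fun do rewrite integral_density_nnsfun.
rewrite -monotone_convergence//=.
- apply: eq_integral => x _; apply: cvg_lim => //.
  exact: cvgeZr.
- by move=> n; apply: emeasurable_funM; exact/measurable_EFinP/measurable_funTS.
- by move=> n ? _; rewrite mule_ge0// lee_fin.
- move=> ? _ ? ? mn; rewrite lee_wpmul2r ?lee_fin//.
  exact/lefP/nd_nnsfun_approx.
Qed.

End density.

Section laws.
Context (R : realType).

Definition borel_id : measurableTypeR R -> R := idfun.

Lemma measurable_borel_id : measurable_fun setT borel_id.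
Proof. by move=> _ A mA; rewrite setTI. Qed.

HB.instance Definition _ :=
  isMeasurableFun.Build _ _ (measurableTypeR R) R borel_id measurable_borel_id.

(* The library measures live on [measurableTypeR R]; pushing them forward
   along the identity gives probabilities on [R] itself. *)
Definition unif : probability R R := distribution
  (uniform_distribution_uniform_prob__canonical__probability_measure_Probability
     (@ltr01 R)) borel_id.

Definition expo (r : R) (r0 : 0 < r) : probability R R := distribution
  (exponential_distribution_exponential_prob__canonical__probability_measure_Probability
     r0) borel_id.

Lemma expoE (r : R) (r0 : 0 < r) A : expo r0 A = exponential_prob r A.
Proof. by []. Qed.

Local Open Scope ereal_scope.

Lemma integral_unif (f : R -> \bar R) :
  measurable_fun setT f -> (forall x, 0 <= f x) ->
  \int[unif]_x f x = \int[lebesgue_measure]_(x in `[0%R, 1%R]) f x.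
Proof.
move=> mf f0; rewrite ge0_integral_distribution// integral_uniform//.
by rewrite subr0 invr1 mul1e.
Qed.

Lemma integral_expo (r : R) (r0 : (0 < r)%R) (f : R -> \bar R) :
  measurable_fun setT f -> (forall x, 0 <= f x) ->
  \int[expo r0]_x f x =
  \int[lebesgue_measure]_(x in `[0%R, +oo[) (f x * (r * expR (- (r * x)))%:E).
Proof.
move=> mf f0; rewrite ge0_integral_distribution//.
rewrite (@integral_density _ _ _ _ lebesgue_measure (exponential_pdf r))//.
- rewrite [RHS]integral_mkcond; apply: eq_integral => x _.
  rewrite patchE /exponential_pdf patchE; case: ifPn => _; last by rewrite mule0.
  by rewrite mulNr.
- exact: measurable_exponential_pdf.
- by move=> x; apply: exponential_pdf_ge0; exact: ltW.
Qed.

End laws.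

(** * Integrating out one independent input *)

Section independence.
Local Open Scope ereal_scope.
Context d (T : measurableType d) (R : realType) (P : probability T R).
Context (I : choiceType) (F : I -> set (set T)).
Hypothesis Findep : mutually_independent P F.
Hypothesis Fmeas : forall i, F i `<=` measurable.
Hypothesis FT : forall i, F i setT.
Hypothesis FI : forall i, setI_closed (F i).

Definition cylinders (S : set I) : set (set T) :=
  [set C | exists J (A : I -> set T), [/\ uniq J,
     forall i, i \in J -> S i /\ F i (A i) & C = \bigcap_(i in [set` J]) A i]].

(** The same points as [T], with the sigma-algebra generated by the inputs in [S]. Depending only on
    those inputs is thus expressed as measurability from [history S]. *)
Definition history (S : set I) := g_sigma_algebraType (cylinders S).

Lemma cylinders_measurable S : cylinders S `<=` measurable.
Proof.
move=> _ [J [A [_ JA ->]]]; apply: fin_bigcap_measurable => // i /= iJ.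
exact/Fmeas/(JA _ iJ).2.
Qed.

Lemma measurable_history S (G : set T) :
  measurable (G : set (history S)) -> measurable G.
Proof.
apply: smallest_sub; first exact: sigma_algebra_measurable.
exact: cylinders_measurable.
Qed.

Lemma cylindersI S : setI_closed (cylinders S).
Proof.
move=> _ _ [J [A [uJ JA ->]]] [K [B [uK KB ->]]].
exists (undup (J ++ K)), (fun i => (if i \in J then A i else setT) `&`
  (if i \in K then B i else setT)); split.
- exact: undup_uniq.
- move=> i; rewrite mem_undup mem_cat => iJK; split.
    by case/orP: iJK => [/JA|/KB] [].
  by apply: FI; [case: ifPn => // /JA[]|case: ifPn => // /KB[]].
- apply/seteqP; split=> [w [/= wA wB] i /= _|w /= wAB].
    by split; case: ifPn => //; [exact: wA|exact: wB].
  split=> i /= ii; have := wAB i; rewrite /= mem_undup mem_cat ii ?orbT;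
  by move=> /(_ isT)[].
Qed.

Lemma measurable_history_coord (S : set I) i d' (E : measurableType d') (X : T -> E) :
  S i -> (forall A, measurable A -> F i (X @^-1` A)) ->
  measurable_fun [set: history S] (X : history S -> E).
Proof.
move=> Si FX _ A mA; rewrite setTI; apply: sub_sigma_algebra.
exists [:: i], (fun=> X @^-1` A); split=> //.
  by move=> j; rewrite inE => /eqP->; split=> //; exact: FX.
apply/seteqP; split=> [w wA j _ //|w /= wA].
by apply: (wA i); rewrite /= inE.
Qed.

Lemma measurable_history_fun (S : set I) d' (E : measurableType d') (Y : T -> E) :
  measurable_fun [set: history S] (Y : history S -> E) ->
  measurable_fun [set: T] Y.
Proof.
move=> mY _ A mA; have := mY measurableT A mA; exact: measurable_history.
Qed.

(** Dynkin's argument: the events [G] for which the product formula holds form a Dynkin class that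
    contains the pi-system of cylinders. *)
Lemma indep_history S i A (G : set (history S)) : ~ S i -> F i A -> measurable G ->
  P (A `&` G) = P A * P G.
Proof.
move=> Si FA mG.
have mA : measurable A by exact: Fmeas FA.
move: G mG; apply: (@dynkin_induction _ (history S) (cylinders S)
  (fun G : set T => P (A `&` G) = P A * P G)) => //.
- exact: cylindersI.
- by rewrite setIT probability_setT mule1.
- move=> _ [J [B [uJ JB ->]]].
  have iJ : i \notin J by apply/negP => /JB[].
  (* The fresh index [i] is put in front of the index list of the cylinder, and the family of events
     is overridden at [i] by [A]. *)
  have := @Findep (i :: J) (fun j => if j == i then A else B j).
  rewrite big_cons /= eqxx iJ uJ => /(_ isT) PE.
  have -> : A `&` \bigcap_(i in [set` J]) B i =
      \bigcap_(i0 in [set i0 | i0 \in i :: J]) (if i0 == i then A else B i0).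
    apply/seteqP; split=> [w [Aw wB] j /=|w /= wAB].
      by rewrite inE; case: eqP => //= _ jJ; exact: wB.
    split; first by have := wAB i; rewrite /= inE eqxx => /(_ isT).
    move=> j /= jJ; have := wAB j; rewrite /= inE jJ orbT => /(_ isT).
    by case: eqP => // ji; rewrite -ji jJ in iJ.
  rewrite PE; last first.
    by move=> j; rewrite inE; case: eqP => [->//|_ /= /JB[]].
  congr (_ * _).
  have -> : \prod_(i0 <- J) P (if i0 == i then A else B i0) = \prod_(j <- J) P (B j).
    rewrite !big_seq; apply: eq_bigr => j jJ.
    by case: eqP => // ji; rewrite -ji jJ in iJ.
  by rewrite -Findep// => j /JB[].
- move=> G mG PG.
  have mG' : measurable (G : set T) by exact: measurable_history mG.
  have PAG : P A = P (A `&` G) + P (A `&` ~` G).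
    rewrite -measureU//; [|exact: measurableI|apply: measurableI => //; exact: measurableC|].
      by rewrite -setIUr setUv setIT.
    by rewrite setIACA setICr setI0.
  have PG1 : 1 = P G + P (~` G).
    rewrite -measureU//; [|exact: measurableC|by rewrite setICr].
    by rewrite setUv; exact/esym/(@probability_setT _ _ _ P).
  have finA : P A \is a fin_num by rewrite fin_num_measure.
  have finAG : P (A `&` G) \is a fin_num.
    by rewrite fin_num_measure//; exact: measurableI.
  rewrite -[LHS](addeK _ finAG) -[RHS](addeK _ finAG).
  rewrite [P (A `&` ~` G) + _]addeC -PAG PG.
  by rewrite -muleDr ?ge0_adde_def ?inE// [P (~` G) + _]addeC -PG1 mule1.
- move=> G mG tG PG.
  have mG' n : measurable (G n : set T) by exact: measurable_history (mG n).
  have mAG n : measurable (A `&` G n) by exact: measurableI.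
  rewrite setI_bigcupr measure_bigcup//; last first.
    exact: trivIset_setIl.
  rewrite (measure_bigcup P)//.
  have finA : P A \is a fin_num by rewrite fin_num_measure.
  rewrite -(fineK finA) -nneseriesZl//.
  by apply: eq_eseriesr => n _; rewrite fineK//; exact: PG.
Qed.

(** Independence makes the joint law of [X] and [Y] a product measure, first on rectangles; Tonelli
    then integrates [X] out with [Y] held fixed. It plays the role of conditioning on the inputs in
    [S]. *)
Lemma freeze (S : set I) i d1 (E1 : measurableType d1) (law : probability E1 R)
    (X : T -> E1) d2 (E2 : measurableType d2) (Y : T -> E2) (phi : E1 * E2 -> \bar R) :
  ~ S i -> (forall A, measurable A -> F i (X @^-1` A)) ->
  (forall A, measurable A -> P (X @^-1` A) = law A) ->
  measurable_fun [set: history S] (Y : history S -> E2) ->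
  measurable_fun setT phi -> (forall z, 0 <= phi z) ->
  \int[P]_w phi (X w, Y w) = \int[P]_w \int[law]_x phi (x, Y w).
Proof.
move=> Si FX lawX mY mphi phi0.
have mX : measurable_fun setT X.
  by move=> _ A mA; rewrite setTI; exact: Fmeas (FX A mA).
have mYT : measurable_fun setT Y by exact: measurable_history_fun mY.
have mXY : measurable_fun setT (fun w => (X w, Y w)) by exact: measurable_fun_pair.
pose Y' : {mfun T >-> E2} := HB.pack Y (isMeasurableFun.Build _ _ _ _ Y mYT).
pose XY' : {mfun T >-> (E1 * E2)%type} :=
  HB.pack (fun w => (X w, Y w)) (isMeasurableFun.Build _ _ _ _ _ mXY).
have XYE A : measurable A -> (law \x distribution P Y') A = distribution P XY' A.
  apply: product_measure_unique => B C mB mC /=.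
  rewrite /distribution /pushforward /=.
  rewrite -lawX// -(indep_history Si)//; first exact: FX.
  by rewrite -[X in measurable X]setTI; exact: mY.
transitivity (\int[distribution P XY']_z phi z).
  by rewrite ge0_integral_distribution.
transitivity (\int[law \x distribution P Y']_z phi z).
  by apply: eq_measure_integral => A mA _; exact/esym/XYE.
rewrite fubini_tonelli1// fubini_tonelli// ge0_integral_distribution//.
- exact: (measurable_fun_fubini_tonelli_G (m1 := law) phi).
- by move=> y; apply: integral_ge0.
Qed.

End independence.

(** * Powers of time and their convolutions *)

Section time_powers.
Context (R : realType).
Local Open Scope ring_scope.

(** The volume of the ordered [j]-tuples of times in [[0, r]]; multiplied by [expR (- r)] it is the
    Poisson weight of [j]. *)
Definition tpow (j : nat) (r : R) : R := r ^+ j / j`!%:R.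

Lemma tpow0 r : tpow 0 r = 1.
Proof. by rewrite /tpow expr0 fact0 divr1. Qed.

Lemma tpowS0 j : tpow j.+1 0 = 0.
Proof. by rewrite /tpow exprS mul0r mul0r. Qed.

Lemma tpow_ge0 j r : 0 <= r -> 0 <= tpow j r.
Proof. by move=> r0; rewrite divr_ge0// exprn_ge0. Qed.

Lemma is_derive_tpowS j (x : R) : is_derive x 1 (tpow j.+1) (tpow j x).
Proof.
rewrite (_ : tpow j.+1 = (j.+1)`!%:R^-1 \*: ((@id R) ^+ j.+1)); last first.
  by apply/funext => y; rewrite /tpow /= exprfctE mulrC.
apply: is_derive_eq.
rewrite /GRing.scale /= /tpow factS natrM invfM.
have : (j`!)%:R != 0 :> R by rewrite pnatr_eq0 -lt0n fact_gt0.
move=> jn; field.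
by rewrite jn /= (_ : 1 + j%:R = j.+1%:R) ?pnatr_eq0// -natr1 addrC.
Qed.

Lemma continuous_tpow j : continuous (tpow j).
Proof.
move=> x; apply: cvgM; last exact: cvg_cst.
exact: exprn_continuous.
Qed.

Lemma measurable_tpow j : measurable_fun setT (tpow j).
Proof. by apply: continuous_measurable_fun; exact: continuous_tpow. Qed.

(** Integration by parts moves one power from [r - x] to [x] and leaves the sum of the exponents
    unchanged; after [m] rounds only a pure power of [x] is left. *)
Lemma tpow_beta_primitive j m (r : R) : exists F : R -> R,
  [/\ forall x : R, is_derive x 1 F (tpow j x * tpow m (r - x)),
      F 0 = 0 & F r = tpow (j + m).+1 r].
Proof.
elim: m j => [|m IH] j.
  exists (tpow j.+1); split; [|exact: tpowS0|by rewrite addn0].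
  by move=> x; rewrite tpow0 mulr1; exact: is_derive_tpowS.
have [F [dF F0 Fr]] := IH j.+1.
exists (fun x => tpow j.+1 x * tpow m.+1 (r - x) + F x); split.
- move=> x.
  have d1 := is_derive_tpowS j x.
  have d2 : is_derive x 1 (fun x => tpow m.+1 (r - x)) (- tpow m (r - x)).
    have d3 := is_derive_tpowS m (r - x).
    have : is_derive x 1 (fun x : R => r - x) (-1).
      rewrite (_ : (fun x : R => r - x) = cst r - @id R)//.
      by apply: is_derive_eq; rewrite sub0r.
    move=> d4; have := @is_derive1_comp _ (tpow m.+1) _ x _ _ d3 d4.
    by rewrite mulrN1.
  have d5 := dF x.
  have := is_deriveD (is_deriveM d1 d2) d5.
  rewrite /GRing.scale/=; congr is_derive.
  by ring.
- by rewrite F0 tpowS0 mul0r addr0.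
- by rewrite subrr tpowS0 mulr0 add0r Fr addSnnS.
Qed.

(** Placing [j] events before time [x], [m] after it, and integrating over the position [x] of one
    further event yields all placements of [j + m + 1] events. The case [r = 0] is separate because
    the fundamental theorem is applied on a nondegenerate interval. *)
Lemma integral_tpow_beta j m (r : R) : 0 <= r ->
  (\int[lebesgue_measure]_(x in `[0%R, r]) (tpow j x * tpow m (r - x))%:E =
   (tpow (j + m).+1 r)%:E)%E.
Proof.
rewrite le_eqVlt => /predU1P[<-|r0].
  by rewrite set_itv1 integral_set1 tpowS0.
have [F [dF F0 Fr]] := tpow_beta_primitive j m r.
rewrite (continuous_FTC2 (F := F) r0) ?F0 ?sube0 ?Fr//.
- apply: continuous_subspaceT => x; apply: cvgM; first exact: continuous_tpow.
  apply: (@continuous_comp _ _ _ (fun x => r - x)); last exact: continuous_tpow.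
  by apply: cvgB => //; exact: cvg_cst.
- have cF x : {for x, continuous F}.
    by apply: differentiable_continuous; apply/derivable1_diffP; case: (dF x).
  split.
  + by move=> x _; case: (dF x).
  + exact/cvg_at_right_filter/cF.
  + exact/cvg_at_left_filter/cF.
- by move=> x _; rewrite derive1E; case: (dF x).
Qed.

End time_powers.

Section exponential_law.
Context (R : realType) (r : R) (r0 : 0 < r).
Local Open Scope ereal_scope.

Lemma expo_tail (x : R) : (0 <= x)%R -> expo r0 `]x, +oo[%classic = (expR (- (r * x)))%:E.
Proof.
move=> x0; rewrite expoE /exponential_prob.
have cf : continuous (fun y : R => r * expR (- r * y))%R.
  move=> y; apply: cvgM; first exact: cvg_cst.
  apply: (@continuous_comp _ _ _ (fun y : R => - r * y)%R); last exact: continuous_expR.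
  exact: mulrl_continuous.
rewrite integral_itv_obnd_cbnd; last first.
  by apply/measurable_EFinP/measurable_funTS; exact: measurable_exponential_pdf.
rewrite (eq_integral (fun y : measurableTypeR R => (r * expR (- r * y))%:E)); last first.
  move=> y; rewrite inE /= in_itv/= andbT => xy.
  by rewrite exponential_pdfE// (le_trans x0).
have d1 (y : R) : is_derive y 1%R (fun z : R => - (expR (- r * z)))%R (r * expR (- r * y))%R.
  have d2 : is_derive y 1%R (fun z : R => - r * z)%R (- r)%R.
    rewrite (_ : (fun z : R => - r * z)%R = (- r)%R \*: (@id R))//.
    by apply: is_derive_eq; rewrite /GRing.scale/= mulr1.
  have d3 := @is_derive1_comp _ expR _ y _ _ (is_derive_expR _) d2.
  have := is_deriveN d3.
  by congr is_derive; rewrite mulrN opprK mulrC.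
rewrite (@ge0_continuous_FTC2y _ _ (fun z => - (expR (- r * z)))%R x 0%R).
- by rewrite sub0e EFinN oppeK mulNr.
- by move=> y _; rewrite mulr_ge0 ?expR_ge0// ltW.
- exact: continuous_subspaceT.
- rewrite -oppr0; apply: cvgN.
  rewrite (_ : (fun x => expR (- r * x)) =
               (fun z => expR (- z)) \o (fun z => r * z))%R; last first.
    by apply/funext => y /=; rewrite mulNr.
  apply: (@cvg_comp _ _ _ _ _ _ (pinfty_nbhs R)); last exact: cvgr_expR.
  exact: gt0_cvgMry.
- by move=> y _; case: (d1 y).
- have cF : {for x, continuous (fun z : R => - expR (- r * z))%R}.
    by apply: differentiable_continuous; apply/derivable1_diffP; case: (d1 x).
  exact/cvg_at_right_filter/cF.
- by move=> y _; rewrite derive1E; case: (d1 y).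
Qed.

Lemma expo_tail_lt0 (x : R) : (x <= 0)%R -> expo r0 `]x, +oo[%classic = 1.
Proof.
move=> x0; apply/eqP; rewrite eq_le probability_le1//=.
apply: (@le_trans _ _ (expo r0 `]0%R, +oo[%classic)).
  by rewrite expo_tail// mulr0 oppr0 expR0.
by rewrite le_measure ?inE//; apply: subset_itvr; rewrite bnd_simp.
Qed.

Lemma integral_expo_tail (x : R) (c : \bar R) : (0 <= x)%R -> 0 <= c ->
  \int[expo r0]_g (if (x < g)%R then c else 0) = (expR (- (r * x)))%:E * c.
Proof.
move=> x0 c0; rewrite -expo_tail// muleC.
have mD : measurable (`]x, +oo[%classic : set R) by exact: measurable_itv.
rewrite -(integral_cst (expo r0) mD c).
rewrite [RHS]integral_mkcond; apply: eq_integral => g _.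
by rewrite patchE mem_setE in_itv/= andbT.
Qed.

(** Memorylessness as an equality of measures: the law restricted beyond [tau] and shifted back
    equals the law scaled by [expR (- (r * tau))]. The two agree on the rays []x, +oo[], a
    generating pi-system; for negative [x] the ray carries the whole mass. *)
Lemma expo_memoryless (tau : R) (phi : R -> \bar R) : (0 <= tau)%R ->
  measurable_fun setT phi -> (forall x, 0 <= phi x) ->
  \int[expo r0]_s (if (s <= tau)%R then 0 else phi (s - tau)%R) =
  (expR (- (r * tau)))%:E * \int[expo r0]_s phi s.
Proof.
move=> tau0 mphi phi0.
have mD : measurable (`]tau, +oo[%classic : set R) by exact: measurable_itv.
pose nu := mrestr (expo r0) mD.
have mshift : measurable_fun setT (fun s : R => s - tau)%R by exact: measurable_funB.
have mshift' : measurable_fun setT (fun s : R => phi (s - tau)%R).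
  exact: measurableT_comp mphi mshift.
pose h : {mfun R >-> R} := HB.pack (fun s : R => s - tau)%R
  (isMeasurableFun.Build _ _ _ _ (fun s : R => s - tau)%R mshift).
have c0 : (0 <= expR (- (r * tau)))%R by exact: expR_ge0.
pose m2 := mscale (NngNum c0) (expo r0).
have m12 A : measurable A -> pushforward nu h A = m2 A.
  apply: (@measure_unique _ R R (@RGenOInfty.G R) (fun n => `]- n%:R, +oo[%classic)%R).
  - exact: RGenOInfty.measurableE.
  - move=> _ _ [x ->] [y ->]; exists (Num.max x y).
    rewrite predeqE => z /=; rewrite !in_itv/= !andbT gt_max.
    by split=> [[-> ->]|/andP[]].
  - by move=> n; exists (- n%:R)%R.
  - apply/seteqP; split=> // z _; exists (Num.bound `|z|) => //=.
    rewrite in_itv/= andbT ltrNl (le_lt_trans (ler_norm _))// normrN.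
    exact: archi_boundP.
  - move=> _ [x ->]; rewrite /pushforward /nu /mrestr /m2 /mscale /=.
    transitivity (expo r0 `](Num.max (x + tau) tau)%R, +oo[%classic).
      congr (expo r0 _); rewrite predeqE => z /=; rewrite !in_itv/= !andbT gt_max -ltrBrDr.
      by split=> [[-> ->]|/andP[]].
    have [x0|x0] := (leP 0 x)%R.
      rewrite max_l ?lerDr// expo_tail ?addr_ge0// /m2 /mscale /= expo_tail//.
      by rewrite -EFinM -expRD mulrDr opprD addrC.
    rewrite max_r ?gerDr ?ltW// expo_tail// /m2 /mscale /= expo_tail_lt0 ?mule1//.
    exact: ltW.
  - move=> n; rewrite /pushforward /nu /mrestr.
    apply: (@le_lt_trans _ _ 1); last exact: ltry.
    apply: probability_le1; apply: measurableI => //.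
    by apply: measurable_funPTI; exact: measurable_itv.
transitivity (\int[nu]_s phi (s - tau)%R).
  rewrite (@integral_density _ _ _ nu (expo r0) (\1_(`]tau, +oo[)))//.
  - apply: eq_integral => s _; rewrite indicE mem_setE in_itv/= andbT.
    by case: ltP => _; rewrite ?mule1 ?mule0.
  - by move=> A mA; rewrite integral_indic// setIC.
transitivity (\int[pushforward nu h]_s phi s).
  by rewrite ge0_integral_pushforward//.
transitivity (\int[m2]_s phi s).
  by apply: eq_measure_integral => A mA _; exact: m12.
by rewrite ge0_integral_mscale.
Qed.

End exponential_law.

(** * Mean effect of an arrival and of a period of service *)

Lemma measurable_fun_integral d1 d2 (T1 : measurableType d1)
    (T2 : measurableType d2) (R : realType)
    (mu : {sigma_finite_measure set T2 -> \bar R}) (f : T1 * T2 -> \bar R) :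
  measurable_fun setT f -> (forall z, 0 <= f z)%E ->
  measurable_fun setT (fun x => \int[mu]_y f (x, y))%E.
Proof. by move=> mf f0; exact: (measurable_fun_fubini_tonelli_F f). Qed.

Lemma integral_prob_cst d (T : measurableType d) (R : realType)
    (P : probability T R) (c : \bar R) : (\int[P]_x c = c)%E.
Proof.
transitivity (c * P setT)%E; last by rewrite probability_setT mule1.
exact: integral_cst.
Qed.

Section operators.
Context (R : realType).
Local Open Scope ereal_scope.

Definition higher : rel R := fun p p' => (p' <= p)%R.

Lemma higher_total : total higher.
Proof. by move=> x y; rewrite /higher le_total. Qed.

Lemma higher_trans : transitive higher.
Proof. by move=> y x z /[swap]; exact: le_trans. Qed.

Lemma higher_anti : antisymmetric higher.
Proof. by move=> x y; rewrite andbC; exact: le_anti. Qed.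

Lemma measurable_higher : measurable_fun setT (fun p : R * R => higher p.1 p.2).
Proof. by apply: measurable_fun_ler; [exact: measurable_snd|exact: measurable_fst]. Qed.

Definition arrive (f : seq R -> \bar R) (x : seq R) := \int[unif R]_u f (u :: x).

(** On the empty list [behead] does nothing: this is the fictitious service of an idle server in the
    uniformized chain. *)
Definition depart (f : seq R -> \bar R) (x : seq R) := f (behead (sort higher x)).

Definition service_prob : probability R R := expo (@ltr01 R).

(* Mean of [F] over jobs with priorities [ps] and independent exponential
   residual services. *)
Fixpoint avg (F : seq (R * R) -> \bar R) (ps : seq R) : \bar R :=
  if ps is p :: ps' then \int[service_prob]_s avg (fun l => F ((p, s) :: l)) ps'
  else F [::].

Lemma avg_ge0 F ps : (forall l, 0 <= F l) -> 0 <= avg F ps.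
Proof.
by elim: ps F => [|p ps IH] F F0 //=; apply: integral_ge0 => s _; exact: IH.
Qed.

Lemma eq_avg F G ps : F =1 G -> avg F ps = avg G ps.
Proof. by move=> /funext->. Qed.

Lemma measurable_avg d (T : measurableType d) (H : T * seq (R * R) -> \bar R) ps :
  measurable_fun setT H -> (forall z, 0 <= H z) ->
  measurable_fun setT (fun t => avg (fun l => H (t, l)) ps).
Proof.
elim: ps d T H => [|p ps IH] d T H mH H0 /=.
  apply: (measurableT_comp mH (g := fun t => (t, [::]))).
  by apply: measurable_fun_pair => //; exact: measurable_cst.
apply: (@measurable_fun_integral _ _ _ _ _ service_prob
  (fun z : T * R => avg (fun l => H (z.1, (p, z.2) :: l)) ps)); last first.
  by move=> z; exact: avg_ge0.
apply: (IH _ _ (fun z : (T * R) * seq (R * R) => H (z.1.1, (p, z.1.2) :: z.2))) => //.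
apply: (measurableT_comp mH
  (g := fun z : (T * R) * seq (R * R) => (z.1.1, (p, z.1.2) :: z.2))).
apply: measurable_fun_pair.
  exact: measurableT_comp measurable_fst measurable_fst.
apply: measurable_fun_cons; last exact: measurable_snd.
apply: measurable_fun_pair; first exact: measurable_cst.
exact: measurableT_comp measurable_snd measurable_fst.
Qed.

Lemma measurable_curry_cons d (T : measurableType d) (H : T * seq (R * R) -> \bar R) (c : R * R) :
  measurable_fun setT H -> measurable_fun setT (fun z => H (z.1, c :: z.2)).
Proof.
move=> mH; apply: (measurableT_comp mH (g := fun z => (z.1, c :: z.2))).
apply: measurable_fun_pair; first exact: measurable_fst.
by apply: measurable_fun_cons; [exact: measurable_cst|exact: measurable_snd].
Qed.

Lemma avg_integral d (T : measurableType d) (mu : {sigma_finite_measure set T -> \bar R})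
    (H : T * seq (R * R) -> \bar R) ps :
  measurable_fun setT H -> (forall z, 0 <= H z) ->
  avg (fun l => \int[mu]_t H (t, l)) ps = \int[mu]_t avg (fun l => H (t, l)) ps.
Proof.
elim: ps H => [//|p ps IH] H mH H0 /=.
under eq_integral => s _.
  rewrite (IH (fun z => H (z.1, (p, s) :: z.2)))//; last exact: measurable_curry_cons.
  over.
rewrite (fubini_tonelli (m1 := service_prob) (m2 := mu)
  (fun z => avg (fun l => H (z.2, (p, z.1) :: l)) ps))//.
- apply: (measurable_avg (H := fun z : (R * T) * seq (R * R) => H (z.1.2, (p, z.1.1) :: z.2))) => //.
  apply: (measurableT_comp mH
    (g := fun z : (R * T) * seq (R * R) => (z.1.2, (p, z.1.1) :: z.2))).
  apply: measurable_fun_pair.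
    exact: measurableT_comp measurable_snd measurable_fst.
  apply: measurable_fun_cons; last exact: measurable_snd.
  apply: measurable_fun_pair; first exact: measurable_cst.
  exact: measurableT_comp measurable_fst measurable_fst.
- by move=> z; exact: avg_ge0.
Qed.

Lemma avg_priorities (f : seq R -> \bar R) ps :
  avg (fun l => f (map fst l)) ps = f ps.
Proof.
elim: ps f => [//|p ps IH] f /=.
under eq_integral do rewrite (IH (fun l => f (p :: l))).
exact: integral_prob_cst.
Qed.

(** The place of the new job is decided by priorities alone and all services have the same law, so
    moving it past the head only exchanges two integrals. *)
Lemma avg_insert (F : seq (R * R) -> \bar R) p ps :
  measurable_fun setT F -> (forall l, 0 <= F l) ->
  \int[service_prob]_s avg (fun l => F (insert (@higher_priority R) (p, s) l)) ps =
  avg F (insert higher p ps).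
Proof.
elim: ps F => [//|q ps IH] F mF F0 /=.
rewrite /higher_priority /= /higher; case: ifPn => qp //=.
have mFins : measurable_fun setT (fun z : (R * R) * seq (R * R) =>
    F ((q, z.1.2) :: insert (@higher_priority R) (p, z.1.1) z.2)).
  apply: measurableT_comp mF _; apply: measurable_fun_cons.
    apply: measurable_fun_pair; first exact: measurable_cst.
    exact: measurableT_comp measurable_snd measurable_fst.
  apply: measurable_fun_insert; last exact: measurable_snd.
    exact: measurable_higher_priority.
  apply: measurable_fun_pair; first exact: measurable_cst.
  exact: measurableT_comp measurable_fst measurable_fst.
rewrite (fubini_tonelli (m1 := service_prob) (m2 := service_prob)
  (fun z => avg (fun l => F ((q, z.2) :: insert (@higher_priority R) (p, z.1) l)) ps)).
- apply: eq_integral => s _; rewrite (IH (fun l => F ((q, s) :: l)))//.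
  apply: measurableT_comp mF _; apply: measurable_fun_cons => //.
- exact: (measurable_avg _ mFins (fun=> F0 _)).
- by move=> z; exact: avg_ge0.
Qed.

Lemma avg_sort (F : seq (R * R) -> \bar R) ps :
  measurable_fun setT F -> (forall l, 0 <= F l) ->
  avg (fun l => F (sort (@higher_priority R) l)) ps = avg F (sort higher ps).
Proof.
have hpE := sort_foldr (@higher_priority_total R) (@higher_priority_trans R).
under eq_avg do rewrite hpE.
rewrite (sort_foldr higher_total higher_trans).
elim: ps F => [//|p ps IH] F mF F0 /=.
rewrite -avg_insert//; apply: eq_integral => s _.
rewrite (IH (fun l => F (insert (@higher_priority R) (p, s) l)))//.
apply: measurableT_comp mF _; apply: measurable_fun_insert => //.
exact: measurable_higher_priority.
Qed.

Definition arrive_job (F : seq (R * R) -> \bar R) l :=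
  \int[unif R]_p \int[service_prob]_s F ((p, s) :: l).

Lemma avg_arrive_job (F : seq (R * R) -> \bar R) ps :
  measurable_fun setT F -> (forall l, 0 <= F l) ->
  avg (arrive_job F) ps = arrive (avg F) ps.
Proof.
move=> mF F0; rewrite /arrive_job /arrive.
have mF3 : measurable_fun setT
    (fun z : (R * seq (R * R)) * R => F ((z.1.1, z.2) :: z.1.2)).
  apply: measurableT_comp mF _; apply: measurable_fun_cons; last first.
    exact: measurableT_comp measurable_snd measurable_fst.
  apply: measurable_fun_pair => //.
  exact: measurableT_comp measurable_fst measurable_fst.
rewrite (avg_integral (unif R) (H := fun z => \int[service_prob]_s F ((z.1, s) :: z.2))).
- apply: eq_integral => p _ /=.
  rewrite (avg_integral service_prob (H := fun z => F ((p, z.1) :: z.2)))//.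
  apply: measurableT_comp mF _; apply: measurable_fun_cons => //.
  by apply: measurable_fun_pair => //.
- exact: (measurable_fun_integral service_prob mF3).
- by move=> z; exact: integral_ge0.
Qed.

End operators.

Lemma ge0_nneseriesZl (R : realType) (k : \bar R) (a : nat -> \bar R) :
  (0 <= k)%E -> (forall n, 0 <= a n)%E ->
  (\sum_(n <oo) k * a n = k * \sum_(n <oo) a n)%E.
Proof.
move=> k0 a0; rewrite -!ge0_integral_count//; last by move=> n; exact: mule_ge0.
by rewrite ge0_integralZl.
Qed.

Lemma ge0_nneseriesZr (R : realType) (k : \bar R) (a : nat -> \bar R) :
  (0 <= k)%E -> (forall n, 0 <= a n)%E ->
  (\sum_(n <oo) a n * k = (\sum_(n <oo) a n) * k)%E.
Proof.
move=> k0 a0; rewrite muleC -ge0_nneseriesZl//.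
by apply: eq_eseriesr => n _; rewrite muleC.
Qed.

Section exponential_integrals.
Context (R : realType).
Local Open Scope ereal_scope.

Lemma nneseries_tpow (r : R) : (0 <= r)%R ->
  \sum_(j <oo) (tpow j r)%:E = (expR r)%:E.
Proof.
move=> r0; apply/cvg_lim => //.
rewrite (_ : (fun n => \sum_(0 <= j < n) (tpow j r)%:E) =
    EFin \o series (exp_coeff r)).
  apply: cvg_EFin; first by near=> n.
  exact: is_cvg_series_exp_coeff.
by apply/funext => n /=; rewrite sumEFin.
Unshelve. all: end_near. Qed.

Lemma nneseries_poisson (r : R) : (0 <= r)%R ->
  \sum_(j <oo) (expR (- r) * tpow j r)%:E = 1.
Proof.
move=> r0; under eq_eseriesr do rewrite EFinM.
rewrite ge0_nneseriesZl ?lee_fin ?expR_ge0//; last first.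
  by move=> n; rewrite lee_fin tpow_ge0.
by rewrite nneseries_tpow// -EFinM -expRD addNr expR0.
Qed.

Lemma integral_expo_le (r : R) (r0 : (0 < r)%R) (tau : R) (f : R -> \bar R) :
  measurable_fun setT f -> (forall x, 0 <= f x) ->
  \int[expo r0]_s (if (s <= tau)%R then f s else 0) =
  \int[lebesgue_measure]_(s in `[0%R, tau]) (f s * (r * expR (- (r * s)))%:E).
Proof.
move=> mf f0; rewrite integral_expo//; last first.
- by move=> s; case: ifP.
- by apply: measurable_fun_ifT => //; exact: measurable_fun_ler.
rewrite [LHS]integral_mkcond [RHS]integral_mkcond; apply: eq_integral => s _.
rewrite !patchE !mem_setE !in_itv/= andbT.
by case: (0 <= s)%R; case: (s <= tau)%R => //=; rewrite mul0e.
Qed.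

Lemma nneseries_recl0 (f : nat -> \bar R) : (forall k, 0 <= f k) ->
  \sum_(k <oo) f k = f 0%N + \sum_(k <oo) f k.+1.
Proof.
move=> f0; rewrite nneseries_recl//; congr (_ + _).
by rewrite -nneseries_addn//; under [LHS]eq_eseriesr do rewrite addn1.
Qed.

(** During [tau] units of work the completions form a Poisson process of rate 1, and [drop] absorbs
    those beyond the end of the list. The induction splits on whether the first job is completed,
    and at which time [s]. *)
Lemma avg_serve (F : seq (R * R) -> \bar R) (tau : R) ps : (0 <= tau)%R ->
  measurable_fun setT F -> (forall l, 0 <= F l) ->
  avg (fun l => F (serve tau l)) ps =
  \sum_(j <oo) (expR (- tau) * tpow j tau)%:E * avg F (drop j ps).
Proof.
move=> + mF F0; elim: ps tau => [|p ps IH] tau tau0.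
  rewrite /= ge0_nneseriesZr//.
    by rewrite nneseries_poisson// mul1e.
  by move=> n; rewrite lee_fin mulr_ge0 ?expR_ge0 ?tpow_ge0.
have pois_ge0 j : (0 <= expR (- tau) * tpow j tau)%R.
  by rewrite mulr_ge0 ?expR_ge0 ?tpow_ge0.
rewrite nneseries_recl0; last first.
  by move=> n; rewrite mule_ge0 ?avg_ge0// lee_fin.
pose served s := avg (fun l => F (serve (tau - s) l)) ps.
pose phi s := avg (fun l => F ((p, s) :: l)) ps.
have mserved : measurable_fun setT served.
  apply: (measurable_avg (H := fun z : R * seq (R * R) => F (serve (tau - z.1) z.2))) => //.
  apply: measurableT_comp mF _; apply: measurable_fun_serve; last exact: measurable_snd.
  by apply: measurable_funB => //; exact: measurable_fst.
have mphi : measurable_fun setT phi.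
  apply: (measurable_avg (H := fun z : R * seq (R * R) => F ((p, z.1) :: z.2))) => //.
  apply: measurableT_comp mF _; apply: measurable_fun_cons; last exact: measurable_snd.
  by apply: measurable_fun_pair => //; exact: measurable_fst.
have served0 s : 0 <= served s by exact: avg_ge0.
have phi0 s : 0 <= phi s by exact: avg_ge0.
rewrite /= (eq_integral (fun s : R => (if (s <= tau)%R then served s else 0) +
    (if (s <= tau)%R then 0 else phi (s - tau)%R))); last first.
  move=> s _; case: (leP s tau) => stau; rewrite ?adde0 ?add0e.
    by apply: eq_avg => l.
  by apply: eq_avg => l.
rewrite ge0_integralD//; last 4 first.
- by move=> s _; case: ifP.
- by apply: measurable_fun_ifT => //; exact: measurable_fun_ler.
- by move=> s _; case: ifP.
- apply: measurable_fun_ifT => //; first exact: measurable_fun_ler.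
  by apply: measurableT_comp mphi _; exact: measurable_funB.
(* The case where the first job survives is the term [j = 0]: by memorylessness its residual service
   is exponential again. *)
rewrite addeC; congr (_ + _).
  by rewrite /service_prob expo_memoryless// tpow0 mulr1 mul1r.
rewrite /service_prob integral_expo_le//.
(* The service density at [s] and the exponential factor for the time [tau - s] left to the other
   jobs multiply to [expR (- tau)], which does not involve [s]. *)
rewrite (eq_integral (fun s : measurableTypeR R => \sum_(j <oo)
    (expR (- tau) * tpow j (tau - s))%:E * avg F (drop j ps))); last first.
  move=> s; rewrite inE /= in_itv/= => /andP[s0 stau].
  rewrite /served IH ?subr_ge0// -ge0_nneseriesZr.
  - apply: eq_eseriesr => j _; rewrite muleAC -EFinM; congr (_%:E * _).
    by rewrite !mul1r mulrAC -expRD; congr (expR _ * _)%R; ring.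
  - by rewrite lee_fin mul1r expR_ge0.
  - move=> j; rewrite mule_ge0 ?avg_ge0// lee_fin.
    by rewrite mulr_ge0 ?expR_ge0 ?tpow_ge0 ?subr_ge0.
rewrite integral_nneseries//; last 2 first.
- move=> j; apply/measurable_funTS/emeasurable_funM; last exact: measurable_cst.
  apply/measurable_EFinP/measurable_funM; first exact: measurable_cst.
  by apply: measurableT_comp (measurable_tpow _) _; exact: measurable_funB.
- move=> j s; rewrite /= in_itv/= => /andP[s0 stau].
  rewrite mule_ge0 ?avg_ge0// lee_fin.
  by rewrite mulr_ge0 ?expR_ge0 ?tpow_ge0 ?subr_ge0.
apply: eq_eseriesr => j _ /=.
(* The trivial factor [tpow 0 s] brings the integrand into the form of the beta integral, which
   raises the index [j] to [j.+1]. *)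
rewrite (eq_integral (fun s : measurableTypeR R => (avg F (drop j ps) * (expR (- tau))%:E) *
  (tpow 0 s * tpow j (tau - s))%:E)); last first.
  by move=> s _; rewrite tpow0 mul1r muleC EFinM muleA.
rewrite ge0_integralZl//.
- by rewrite integral_tpow_beta// add0n -muleA -EFinM muleC.
- apply/measurable_funTS/measurable_EFinP/measurable_funM; first exact: measurable_tpow.
  by apply: measurableT_comp (measurable_tpow _) _; exact: measurable_funB.
- move=> s; rewrite /= in_itv/= => /andP[s0 stau].
  by rewrite lee_fin mulr_ge0 ?tpow_ge0 ?subr_ge0.
- by rewrite mule_ge0 ?avg_ge0// lee_fin expR_ge0.
Qed.

End exponential_integrals.

Lemma nneseries_diagonal (R : realType) (a : nat -> nat -> \bar R) :
  (forall j m, 0 <= a j m)%E ->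
  (\sum_(j <oo) \sum_(m <oo) a j m =
   \sum_(M <oo) \sum_(j < M.+1) a j (M - j)%N)%E.
Proof.
move=> a0; pose b j M := if (j <= M)%N then a j (M - j)%N else 0%E.
have b0 j M : (0 <= b j M)%E by rewrite /b; case: ifP.
transitivity (\sum_(j <oo) \sum_(M <oo) b j M)%E.
  apply: eq_eseriesr => j _.
  rewrite [RHS](nneseries_split 0 j); last by move=> k _; exact: b0.
  rewrite big1_seq ?add0e; last first.
    by move=> k; rewrite mem_index_iota add0n /b => /andP[_ /andP[_ kj]]; rewrite leqNgt kj.
  rewrite add0n -[RHS]nneseries_addn//.
  by apply: eq_eseriesr => m _; rewrite /b leq_addl addnK.
rewrite nneseries_interchange//; apply: eq_eseriesr => M _.
rewrite [LHS](nneseries_split 0 M.+1); last by move=> k _; exact: b0.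
rewrite [X in (_ + X)%E]eseries0 ?adde0; last first.
  by move=> k; rewrite add0n /b => Mk _; rewrite leqNgt Mk.
rewrite add0n big_mkord; apply: eq_bigr => j _.
by rewrite /b -ltnS ltn_ord.
Qed.

(** * Words of arrivals and departures *)

Section semigroup.
Context (R : realType) (rho : R) (rho_gt0 : 0 < rho).
Local Open Scope ereal_scope.

(** Invariance under permutations lets a list stand for a point measure; sorting then never changes
    a value of [f]. *)
Definition regular (f : seq R -> \bar R) :=
  [/\ measurable_fun setT f, forall x, 0 <= f x &
      forall x y, perm_eq x y -> f x = f y].

Lemma sort_sym (f : seq R -> \bar R) x :
  (forall x y, perm_eq x y -> f x = f y) -> f (sort (@higher R) x) = f x.
Proof. by apply; rewrite perm_sort. Qed.

Lemma measurable_arrive (f : seq R -> \bar R) : measurable_fun setT f ->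
  (forall x, 0 <= f x) -> measurable_fun setT (arrive f).
Proof.
move=> mf f0; apply: (measurable_fun_integral (unif R)
  (f := fun z : seq R * R => f (z.2 :: z.1))) => //.
apply: measurableT_comp mf _.
by apply: measurable_fun_cons; [exact: measurable_snd|exact: measurable_fst].
Qed.

Lemma measurable_cons1 (f : seq R -> \bar R) x : measurable_fun setT f ->
  measurable_fun setT (fun u => f (u :: x)).
Proof. by move=> mf; apply: measurableT_comp mf _; exact: measurable_fun_cons. Qed.

Lemma arrive_ge0 (f : seq R -> \bar R) x : (forall y, 0 <= f y) -> 0 <= arrive f x.
Proof. by move=> f0; apply: integral_ge0. Qed.

Lemma regular_arrive f : regular f -> regular (arrive f).
Proof.
move=> [mf f0 fsym]; split; first exact: measurable_arrive.
- by move=> x; apply: integral_ge0.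
- move=> x y xy; apply: eq_integral => u _; apply: fsym.
  by rewrite perm_cons.
Qed.

Lemma sort_higher_perm (x y : seq R) : perm_eq x y ->
  sort (@higher R) x = sort (@higher R) y.
Proof.
by move=> xy; apply/perm_sortP => //; [exact: higher_total|exact: higher_trans|exact: higher_anti].
Qed.

Lemma measurable_sort_higher : measurable_fun setT (sort (@higher R)).
Proof.
apply: measurable_sort; [exact: higher_total|exact: higher_trans|].
exact: measurable_higher.
Qed.

Lemma regular_depart f : regular f -> regular (depart f).
Proof.
move=> [mf f0 fsym]; split.
- rewrite (_ : depart f = f \o (behead \o sort (@higher R)))//.
  apply: measurableT_comp mf _.
  apply: (measurableT_comp (@measurable_behead_seq _ R)).
  exact: measurable_sort_higher.
- by move=> x; exact: f0.
- by move=> x y xy; rewrite /depart (sort_higher_perm xy).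
Qed.

(* [words M n f]: the sum over the words in [n] letters [rho * arrive] and
   [M - n] letters [depart], applied to [f]. *)
Fixpoint words (M n : nat) (f : seq R -> \bar R) : seq R -> \bar R :=
  match M with
  | 0%N => if n is 0%N then f else cst 0
  | M'.+1 => fun x => depart (words M' n f) x +
      (if n is n'.+1 then rho%:E * arrive (words M' n' f) x else 0)
  end.

Lemma regular_words M n f : regular f -> regular (words M n f).
Proof.
move=> rf; elim: M n => [|M IH] [|n] //=.
- have [mW W0 Wsym] := regular_depart (IH 0%N).
  split.
  + by apply: emeasurable_funD => //; exact: measurable_cst.
  + by move=> x; rewrite adde0.
  + by move=> x y xy; rewrite !adde0 (Wsym _ _ xy).
- have [mD D0 Dsym] := regular_depart (IH n.+1).
  have [mA A0 Asym] := regular_arrive (IH n).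
  split.
  + by apply: emeasurable_funD => //; exact: measurable_funeM.
  + by move=> x; rewrite adde_ge0// mule_ge0// lee_fin ltW.
  + by move=> x y xy; rewrite (Dsym _ _ xy) (Asym _ _ xy).
Qed.

Lemma words_ge0 M n f x : regular f -> 0 <= words M n f x.
Proof. by move=> /regular_words => /(_ M n)[]. Qed.

Lemma words0 M f x : regular f -> words M 0 f x = f (drop M (sort (@higher R) x)).
Proof.
move=> [_ _ fsym]; elim: M x => [|M IH] x /=; first by rewrite drop0 sort_sym.
rewrite adde0 /depart IH -drop1 (sorted_sort (@higher_trans R)) ?drop_drop ?addn1//.
by apply: drop_sorted; apply: sort_sorted; exact: higher_total.
Qed.

(** A word is cut at its first arrival: [j] departures precede it and [M - j.+1] letters follow.
    This matches conditioning the queue on its first arrival. *)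
Lemma wordsS M n f x : regular f ->
  words M n.+1 f x = rho%:E * \sum_(j < M)
    arrive (words (M - j.+1) n f) (drop j (sort (@higher R) x)).
Proof.
move=> rf; elim: M x => [|M IH] x; first by rewrite big_ord0 mule0.
have [mA A0 Asym] := regular_arrive (regular_words M n rf).
rewrite [LHS]/= /depart IH big_ord_recl.
rewrite [RHS]ge0_muleDr; last 2 first.
- by apply: arrive_ge0 => y; exact: words_ge0.
- by apply: sume_ge0 => j _; apply: arrive_ge0 => y; exact: words_ge0.
rewrite subn1 /= drop0 sort_sym// addeC; congr (_ + _ * _).
apply: eq_bigr => j _; rewrite /bump add1n subSS.
rewrite (sorted_sort (@higher_trans R)); first by rewrite -drop1 drop_drop addn1.
rewrite -drop1.
by apply: drop_sorted; apply: sort_sorted; exact: higher_total.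
Qed.

(** The generator of the priority process plus [1 + rho] times the identity, hence a positive
    operator whose exponential series has only nonnegative terms. *)
Definition evolve (f : seq R -> \bar R) : seq R -> \bar R :=
  fun x => depart f x + rho%:E * arrive f x.

Lemma regular_evolve f : regular f -> regular (evolve f).
Proof.
move=> rf; have [mD D0 Dsym] := regular_depart rf.
have [mA A0 Asym] := regular_arrive rf; split.
- by apply: emeasurable_funD => //; exact: measurable_funeM.
- by move=> x; rewrite adde_ge0// mule_ge0// lee_fin ltW.
- by move=> x y xy; rewrite /evolve (Dsym _ _ xy) (Asym _ _ xy).
Qed.

Lemma regular_iter_evolve M f : regular f -> regular (iter M evolve f).
Proof. by move=> rf; elim: M => //= M; exact: regular_evolve. Qed.

(** The noncommutative binomial expansion of the [M]-th power, graded by the number of arrivals;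
    words with more arrivals than letters contribute 0. *)
Lemma nneseries_words M f x : regular f ->
  \sum_(n <oo) words M n f x = iter M evolve f x.
Proof.
move=> rf; have W0 := fun M n x => words_ge0 M n x rf.
elim: M x => [|M IH] x /=.
  rewrite nneseries_recl0; last by case=> //=; case: rf.
  by rewrite eseries0// adde0.
rewrite nneseriesD//; last 2 first.
- by move=> n _ _; rewrite /depart.
- case=> // n _ _; apply: mule_ge0; first by rewrite lee_fin ltW.
  by apply: arrive_ge0 => y; exact: words_ge0.
rewrite /evolve; congr (_ + _); first exact: IH.
rewrite nneseries_recl0 ?add0e; last first.
  case=> // n; apply: mule_ge0; first by rewrite lee_fin ltW.
  by apply: arrive_ge0 => y; exact: words_ge0.
rewrite ge0_nneseriesZl ?lee_fin ?(ltW rho_gt0)//; last first.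
  by move=> n; apply: arrive_ge0 => y; exact: words_ge0.
congr (_ * _); rewrite -integral_nneseries//.
  by apply: eq_integral => u _; exact: IH.
by move=> n; apply: measurable_cons1; case: (regular_words M n rf).
Qed.

End semigroup.

(** * The queue with a prescribed number of arrivals *)

Section flow.
Context (R : realType) (rho : R) (rho_gt0 : 0 < rho).
Local Open Scope ereal_scope.

Lemma measurable_map_fst :
  measurable_fun setT (map fst : seq (R * R) -> seq R).
Proof.
apply: measurable_fun_seq => [|i].
  by under eq_fun do rewrite size_map; exact: measurable_size.
rewrite (_ : (fun t => _) = (fun l : seq (R * R) => (nth point l i).1)).
  exact: measurableT_comp measurable_fst (@measurable_nth _ _ i).
by apply/funext => l; elim: l i => [|c l IH] [|i] //=.
Qed.

Lemma avg_run (F : seq (R * R) -> \bar R) (tau : R) ps : (0 <= tau)%R ->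
  measurable_fun setT F -> (forall l, 0 <= F l) ->
  avg (fun l => F (run tau l)) ps =
  \sum_(j <oo) (expR (- tau) * tpow j tau)%:E * avg F (drop j (sort (@higher R) ps)).
Proof.
move=> tau0 mF F0; rewrite /run (avg_sort (F := fun l => F (serve tau l)))//.
  exact: avg_serve.
apply: measurableT_comp mF _; apply: measurable_fun_serve => //.
Qed.

Lemma arrive_nneseries (f : nat -> seq R -> \bar R) x :
  (forall n, measurable_fun setT (f n)) -> (forall n y, 0 <= f n y) ->
  arrive (fun y => \sum_(n <oo) f n y) x = \sum_(n <oo) arrive (f n) x.
Proof.
move=> mf f0; rewrite /arrive integral_nneseries// => n.
exact: measurable_cons1.
Qed.

Lemma arriveZ (f : seq R -> \bar R) (c : \bar R) x : 0 <= c ->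
  measurable_fun setT f -> (forall y, 0 <= f y) ->
  arrive (fun y => c * f y) x = c * arrive f x.
Proof.
by move=> c0 mf f0; rewrite /arrive ge0_integralZl//; exact: measurable_cons1.
Qed.

Lemma arrive0 x : arrive (fun _ : seq R => 0) x = 0.
Proof. by rewrite /arrive integral0. Qed.

(* A state [(r, l)] consists of the remaining time [r] and of the jobs [l]. *)
Definition start (f : seq R -> \bar R) (z : R * seq (R * R)) : \bar R :=
  if (0 <= z.1)%R then (expR (- (rho * z.1)))%:E * f (map fst (run z.1 z.2))
  else 0.

(** One interarrival time followed by one arrival. The remaining time may turn negative; [start]
    vanishes there, which discards arrivals beyond the horizon. *)
Definition step (G : R * seq (R * R) -> \bar R) (z : R * seq (R * R)) :=
  \int[expo rho_gt0]_g arrive_job (fun l => G ((z.1 - g)%R, l)) (run g z.2).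

(** The factor in [start] is the probability of no arrival during the remaining time, so this is the
    mean of [f] at the horizon on the event of exactly [n] arrivals. *)
Definition flow n f := iter n step (start f).

Lemma start_ge0 f z : (forall x, 0 <= f x) -> 0 <= start f z.
Proof.
by move=> f0; rewrite /start; case: ifP => // _; rewrite mule_ge0// lee_fin expR_ge0.
Qed.

Lemma measurable_start f : measurable_fun setT f -> measurable_fun setT (start f).
Proof.
move=> mf; apply: measurable_fun_ifT.
- by apply: measurable_fun_ler => //; exact: measurable_fst.
- apply: emeasurable_funM.
    apply/measurable_EFinP; apply: measurableT_comp (@measurable_expR R) _.
    by apply: measurable_funN; apply: measurable_funM => //; exact: measurable_fst.
  apply: measurableT_comp mf _; apply: measurableT_comp measurable_map_fst _.
  by apply: measurable_fun_run; [exact: measurable_fst|exact: measurable_snd].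
- exact: measurable_cst.
Qed.

Lemma step_ge0 G z : (forall z, 0 <= G z) -> 0 <= step G z.
Proof.
by move=> G0; apply: integral_ge0 => g _; apply: integral_ge0 => p _; apply: integral_ge0.
Qed.

Lemma measurable_step_arrive G : measurable_fun setT G -> (forall z, 0 <= G z) ->
  measurable_fun setT (fun z : (R * seq (R * R)) * R =>
    arrive_job (fun l => G ((z.1.1 - z.2)%R, l)) (run z.2 z.1.2)).
Proof.
move=> mG G0; rewrite /arrive_job.
apply: (measurable_fun_integral (unif R) (f := fun y : ((R * seq (R * R)) * R) * R =>
  \int[service_prob R]_s G ((y.1.1.1 - y.1.2)%R, (y.2, s) :: run y.1.2 y.1.1.2))); last first.
  by move=> y; apply: integral_ge0.
apply: (measurable_fun_integral (service_prob R)
  (f := fun y : (((R * seq (R * R)) * R) * R) * R =>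
   G ((y.1.1.1.1 - y.1.1.2)%R, (y.1.2, y.2) :: run y.1.1.2 y.1.1.1.2))) => //.
have m1 : measurable_fun setT (fun y : (((R * seq (R * R)) * R) * R) * R => y.1.1).
  exact: measurableT_comp measurable_fst measurable_fst.
have m2 : measurable_fun setT (fun y : (((R * seq (R * R)) * R) * R) * R => y.1.1.1).
  exact: measurableT_comp measurable_fst m1.
have m3 : measurable_fun setT (fun y : (((R * seq (R * R)) * R) * R) * R => y.1.1.2).
  exact: measurableT_comp measurable_snd m1.
apply: measurableT_comp mG _; apply: measurable_fun_pair.
  by apply: measurable_funB => //; exact: measurableT_comp measurable_fst m2.
apply: measurable_fun_cons.
  apply: measurable_fun_pair; last exact: measurable_snd.
  exact: measurableT_comp measurable_snd measurable_fst.
by apply: measurable_fun_run => //; exact: measurableT_comp measurable_snd m2.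
Qed.

Lemma measurable_step G : measurable_fun setT G -> (forall z, 0 <= G z) ->
  measurable_fun setT (step G).
Proof.
move=> mG G0.
apply: (measurable_fun_integral (expo rho_gt0)
  (f := fun z : (R * seq (R * R)) * R =>
    arrive_job (fun l => G ((z.1.1 - z.2)%R, l)) (run z.2 z.1.2))).
  exact: measurable_step_arrive.
by move=> z; apply: integral_ge0 => p _; apply: integral_ge0.
Qed.

Lemma flow_ge0 n f z : (forall x, 0 <= f x) -> 0 <= flow n f z.
Proof.
by move=> f0; elim: n z => [|n IH] z; [exact: start_ge0|exact: step_ge0].
Qed.

Lemma measurable_flow n f : measurable_fun setT f -> (forall x, 0 <= f x) ->
  measurable_fun setT (flow n f).
Proof.
move=> mf f0; elim: n => [|n IH]; first exact: measurable_start.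
by apply: measurable_step => // z; exact: flow_ge0.
Qed.

Let lam := (1 + rho)%R.

(** The uniformized chain after a Poisson number [M] of steps, on the event that [n] of them are
    arrivals. The letters in [words] carry rates instead of probabilities, so the powers of [lam] in
    the Poisson weights have cancelled. *)
Definition flow_series n f (r : R) ps :=
  if (0 <= r)%R then (expR (- (lam * r)))%:E *
    \sum_(M <oo) (tpow M r)%:E * words rho M n f ps
  else 0.

Lemma avg0 ps : avg (fun _ : seq (R * R) => 0) ps = 0.
Proof. exact: (avg_priorities (fun=> 0)). Qed.

Lemma avg_start f r ps : regular f ->
  avg (fun l => start f (r, l)) ps = flow_series 0 f r ps.
Proof.
move=> rf; have [mf f0 fsym] := rf; rewrite /start /flow_series /=.
case: ifPn => r0; last exact: avg0.
have c0 : 0 <= (expR (- (rho * r)))%:E by rewrite lee_fin expR_ge0.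
rewrite (avg_run (F := fun l => (expR (- (rho * r)))%:E * f (map fst l)))//.
- rewrite -ge0_nneseriesZl ?lee_fin ?expR_ge0//; last first.
    by move=> M; rewrite mule_ge0 ?words_ge0// lee_fin tpow_ge0.
  apply: eq_eseriesr => M _; rewrite words0//.
  rewrite (avg_priorities (fun x => (expR (- (rho * r)))%:E * f x)).
  rewrite !muleA -!EFinM; congr (_%:E * _).
  by rewrite mulrAC -expRD; congr (expR _ * _)%R; rewrite /lam; ring.
- by apply: measurable_funeM; apply: measurableT_comp mf measurable_map_fst.
- by move=> l; rewrite mule_ge0.
Qed.

Lemma arrive_flow_series n f r y : regular f -> (0 <= r)%R ->
  arrive (flow_series n f r) y =
  (expR (- (lam * r)))%:E * \sum_(M <oo) (tpow M r)%:E * arrive (words rho M n f) y.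
Proof.
move=> rf r0.
have tW0 M x : 0 <= (tpow M r)%:E * words rho M n f x.
  by rewrite mule_ge0 ?words_ge0// lee_fin tpow_ge0.
have mW M : measurable_fun setT (words rho M n f) by case: (regular_words rho_gt0 M n rf).
rewrite (_ : flow_series n f r = fun ps => (expR (- (lam * r)))%:E *
    \sum_(M <oo) (tpow M r)%:E * words rho M n f ps); last first.
  by apply/funext => ps; rewrite /flow_series r0.
rewrite arriveZ ?lee_fin ?expR_ge0//; last 2 first.
- by apply: ge0_emeasurable_sum => // M _; exact: measurable_funeM.
- by move=> x; apply: nneseries_ge0.
rewrite arrive_nneseries//; last by move=> M; exact: measurable_funeM.
congr (_ * _); apply: eq_eseriesr => M _; rewrite arriveZ ?lee_fin ?tpow_ge0//.
by move=> x; exact: words_ge0.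
Qed.

(** Conditioning on the first gap [g]: [avg_run] accounts for the departures before [g], the
    induction hypothesis for the time [r - g] after the arrival. The exponentials combine to a
    factor free of [g], and the powers of [g] and [r - g] convolve by the beta integral. *)
Lemma avg_flow n f r ps : regular f ->
  avg (fun l => flow n f (r, l)) ps = flow_series n f r ps.
Proof.
move=> rf; have [mf f0 fsym] := rf.
elim: n r ps => [|n IH] r ps; first exact: avg_start.
have mF := measurable_flow n mf f0.
have F0 := fun z => flow_ge0 n z f0.
pose h g := avg (fun l => arrive_job (fun l' => flow n f ((r - g)%R, l')) (run g l)) ps.
have H0 (z : R * seq (R * R)) :
    0 <= arrive_job (fun l' => flow n f ((r - z.1)%R, l')) (run z.1 z.2).
  by apply: integral_ge0 => p _; apply: integral_ge0.
have mH : measurable_fun setT (fun z : R * seq (R * R) =>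
    arrive_job (fun l' => flow n f ((r - z.1)%R, l')) (run z.1 z.2)).
  apply: (measurableT_comp (measurable_step_arrive mF F0)
    (g := fun z : R * seq (R * R) => ((r, z.2), z.1))).
  apply: measurable_fun_pair; last exact: measurable_fst.
  by apply: measurable_fun_pair; [exact: measurable_cst|exact: measurable_snd].
have mh : measurable_fun setT h by exact: (measurable_avg ps mH).
have h0 g : 0 <= h g by apply: avg_ge0 => l; exact: (H0 (g, l)).
transitivity (\int[expo rho_gt0]_g h g).
  exact: (avg_integral _ ps mH).
pose s := sort (@higher R) ps.
pose c j m := arrive (words rho m n f) (drop j s).
have c0 j m : 0 <= c j m by apply: arrive_ge0 => y; exact: words_ge0.
(* Here [j] counts the departures before the first arrival and [m] the letters after it. A gap
   longer than [r] contributes nothing. *)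
have hE g : (0 <= g)%R -> h g = if (g <= r)%R then
    \sum_(j <oo) \sum_(m <oo)
      (expR (- g) * expR (- (lam * (r - g))) * (tpow j g * tpow m (r - g)))%:E * c j m
    else 0.
  move=> g0; rewrite /h (avg_run (F := arrive_job (fun l' => flow n f ((r - g)%R, l'))))//.
  - have mFg : measurable_fun setT (fun l' => flow n f ((r - g)%R, l')).
      apply: (measurableT_comp mF (g := fun l => ((r - g)%R, l))).
      by apply: measurable_fun_pair => //; exact: measurable_cst.
    transitivity (\sum_(j <oo) (expR (- g) * tpow j g)%:E *
        arrive (flow_series n f (r - g)) (drop j s)).
      apply: eq_eseriesr => j _; congr (_ * _).
      rewrite (avg_arrive_job (F := fun l' => flow n f ((r - g)%R, l')))//.
      by congr arrive; apply/funext => y; exact: IH.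
    case: (leP g r) => gr; last first.
      apply: eseries0 => j _ _; rewrite (_ : flow_series _ _ _ = fun=> 0) ?arrive0 ?mule0//.
      by apply/funext => y; rewrite /flow_series leNgt subr_lt0 gr.
    apply: eq_eseriesr => j _; rewrite arrive_flow_series ?subr_ge0//.
    rewrite -!ge0_nneseriesZl.
    + apply: eq_eseriesr => m _; rewrite !muleA -!EFinM; congr (_%:E * _).
      by ring.
    + by rewrite lee_fin mulr_ge0 ?expR_ge0 ?tpow_ge0.
    + by move=> m; rewrite !mule_ge0 ?c0 ?lee_fin ?expR_ge0 ?tpow_ge0 ?subr_ge0.
    + by rewrite lee_fin expR_ge0.
    + by move=> m; rewrite !mule_ge0 ?c0 ?lee_fin ?expR_ge0 ?tpow_ge0 ?subr_ge0.
  - rewrite /arrive_job.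
    apply: (measurable_fun_integral (unif R) (f := fun z : seq (R * R) * R => \int[service_prob R]_s0
       flow n f ((r - g)%R, (z.2, s0) :: z.1))); last by move=> z; exact: integral_ge0.
    apply: (measurable_fun_integral (service_prob R)
      (f := fun z : (seq (R * R) * R) * R => flow n f ((r - g)%R, (z.1.2, z.2) :: z.1.1))) => //.
    apply: measurableT_comp mF _; apply: measurable_fun_pair; first exact: measurable_cst.
    apply: measurable_fun_cons; last exact: measurableT_comp measurable_fst measurable_fst.
    apply: measurable_fun_pair; last exact: measurable_snd.
    exact: measurableT_comp measurable_snd measurable_fst.
  - by move=> l; apply: integral_ge0 => p _; exact: integral_ge0.
pose k := (expR (- (lam * r)))%:E.
have k0 : 0 <= k by rewrite lee_fin expR_ge0.
transitivity (\int[lebesgue_measure]_(g in `[0%R, r])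
    \sum_(j <oo) \sum_(m <oo) (k * rho%:E * c j m) * (tpow j g * tpow m (r - g))%:E).
  rewrite integral_expo// [LHS]integral_mkcond [RHS]integral_mkcond.
  apply: eq_integral => g _; rewrite !patchE !mem_setE !in_itv/= andbT.
  case: (leP 0%R g) => //= g0; rewrite hE//.
  case: (leP g r) => gr; last by rewrite mul0e.
  have tt0 j m : (0 <= tpow j g * tpow m (r - g))%R.
    by rewrite mulr_ge0 ?tpow_ge0 ?subr_ge0.
  have rg0 : (0 <= rho * expR (- (rho * g)))%R by rewrite mulr_ge0 ?expR_ge0 ?ltW.
  have ee0 : (0 <= expR (- g) * expR (- (lam * (r - g))))%R by rewrite mulr_ge0 ?expR_ge0.
  rewrite -ge0_nneseriesZr; last 2 first.
  - by rewrite lee_fin.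
  - by move=> j; apply: nneseries_ge0 => m _ _; rewrite mule_ge0// lee_fin mulr_ge0.
  apply: eq_eseriesr => j _; rewrite -ge0_nneseriesZr; last 2 first.
  - by rewrite lee_fin.
  - by move=> m; rewrite mule_ge0// lee_fin mulr_ge0.
  apply: eq_eseriesr => m _.
  rewrite muleAC -EFinM [RHS]muleAC /k -!EFinM; congr (_%:E * _).
  have -> : expR (- (lam * r)) =
      (expR (- g) * expR (- (lam * (r - g))) * expR (- (rho * g)))%R.
    by rewrite -!expRD; congr expR; rewrite /lam; ring.
  by ring.
rewrite /flow_series; case: ifPn => [r0|]; last first.
  rewrite -ltNge => r0; rewrite set_itv_ge ?integral_set0//.
  by rewrite bnd_simp -ltNge.
have krc0 j m : 0 <= k * rho%:E * c j m.
  by rewrite !mule_ge0// lee_fin ltW.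
have mt j m : measurable_fun (`[0%R, r]%classic : set (measurableTypeR R))
    (fun g => (tpow j g * tpow m (r - g))%:E).
  apply/measurable_funTS/measurable_EFinP/measurable_funM; first exact: measurable_tpow.
  by apply: measurableT_comp (measurable_tpow _) _; exact: measurable_funB.
have t0 j m (g : R) : `[0%R, r]%classic g -> 0 <= (tpow j g * tpow m (r - g))%:E.
  rewrite /= in_itv/= => /andP[g0 gr].
  by rewrite lee_fin mulr_ge0 ?tpow_ge0 ?subr_ge0.
rewrite integral_nneseries//; last 2 first.
- by move=> j; apply: ge0_emeasurable_sum => // m *; [exact: mule_ge0 (t0 _ _ _ _)|exact: measurable_funeM].
- by move=> j g gr; apply: nneseries_ge0 => m *; exact: mule_ge0 (t0 _ _ _ _).
transitivity (\sum_(j <oo) \sum_(m <oo) (k * rho%:E * c j m) * (tpow (j + m).+1 r)%:E).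
  apply: eq_eseriesr => j _; rewrite integral_nneseries//; last 2 first.
  - by move=> m; exact: measurable_funeM.
  - by move=> m g gr; exact: mule_ge0 (t0 _ _ _ _).
  apply: eq_eseriesr => m _; rewrite ge0_integralZl//; last exact: t0.
  by rewrite integral_tpow_beta.
(* Terms are grouped by [M = j + m]. The word has [M.+1] letters because the first arrival is a
   letter too, hence the index shift on the other side, whose term for the empty word is 0. *)
rewrite (nneseries_diagonal (a := fun j m => k * rho%:E * c j m * (tpow (j + m).+1 r)%:E)); last first.
  by move=> j m; apply: mule_ge0 => //; rewrite lee_fin tpow_ge0.
rewrite [in RHS]nneseries_recl0; last first.
  move=> M; apply: (@mule_ge0 _ (tpow M r)%:E); last exact: words_ge0.
  by rewrite lee_fin tpow_ge0.
rewrite [words _ 0 _ _ _]/= mule0 add0e -ge0_nneseriesZl//; last first.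
  by move=> M; rewrite mule_ge0 ?words_ge0// lee_fin tpow_ge0.
apply: eq_eseriesr => M _; rewrite wordsS// -/s.
under eq_bigr => j _.
  rewrite subnKC; last by rewrite -ltnS.
  over.
rewrite /= -ge0_sume_distrl; last by move=> j _; exact: krc0.
rewrite -ge0_sume_distrr; last by move=> j _; exact: c0.
rewrite muleC -muleA [RHS]muleCA; congr (_ * (_ * _)).
Qed.

End flow.

(** * The law of the priorities at a fixed time *)

Section queue.
Local Open Scope ereal_scope.
Context (R : realType) d (T : measurableType d) (P : probability T R).
Context (rho : R) (rho_gt0 : (0 < rho)%R).
Context (q : queue_input P) (q_laws : queue_laws rho q).

Lemma input_events_measurable i : input_events q i `<=` measurable.
Proof.
by move=> A; case: i => [[k|[c|c]]|] /= [B mB <-]; exact: measurable_funP.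
Qed.

Lemma input_eventsT i : input_events q i setT.
Proof.
by case: i => [[k|[c|c]]|]; exists setT; rewrite ?setTI// preimage_setT.
Qed.

Lemma input_eventsI i : setI_closed (input_events q i).
Proof.
by case: i => [[k|[c|c]]|] _ _ [A mA <-] [B mB <-]; exists (A `&` B) => //;
  try exact: measurableI; rewrite !setTI preimage_setI.
Qed.

Notation hist := (history (input_events q)).

(** The inputs that determine the state just after the [n]-th arrival, together with all inputs of
    the initial customers. *)
Definition past (n : nat) : set (option (nat + (customer + customer))) :=
  [set i | match i with
    | None => True
    | Some (inl k) => (k < n)%N
    | Some (inr (inl (inr k))) | Some (inr (inr (inr k))) => (k < n)%N
    | _ => True
    end].

Lemma measurable_init_num S : S None -> measurable_fun [set: hist S] (init_num q : T -> nat).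
Proof.
move=> SN; apply: (measurable_history_coord (i := None)) => // A mA.
by exists A => //; rewrite setTI.
Qed.

Lemma measurable_gap S k : S (Some (inl k)) ->
  measurable_fun [set: hist S] (gap q k : T -> R).
Proof.
move=> SN; apply: (measurable_history_coord (i := Some (inl k))) => // A mA.
by exists A => //; rewrite setTI.
Qed.

Lemma measurable_service S c : S (Some (inr (inl c))) ->
  measurable_fun [set: hist S] (service q c : T -> R).
Proof.
move=> SN; apply: (measurable_history_coord (i := Some (inr (inl c)))) => // A mA.
by exists A => //; rewrite setTI.
Qed.

Lemma measurable_priority S c : S (Some (inr (inr c))) ->
  measurable_fun [set: hist S] (priority q c : T -> R).
Proof.
move=> SN; apply: (measurable_history_coord (i := Some (inr (inr c)))) => // A mA.
by exists A => //; rewrite setTI.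
Qed.

Lemma measurable_arrival_time S n : past n `<=` S ->
  measurable_fun [set: hist S] (arrival_time q n : T -> R).
Proof.
move=> nS; apply: measurable_sum => k; apply: measurable_gap.
by apply: nS => /=.
Qed.

Definition jobs_of (r : seq nat) (w : T) : seq (R * R) :=
  [seq (priority q (inl i) w, service q (inl i) w) | i <- r].

Lemma measurable_jobs_of (S : set (option (nat + (customer + customer)))) (r : seq nat) :
  (forall i, i \in r -> S (Some (inr (inl (inl i)))) /\ S (Some (inr (inr (inl i))))) ->
  measurable_fun [set: hist S] (jobs_of r : T -> _).
Proof.
elim: r => [|i r IH] rS; first exact: measurable_cst.
apply: measurable_fun_cons; last by apply: IH => j jr; apply: rS; rewrite inE jr orbT.
have [Ss Sp] := rS i (mem_head _ _).
by apply: measurable_fun_pair; [exact: measurable_priority|exact: measurable_service].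
Qed.

Lemma measurable_jobs_after S n : past n `<=` S ->
  measurable_fun [set: hist S] (jobs_after q n : T -> seq (R * R)).
Proof.
elim: n => [|n IH] nS /=.
  apply: (@measurable_fun_glue _ _ (hist S) _ (init_num q) (fun n => jobs_of (iota 0 n))).
    by apply: measurable_init_num; apply: nS.
  by move=> n; apply: measurable_jobs_of => i _; split; apply: nS.
have nS' : past n `<=` S.
  move=> [[k|[[k|k]|[k|k]]]|] /= kn; apply: nS => //=; exact: ltn_trans kn _.
apply: measurable_fun_cons.
  apply: measurable_fun_pair; [apply: measurable_priority|apply: measurable_service];
  by apply: nS => /=.
apply: measurable_fun_run; last exact: IH.
by apply: measurable_gap; apply: nS => /=.
Qed.

Lemma freeze_service S c d2 (E2 : measurableType d2) (Y : T -> E2) (phi : R * E2 -> \bar R) :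
  ~ S (Some (inr (inl c))) -> measurable_fun [set: hist S] (Y : hist S -> E2) ->
  measurable_fun setT phi -> (forall z, 0 <= phi z) ->
  \int[P]_w phi (service q c w, Y w) = \int[P]_w \int[service_prob R]_x phi (x, Y w).
Proof.
move=> Sc mY mphi phi0; apply: (freeze (inputs_independent q_laws) input_events_measurable
  input_eventsT input_eventsI Sc) => // A mA.
  by exists A => //; rewrite setTI.
exact: (service_law q_laws).
Qed.

Lemma freeze_priority S c d2 (E2 : measurableType d2) (Y : T -> E2) (phi : R * E2 -> \bar R) :
  ~ S (Some (inr (inr c))) -> measurable_fun [set: hist S] (Y : hist S -> E2) ->
  measurable_fun setT phi -> (forall z, 0 <= phi z) ->
  \int[P]_w phi (priority q c w, Y w) = \int[P]_w \int[unif R]_x phi (x, Y w).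
Proof.
move=> Sc mY mphi phi0; apply: (freeze (inputs_independent q_laws) input_events_measurable
  input_eventsT input_eventsI Sc) => // A mA.
  by exists A => //; rewrite setTI.
exact: (priority_law q_laws).
Qed.

Lemma freeze_gap S k d2 (E2 : measurableType d2) (Y : T -> E2) (phi : R * E2 -> \bar R) :
  ~ S (Some (inl k)) -> measurable_fun [set: hist S] (Y : hist S -> E2) ->
  measurable_fun setT phi -> (forall z, 0 <= phi z) ->
  \int[P]_w phi (gap q k w, Y w) = \int[P]_w \int[expo rho_gt0]_x phi (x, Y w).
Proof.
move=> Sc mY mphi phi0; apply: (freeze (inputs_independent q_laws) input_events_measurable
  input_eventsT input_eventsI Sc) => // A mA.
  by exists A => //; rewrite setTI.
exact: (gap_law q_laws).
Qed.

Definition state (t : R) n (w : T) : R * seq (R * R) :=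
  ((t - arrival_time q n w)%R, jobs_after q n w).

Lemma measurable_state S t n : past n `<=` S -> measurable_fun [set: hist S] (state t n).
Proof.
move=> nS; apply: measurable_fun_pair; last exact: measurable_jobs_after.
by apply: measurable_funB; [exact: measurable_cst|exact: measurable_arrival_time].
Qed.

Lemma stateS t n w : state t n.+1 w = (((state t n w).1 - gap q n w)%R,
  (priority q (inr n) w, service q (inr n) w) :: run (gap q n w) (state t n w).2).
Proof. by rewrite /state /arrival_time big_ord_recr /= opprD addrA. Qed.

(** The service, the priority and the gap belonging to arrival [n] are integrated out in this order.
    Each lies outside the set of inputs on which the rest of the integrand depends: [S2], then [S1],
    then [past n]. *)
Lemma integral_state_step t n G : measurable_fun setT G -> (forall z, 0 <= G z) ->
  \int[P]_w G (state t n.+1 w) = \int[P]_w step rho_gt0 G (state t n w).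
Proof.
move=> mG G0; under eq_integral do rewrite stateS.
have : forall S, past n `<=` S -> measurable_fun [set: hist S] (state t n).
  by move=> S; exact: measurable_state.
 (* From here on the state matters only through its measurability from the past, so it is made
    opaque. *)
 move: (state t n) => st mst.
pose S1 := past n `|` [set Some (inl n)].
pose S2 := S1 `|` [set Some (inr (inr (inr n)))].
have nS1 : past n `<=` S1 by move=> i; left.
have nS2 : past n `<=` S2 by move=> i /nS1; left.
have S1n : S1 (Some (inl n)) by right.
have S2n : S2 (Some (inl n)) by left.
have S2p : S2 (Some (inr (inr (inr n)))) by right.
pose E := (R * (R * (R * seq (R * R))))%type.
have mrun : measurable_fun setT (fun y : R * E =>
    G ((y.2.2.2.1 - y.2.2.1)%R, (y.2.1, y.1) :: run y.2.2.1 y.2.2.2.2)).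
  have m2 : measurable_fun setT (fun y : R * E => y.2.2).
    exact: measurableT_comp measurable_snd measurable_snd.
  have m21 : measurable_fun setT (fun y : R * E => y.2.2.1).
    exact: measurableT_comp measurable_fst m2.
  have m22 : measurable_fun setT (fun y : R * E => y.2.2.2).
    exact: measurableT_comp measurable_snd m2.
  apply: measurableT_comp mG _; apply: measurable_fun_pair.
    by apply: measurable_funB => //; exact: measurableT_comp measurable_fst m22.
  apply: measurable_fun_cons; last first.
    by apply: measurable_fun_run => //; exact: measurableT_comp measurable_snd m22.
  apply: measurable_fun_pair; last exact: measurable_fst.
  exact: measurableT_comp measurable_fst measurable_snd.
have mswap : measurable_fun setT (fun y : E * R =>
    G ((y.1.2.2.1 - y.1.2.1)%R, (y.1.1, y.2) :: run y.1.2.1 y.1.2.2.2)).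
  apply: (measurableT_comp mrun (g := fun y => (y.2, y.1))).
  by apply: measurable_fun_pair; [exact: measurable_snd|exact: measurable_fst].
have mrun2 := measurable_fun_integral (service_prob R) mswap (fun=> G0 _).
have mrun3 : measurable_fun setT (fun y : R * (R * seq (R * R)) =>
    arrive_job (fun l => G ((y.2.1 - y.1)%R, l)) (run y.1 y.2.2)).
  apply: (measurableT_comp (measurable_step_arrive mG G0) (g := fun y => (y.2, y.1))).
  by apply: measurable_fun_pair; [exact: measurable_snd|exact: measurable_fst].
have mY : measurable_fun [set: hist S1] (fun w => (gap q n w, st w)).
  apply: measurable_fun_pair; first exact: measurable_gap.
  exact: mst.
have mY2 : measurable_fun [set: hist S2]
    (fun w => (priority q (inr n) w, (gap q n w, st w))).
  apply: measurable_fun_pair; first exact: measurable_priority.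
  apply: measurable_fun_pair; first exact: measurable_gap.
  exact: mst.
have S2s : ~ S2 (Some (inr (inl (inr n)))).
  by case=> //; case=> //=; rewrite ltnn.
have S1p : ~ S1 (Some (inr (inr (inr n)))).
  by case=> //=; rewrite ltnn.
have ng : ~ past n (Some (inl n)) by move=> /=; rewrite ltnn.
have E1 := freeze_service S2s mY2 mrun (fun=> G0 _).
have E2 := freeze_priority S1p mY mrun2 (fun y => integral_ge0 _ (fun s _ => G0 _)).
have E3 := freeze_gap ng (mst _ (@subset_refl _ _)) mrun3
  (fun y => integral_ge0 _ (fun p _ => integral_ge0 _ (fun s _ => G0 _))).
refine (etrans E1 _).
refine (etrans E2 _).
exact: E3.
Qed.

(** Peeling arrivals off from the last to the first leaves the initial jobs as the only
    randomness. *)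
Lemma integral_state_flow t n m f : measurable_fun setT f -> (forall x, 0 <= f x) ->
  \int[P]_w flow rho_gt0 m f (state t n w) = \int[P]_w flow rho_gt0 (n + m) f (t, jobs_after q 0 w).
Proof.
move=> mf f0; elim: n m => [|n IH] m.
  by apply: eq_integral => w _; rewrite /state /arrival_time big_ord0 subr0.
rewrite integral_state_step; [|exact: measurable_flow|by move=> z; exact: flow_ge0].
by rewrite addSnnS -IH.
Qed.

End queue.

(** * The random initial number of customers *)

Section initial_mean.
Local Open Scope ereal_scope.
Context (R : realType).

Lemma iter_arrive_ge0 m (f : seq R -> \bar R) x :
  (forall x, 0 <= f x) -> 0 <= iter m (@arrive R) f x.
Proof. by move=> f0; elim: m x => //= m IH x; exact: arrive_ge0. Qed.

Lemma measurable_iter_arrive m (f : seq R -> \bar R) : measurable_fun setT f ->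
  (forall x, 0 <= f x) -> measurable_fun setT (iter m (@arrive R) f).
Proof.
move=> mf f0; elim: m => //= m IH; apply: measurable_arrive => // x.
exact: iter_arrive_ge0.
Qed.

Lemma iter_arrive_nneseries m (f : nat -> seq R -> \bar R) x :
  (forall n, measurable_fun setT (f n)) -> (forall n y, 0 <= f n y) ->
  iter m (@arrive R) (fun y => \sum_(n <oo) f n y) x =
  \sum_(n <oo) iter m (@arrive R) (f n) x.
Proof.
move=> mf f0; elim: m x => //= m IH x.
rewrite (_ : iter m _ _ = fun y => \sum_(n <oo) iter m (@arrive R) (f n) y); last first.
  by apply/funext => y; exact: IH.
apply: arrive_nneseries => [n|n y]; first exact: measurable_iter_arrive.
exact: iter_arrive_ge0.
Qed.

Lemma iter_arriveZ m (f : seq R -> \bar R) (c : \bar R) x : 0 <= c ->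
  measurable_fun setT f -> (forall y, 0 <= f y) ->
  iter m (@arrive R) (fun y => c * f y) x = c * iter m (@arrive R) f x.
Proof.
move=> c0 mf f0; elim: m x => //= m IH x.
rewrite (_ : iter m _ _ = fun y => c * iter m (@arrive R) f y); last first.
  by apply/funext => y; exact: IH.
apply: arriveZ => // [|y]; first exact: measurable_iter_arrive.
exact: iter_arrive_ge0.
Qed.

Lemma iter_arrive_cst m (c : \bar R) x : iter m (@arrive R) (fun=> c) x = c.
Proof.
elim: m x => //= m IH x.
rewrite (_ : iter m _ _ = fun=> c); first exact: integral_prob_cst.
by apply/funext => y; exact: IH.
Qed.

End initial_mean.

Section initial_state.
Local Open Scope ereal_scope.
Context (R : realType) d (T : measurableType d) (P : probability T R).
Context (rho : R) (rho_gt0 : (0 < rho)%R).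
Context (q : queue_input P) (q_laws : queue_laws rho q).

(** Initial customers have i.i.d. uniform priorities, so [m] of them are distributed as after [m]
    arrivals to an empty system. *)
Definition init_mean (h : seq R -> \bar R) : \bar R :=
  \sum_(m <oo) P (init_num q @^-1` [set m]) * iter m (@arrive R) h [::].

Lemma measurable_arrive_job (F : seq (R * R) -> \bar R) : measurable_fun setT F ->
  (forall l, 0 <= F l) -> measurable_fun setT (arrive_job F).
Proof.
move=> mF F0; rewrite /arrive_job.
apply: (measurable_fun_integral (unif R) (f := fun z : seq (R * R) * R =>
  \int[service_prob R]_s F ((z.2, s) :: z.1))); last by move=> z; exact: integral_ge0.
apply: (measurable_fun_integral (service_prob R)
  (f := fun z : (seq (R * R) * R) * R => F ((z.1.2, z.2) :: z.1.1))) => //.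
apply: measurableT_comp mF _.
apply: measurable_fun_cons; last exact: measurableT_comp measurable_fst measurable_fst.
apply: measurable_fun_pair; last exact: measurable_snd.
exact: measurableT_comp measurable_snd measurable_fst.
Qed.

Lemma arrive_job_ge0 (F : seq (R * R) -> \bar R) l : (forall l, 0 <= F l) ->
  0 <= arrive_job F l.
Proof. by move=> F0; apply: integral_ge0 => p _; exact: integral_ge0. Qed.

(** The value [N] of the initial number is kept apart from the number [m] of listed jobs, and the
    list starts at any [k]: the induction removes the customer [k] while the event on the initial
    number stays intact. *)
Lemma integral_jobs_of k m N F : measurable_fun setT F -> (forall l, 0 <= F l) ->
  \int[P]_w (if init_num q w == N then F (jobs_of q (iota k m) w) else 0) =
  P (init_num q @^-1` [set N]) * iter m (@arrive_job R) F [::].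
Proof.
elim: m k F => [|m IH] k F mF F0.
  rewrite /= muleC -(integral_cst P); last exact: measurable_funPTI.
  rewrite [RHS]integral_mkcond; apply: eq_integral => w _; rewrite patchE.
  by case: eqP => Nw; [rewrite mem_set|rewrite memNset].
rewrite iterSr -(IH k.+1); [|exact: measurable_arrive_job|by move=> l; exact: arrive_job_ge0].
pose S1 : set (option (nat + (customer + customer))) := [set i | match i with
  | None => True
  | Some (inr (inl (inl i))) | Some (inr (inr (inl i))) => (k < i)%N
  | _ => False end].
pose S2 := S1 `|` [set Some (inr (inr (inl k)))].
have S12 : S1 `<=` S2 by move=> i; left.
have S1p : ~ S1 (Some (inr (inr (inl k)))) by rewrite /S1 /= ltnn.
have S2s : ~ S2 (Some (inr (inl (inl k)))) by case=> //=; rewrite ltnn.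
pose rest w := jobs_of q (iota k.+1 m) w.
have mY : measurable_fun [set: history (input_events q) S1] (fun w => (init_num q w, rest w)).
  apply: measurable_fun_pair; first exact: measurable_init_num.
  by apply: measurable_jobs_of => i; rewrite mem_iota => /andP[ki _]; split.
have mY2 : measurable_fun [set: history (input_events q) S2]
    (fun w => (priority q (inl k) w, (init_num q w, rest w))).
  apply: measurable_fun_pair; first by apply: measurable_priority; right.
  apply: measurable_fun_pair; first by apply: measurable_init_num; left.
  by apply: measurable_jobs_of => i; rewrite mem_iota => /andP[ki _]; split; left.
pose E := (R * (nat * seq (R * R)))%type.
pose phi (y : R * E) := if y.2.2.1 == N then F ((y.2.1, y.1) :: y.2.2.2) else 0.
have phi0 y : 0 <= phi y by rewrite /phi; case: ifP.
have mphi : measurable_fun setT phi.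
  have m2 : measurable_fun setT (fun y : R * E => y.2.2).
    exact: measurableT_comp measurable_snd measurable_snd.
  apply: measurable_fun_ifT; last exact: measurable_cst.
    apply: (@measurableT_comp _ _ _ _ _ _ (fun n : nat => n == N)) => //.
    exact: measurableT_comp measurable_fst m2.
  apply: measurableT_comp mF _; apply: measurable_fun_cons; last first.
    exact: measurableT_comp measurable_snd m2.
  apply: measurable_fun_pair; last exact: measurable_fst.
  exact: measurableT_comp measurable_fst measurable_snd.
have mphi' : measurable_fun setT (fun y : E * R => phi (y.2, y.1)).
  apply: (measurableT_comp mphi (g := fun y : E * R => (y.2, y.1))).
  by apply: measurable_fun_pair; [exact: measurable_snd|exact: measurable_fst].
have mphi2 := measurable_fun_integral (service_prob R) mphi' (fun=> phi0 _).
have E1 := freeze_service q_laws S2s mY2 mphi phi0.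
have E2 := freeze_priority q_laws S1p mY mphi2 (fun y => integral_ge0 _ (fun s _ => phi0 _)).
refine (etrans E1 _); refine (etrans E2 _).
clear E1 E2.
apply: eq_integral => w _.
rewrite /phi /=.
case: eqP => _ //.
by rewrite integral0_eq// => p _; rewrite integral0_eq.
Qed.

Lemma iter_arrive_job F m : measurable_fun setT F -> (forall l, 0 <= F l) ->
  iter m (@arrive_job R) F [::] = iter m (@arrive R) (avg F) [::].
Proof.
move=> mF F0; rewrite -[LHS]/(avg _ [::]).
suff H ps : avg (iter m (@arrive_job R) F) ps = iter m (@arrive R) (avg F) ps by exact: H.
have mi k : measurable_fun setT (iter k (@arrive_job R) F) /\
    forall l, 0 <= iter k (@arrive_job R) F l.
  elim: k => //= k [mk k0]; split; first exact: measurable_arrive_job.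
  by move=> l; exact: arrive_job_ge0.
elim: m ps => //= m IH ps; have [mm m0] := mi m.
by rewrite avg_arrive_job//; congr arrive; apply/funext.
Qed.

Lemma integral_jobs0 F : measurable_fun setT F -> (forall l, 0 <= F l) ->
  \int[P]_w F (jobs_after q 0 w) = init_mean (avg F).
Proof.
move=> mF F0.
pose u m w := if init_num q w == m then F (jobs_of q (iota 0 m) w) else 0.
have u0 m w : 0 <= u m w by rewrite /u; case: ifP.
have mjobs m : measurable_fun setT (jobs_of q (iota 0 m)).
  apply: (measurable_history_fun (@input_events_measurable _ _ _ _ q) (S := setT)).
  exact: measurable_jobs_of.
transitivity (\int[P]_w \sum_(m <oo) u m w).
  apply: eq_integral => w _; rewrite (nneseriesD1 (n := init_num q w))//.
  rewrite /u eqxx eseries0 ?adde0// => m _ /=.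
  by rewrite eq_sym => /negPf->.
rewrite integral_nneseries//.
  apply: eq_eseriesr => m _.
  by rewrite /u integral_jobs_of// iter_arrive_job.
move=> m; apply: measurable_fun_ifT; last exact: measurable_cst.
  by apply: (@measurableT_comp _ _ _ _ _ _ (fun n : nat => n == m)).
exact: measurableT_comp.
Qed.

Lemma init_mean_nneseries (h : nat -> seq R -> \bar R) :
  (forall n, measurable_fun setT (h n)) -> (forall n x, 0 <= h n x) ->
  init_mean (fun x => \sum_(n <oo) h n x) = \sum_(n <oo) init_mean (h n).
Proof.
move=> mh h0; rewrite /init_mean nneseries_interchange; last first.
  by move=> i j; rewrite mule_ge0// iter_arrive_ge0.
apply: eq_eseriesr => m _; rewrite iter_arrive_nneseries// ge0_nneseriesZl//.
by move=> n; exact: iter_arrive_ge0.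
Qed.

Lemma init_mean_cst (c : \bar R) : 0 <= c -> init_mean (fun=> c) = c.
Proof.
move=> c0; rewrite /init_mean; under eq_eseriesr do rewrite iter_arrive_cst.
rewrite ge0_nneseriesZr// [X in X * _](_ : _ = 1) ?mul1e//.
rewrite -(@probability_setT _ _ _ P).
rewrite (_ : [set: T] = \bigcup_m (init_num q @^-1` [set m])); last first.
  by apply/seteqP; split=> // w _; exists (init_num q w).
rewrite measure_bigcup//.
- by apply: eq_eseriesl => m; rewrite in_setT.
- by move=> m _; exact: measurable_funPTI.
- by move=> m n _ _ [w [/= <- <-]].
Qed.

End initial_state.

(** * The transition semigroup and the law at time [t] *)

Section law_of_jobs.
Local Open Scope ereal_scope.
Context (R : realType) d (T : measurableType d) (P : probability T R).
Context (rho : R) (rho_gt0 : (0 < rho)%R).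
Context (q : queue_input P) (q_laws : queue_laws rho q).

(** The transition semigroup at time [t]: the exponential series of [t] times [evolve], with the
    factor that removes the shift by [1 + rho]. *)
Definition heat (t : R) (f : seq R -> \bar R) (ps : seq R) : \bar R :=
  (expR (- ((1 + rho) * t)))%:E * \sum_(M <oo) (tpow M t)%:E * iter M (evolve rho) f ps.

Lemma flow_series_ge0 n f t ps : regular f -> 0 <= flow_series rho n f t ps.
Proof.
move=> rf; rewrite /flow_series; case: ifPn => // t0.
rewrite mule_ge0 ?lee_fin ?expR_ge0//; apply: nneseries_ge0 => M _ _.
by rewrite mule_ge0 ?lee_fin ?tpow_ge0// words_ge0.
Qed.

Lemma measurable_flow_series n f t : regular f -> measurable_fun setT (flow_series rho n f t).
Proof.
move=> rf; rewrite /flow_series; case: (leP 0%R t) => t0; last exact: measurable_cst.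
apply: measurable_funeM; apply: ge0_emeasurable_sum => [M x _ _|M _].
  by rewrite mule_ge0 ?lee_fin ?tpow_ge0// words_ge0.
by apply: measurable_funeM; case: (regular_words rho_gt0 M n rf).
Qed.

Lemma nneseries_flow_series f t ps : (0 <= t)%R -> regular f ->
  \sum_(n <oo) flow_series rho n f t ps = heat t f ps.
Proof.
move=> t0 rf; rewrite /flow_series t0 /heat.
have tW0 M n : 0 <= (tpow M t)%:E * words rho M n f ps.
  by rewrite mule_ge0 ?lee_fin ?tpow_ge0// words_ge0.
rewrite ge0_nneseriesZl ?lee_fin ?expR_ge0//; last first.
  by move=> n; apply: nneseries_ge0.
rewrite nneseries_interchange//; congr (_ * _); apply: eq_eseriesr => M _.
rewrite ge0_nneseriesZl ?lee_fin ?tpow_ge0//; last by move=> n; exact: words_ge0.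
by rewrite nneseries_words.
Qed.

(** Conservation of mass. It later shows that almost surely only finitely many customers arrive by
    time [t]. *)
Lemma heat_cst t c ps : (0 <= t)%R -> 0 <= c -> heat t (fun=> c) ps = c.
Proof.
move=> t0 c0; rewrite /heat.
have evM M : iter M (evolve rho) (fun=> c) = fun=> ((1 + rho) ^+ M)%:E * c.
  elim: M => [|M IH]; first by rewrite /= expr0 mul1e.
  apply/funext => x; rewrite iterS IH /evolve /depart /arrive integral_prob_cst.
  rewrite muleA -EFinM -ge0_muleDl ?lee_fin ?mulr_ge0 ?exprn_ge0 ?addr_ge0 ?ltW//.
  by rewrite -EFinD exprS mulrDl mul1r.
have lam0 : (0 <= 1 + rho)%R by rewrite addr_ge0// ltW.
transitivity ((expR (- ((1 + rho) * t)))%:E *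
    \sum_(M <oo) (tpow M ((1 + rho) * t))%:E * c).
  congr (_ * _); apply: eq_eseriesr => M _; rewrite evM muleA -EFinM.
  by congr (_%:E * _); rewrite /tpow exprMn; ring.
rewrite ge0_nneseriesZr//; last by move=> M; rewrite lee_fin tpow_ge0// mulr_ge0.
by rewrite nneseries_tpow ?mulr_ge0// muleA -EFinM -expRD addNr expR0 mul1e.
Qed.

(** The event that the next arrival comes after the horizon involves a gap independent of the state;
    integrating it out produces the exponential factor of [start]. *)
Lemma integral_last_gap (f : seq R -> \bar R) t n : measurable_fun setT f ->
  (forall x, 0 <= f x) ->
  \int[P]_w (if (0 <= (state q t n w).1)%R && ((state q t n w).1 < gap q n w)%R
    then f (map fst (run (state q t n w).1 (state q t n w).2)) else 0) =
  \int[P]_w start rho f (state q t n w).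
Proof.
move=> mf f0.
have : forall S, past n `<=` S ->
    measurable_fun [set: history (input_events q) S] (state q t n).
  by move=> S; exact: measurable_state.
move: (state q t n) => st mst.
pose phi (y : R * (R * seq (R * R))) := if (0 <= y.2.1)%R && (y.2.1 < y.1)%R
  then f (map fst (run y.2.1 y.2.2)) else 0.
have phi0 y : 0 <= phi y by rewrite /phi; case: ifP.
have m21 : measurable_fun setT (fun y : R * (R * seq (R * R)) => y.2.1).
  exact: measurableT_comp measurable_fst measurable_snd.
have mphi : measurable_fun setT phi.
  apply: measurable_fun_ifT; last exact: measurable_cst.
    by apply: measurable_and; [apply: measurable_fun_ler|apply: measurable_fun_ltr].
  apply: measurableT_comp mf _; apply: measurableT_comp (@measurable_map_fst R) _.
  apply: measurable_fun_run => //.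
  exact: measurableT_comp measurable_snd measurable_snd.
have ng : ~ past n (Some (inl n)) by move=> /=; rewrite ltnn.
have E1 := freeze_gap rho_gt0 q_laws ng (mst _ (@subset_refl _ _)) mphi phi0.
refine (etrans E1 _); clear E1.
apply: eq_integral => w _; rewrite /phi /start /=.
case: (leP 0%R (st w).1) => r0 /=; last by rewrite integral0.
by rewrite integral_expo_tail.
Qed.

Lemma integral_start_state f t n : (0 <= t)%R -> regular f ->
  \int[P]_w start rho f (state q t n w) = init_mean q (flow_series rho n f t).
Proof.
move=> t0 rf; have [mf f0 _] := rf.
rewrite (integral_state_flow rho_gt0 q_laws t n 0 mf f0) addn0.
rewrite (integral_jobs0 q_laws (F := fun l => flow rho_gt0 n f (t, l))).
- by congr init_mean; apply/funext => ps; exact: avg_flow.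
- apply: (measurableT_comp (measurable_flow rho_gt0 n mf f0) (g := fun l => (t, l))).
  by apply: measurable_fun_pair => //; exact: measurable_cst.
- by move=> l; exact: flow_ge0.
Qed.

Definition arrivals_are (t : R) n := [set w : T |
  (forall k, (k < n)%N -> arrival_time q k.+1 w <= t)%R /\ (t < arrival_time q n.+1 w)%R].

Lemma arrivals_are_uniq t n m w : arrivals_are t n w -> arrivals_are t m w -> n = m.
Proof.
move=> [nt tn] [mt tm]; have [nm|mn|//] := ltngtP n m.
  by have := mt _ nm; rewrite leNgt tn.
by have := nt _ mn; rewrite leNgt tm.
Qed.

Lemma num_arrivalsE t n w : arrivals_are t n w -> num_arrivals q t w = n.
Proof.
move=> wn; rewrite /num_arrivals; case: xgetP => [m _ wm|/(_ n)].
  exact: arrivals_are_uniq wm wn.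
by [].
Qed.

Lemma num_arrivals0 t w : (forall n, ~ arrivals_are t n w) -> num_arrivals q t w = 0%N.
Proof. by move=> wn; rewrite /num_arrivals; case: xgetP => // m _ /wn. Qed.

Lemma measurable_arrivalT n : measurable_fun setT (arrival_time q n).
Proof.
by apply: measurable_sum => k; exact: measurable_funP.
Qed.

Lemma measurable_arrivals_are t n : measurable (arrivals_are t n).
Proof.
rewrite (_ : arrivals_are t n = (\bigcap_(k in `I_n) [set w | arrival_time q k.+1 w <= t]%R)
   `&` [set w | t < arrival_time q n.+1 w]%R) //.
apply: measurableI.
  apply: bigcap_measurableType => k _; rewrite -[X in measurable X]setTI.
  exact: (measurable_fun_ler (measurable_arrivalT _) (measurable_cst t) measurableT
    (Y := [set true])).
rewrite -[X in measurable X]setTI.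
exact: (measurable_fun_ltr (measurable_cst t) (measurable_arrivalT _) measurableT
  (Y := [set true])).
Qed.

Lemma gap_gt0 k : P [set w | gap q k w <= 0]%R = 0.
Proof.
have -> : [set w | gap q k w <= 0]%R = gap q k @^-1` (~` `]0%R, +oo[%classic).
  by apply/seteqP; split=> w /=; rewrite in_itv/= andbT; [rewrite leNgt => /negP|move=> /negP; rewrite -leNgt].
have mI : measurable (`]0%R, +oo[%classic : set R) by exact: measurable_itv.
rewrite -[LHS]/(distribution P (gap q k) _) (gap_law q_laws); last exact: measurableC.
rewrite -(expoE rho_gt0) probability_setC// expo_tail// mulr0 oppr0 expR0.
by rewrite -EFinB subrr.
Qed.

(** With positive gaps the arrival times increase, so the constraints on the first [n] arrivals
    reduce to the one on the last; for [n = 0] it reads [0 <= t]. *)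
Lemma arrivals_areE t n w : (0 <= t)%R -> (forall k, 0 < gap q k w)%R ->
  arrivals_are t n w <->
  (0 <= (state q t n w).1)%R && ((state q t n w).1 < gap q n w)%R.
Proof.
move=> t0 gw; rewrite /state /= subr_ge0 ltrBlDl.
have S_mono k m : (k <= m)%N -> (arrival_time q k w <= arrival_time q m w)%R.
  elim: m => [|m IH]; first by rewrite leqn0 => /eqP->.
  rewrite leq_eqVlt => /predU1P[->//|/IH km]; apply: (le_trans km).
  by rewrite /arrival_time [in leRHS]big_ord_recr /= lerDl ltW.
have SS : arrival_time q n.+1 w = (arrival_time q n w + gap q n w)%R.
  by rewrite /arrival_time big_ord_recr.
rewrite -SS; split=> [[nt ->]|/andP[nt tn]]; last first.
  by split=> // k kn; apply: le_trans nt; exact: S_mono.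
rewrite andbT; case: n nt SS => [_ _|n nt _]; last exact: nt.
by rewrite /arrival_time big_ord0.
Qed.

Lemma measurable_jobsT n : measurable_fun setT (jobs_after q n : T -> seq (R * R)).
Proof.
apply: (measurable_history_fun (@input_events_measurable _ _ _ _ q) (S := setT)).
exact: measurable_jobs_after.
Qed.

Lemma measurable_jobs_at t : measurable_fun setT (jobs_at q t : T -> seq (R * R)).
Proof.
apply: (@measurable_fun_glue _ _ _ _ (num_arrivals q t)
  (fun n w => run (t - arrival_time q n w)%R (jobs_after q n w))); last first.
  move=> n; apply: measurable_fun_run; last exact: measurable_jobsT.
  by apply: measurable_funB => //; exact: measurable_arrivalT.
have mE n : measurable (num_arrivals q t @^-1` [set n]).
  (* The value 0 is also the default, taken where no number of arrivals qualifies. *)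
  have -> : num_arrivals q t @^-1` [set n] = arrivals_are t n `|`
     (if n is 0%N then ~` \bigcup_m arrivals_are t m else set0).
    apply/seteqP; split=> w /=.
      have [[m wm]|wn] := pselect (exists m, arrivals_are t m w).
        by rewrite (num_arrivalsE wm) => <-; left.
      rewrite num_arrivals0 => [<-|m wm]; last by apply: wn; exists m.
      by right=> -[m _ wm]; apply: wn; exists m.
    case=> [|]; first exact: num_arrivalsE.
    case: n => // wn; apply: num_arrivals0 => m wm.
    by apply: wn; exists m.
  apply: measurableU; first exact: measurable_arrivals_are.
  case: n => // ; apply: measurableC; apply: bigcup_measurable => m _.
  exact: measurable_arrivals_are.
move=> _ A _; rewrite setTI (_ : _ @^-1` A = \bigcup_(n in A) (num_arrivals q t @^-1` [set n])).
  by apply: bigcup_measurable => n _.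
by apply/seteqP; split=> [w Aw|w [n An /= ->]//]; exists (num_arrivals q t w).
Qed.

Lemma integral_arrivals_are f t n : (0 <= t)%R -> regular f ->
  \int[P]_(w in arrivals_are t n) f (map fst (jobs_at q t w)) =
  init_mean q (flow_series rho n f t).
Proof.
move=> t0 rf; have [mf f0 fsym] := rf.
rewrite -integral_start_state// -integral_last_gap// integral_mkcond.
have mst : measurable_fun setT (state q t n).
  apply: (measurable_history_fun (@input_events_measurable _ _ _ _ q) (S := setT)).
  exact: measurable_state.
have mst1 : measurable_fun setT (fun w => (state q t n w).1).
  exact: measurableT_comp measurable_fst mst.
apply: ae_eq_integral => //.
- apply: (measurable_restrict _ _ _).1 => //.
    exact: measurable_arrivals_are.
  apply/measurable_funTS/(measurableT_comp mf).
  exact: measurableT_comp (@measurable_map_fst R) (measurable_jobs_at t).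
- apply: measurable_fun_ifT; last exact: measurable_cst.
    by apply: measurable_and; [apply: measurable_fun_ler|apply: measurable_fun_ltr].
  apply/(measurableT_comp mf)/(measurableT_comp (@measurable_map_fst R)).
  by apply: measurable_fun_run => //; exact: measurableT_comp measurable_snd mst.
- have : {ae P, forall w k, (0 < gap q k w)%R}.
    apply/ae_foralln => k.
    exists [set w | gap q k w <= 0]%R; split; last 2 first.
    + exact: gap_gt0.
    + by move=> w /= /negP; rewrite -leNgt.
    have mg : measurable_fun setT (gap q k : T -> R) by exact: measurable_funP.
    rewrite -[X in measurable X]setTI.
    have mle : measurable_fun setT (fun w => gap q k w <= 0)%R.
      by apply: measurable_fun_ler => //; exact: measurable_cst.
    exact: (mle measurableT [set true]).
  apply: filterS => w gw _ /=; rewrite patchE.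
  have [nE En] := arrivals_areE n t0 gw.
  case: ifPn => [|/negP] wE.
    move: wE; rewrite inE => wE; rewrite (nE wE).
    by rewrite /jobs_at (num_arrivalsE wE).
  by case: ifPn => // /En ?; case: wE; rewrite inE.
Qed.

(** The events [arrivals_are t n] are disjoint, and summing over [n] turns [flow_series] into
    [heat]. *)
Lemma law_of_jobs f t : (0 <= t)%R -> regular f ->
  \int[P]_w f (map fst (jobs_at q t w)) = init_mean q (heat t f).
Proof.
move=> t0 rf; have [mf f0 fsym] := rf.
pose U := \bigcup_n arrivals_are t n.
have mU : measurable U by apply: bigcup_measurable => n _; exact: measurable_arrivals_are.
have tr : trivIset setT (arrivals_are t).
  by move=> n m _ _ [w [wn wm]]; exact: arrivals_are_uniq wn wm.
have sumU g : regular g -> \int[P]_(w in U) g (map fst (jobs_at q t w)) = init_mean q (heat t g).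
  move=> rg; have [mg g0 gsym] := rg.
  rewrite ge0_integral_bigcup//=.
  - under eq_eseriesr do rewrite integral_arrivals_are//.
    rewrite -init_mean_nneseries; last 2 first.
      by move=> n; exact: measurable_flow_series.
      by move=> n x; exact: flow_series_ge0.
    by congr init_mean; apply/funext => ps; exact: nneseries_flow_series.
  - by move=> n; exact: measurable_arrivals_are.
  - apply/measurable_funTS/(measurableT_comp mg).
    exact: measurableT_comp (@measurable_map_fst R) (measurable_jobs_at t).
(* The summed identity applied to the constant 1: its right-hand side is 1 by [heat_cst], so the
   outcomes without a number of arrivals are null. *)
have PU : P U = 1.
  have r1 : regular (fun _ : seq R => 1) by split.
  have := sumU _ r1; rewrite integral_cst// mul1e => ->.
  rewrite (_ : heat t _ = fun=> 1) ?init_mean_cst//.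
  by apply/funext => ps; exact: heat_cst.
rewrite -sumU// -(setUv U) ge0_integral_setU//=; last 3 first.
- exact: measurableC.
- rewrite setUv; apply/(measurableT_comp mf).
  exact: measurableT_comp (@measurable_map_fst R) (measurable_jobs_at t).
- exact/disj_setPCl.
rewrite [X in _ + X]null_set_integral ?adde0//.
- exact: measurableC.
- apply/measurable_funTS/(measurableT_comp mf).
  exact: measurableT_comp (@measurable_map_fst R) (measurable_jobs_at t).
- transitivity (1 - P U); last by rewrite PU -EFinB subrr.
  exact: probability_setC.
Qed.

End law_of_jobs.

(** * The uniformized chain *)

Section kernel.
Local Open Scope ereal_scope.
Context (R : realType) (rho : R) (rho_gt0 : (0 < rho)%R).

(* One step of the uniformized chain: with probability [rho / (1 + rho)] an
   arrival, otherwise the departure of the top customer, if any. *)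
Definition kern (f : seq R -> \bar R) : seq R -> \bar R :=
  fun x => ((1 + rho)^-1)%:E * evolve rho f x.

Lemma lam_gt0 : (0 < 1 + rho)%R. Proof. by rewrite addr_gt0. Qed.

Let rho_ge0 : 0 <= rho%:E. Proof. by rewrite lee_fin ltW. Qed.

Let lamV_ge0 : 0 <= ((1 + rho)^-1)%:E.
Proof. by rewrite lee_fin invr_ge0 ltW// lam_gt0. Qed.

Lemma regularZ (c : R) (f : seq R -> \bar R) : (0 <= c)%R -> regular f ->
  regular (fun x => c%:E * f x).
Proof.
move=> c0 [mf f0 fsym]; split.
- exact: measurable_funeM.
- by move=> x; rewrite mule_ge0// lee_fin.
- by move=> x y xy; rewrite (fsym _ _ xy).
Qed.

Lemma regularD (f g : seq R -> \bar R) : regular f -> regular g ->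
  regular (fun x => f x + g x).
Proof.
move=> [mf f0 fsym] [mg g0 gsym]; split.
- exact: emeasurable_funD.
- by move=> x; rewrite adde_ge0.
- by move=> x y xy; rewrite (fsym _ _ xy) (gsym _ _ xy).
Qed.

Lemma regular_cst (c : \bar R) : 0 <= c -> regular (fun _ : seq R => c).
Proof. by move=> c0; split => //; exact: measurable_cst. Qed.

Lemma regular_kern f : regular f -> regular (kern f).
Proof.
by move=> rf; apply: regularZ; [rewrite invr_ge0 ltW// lam_gt0|exact: regular_evolve].
Qed.

Lemma arrive_le (f g : seq R -> \bar R) x : regular f -> regular g ->
  (forall y, f y <= g y) -> arrive f x <= arrive g x.
Proof.
move=> [mf f0 _] [mg g0 _] fg; apply: ge0_le_integral => //;
  try exact: measurable_cons1.
Qed.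

Lemma arriveD (f g : seq R -> \bar R) x : regular f -> regular g ->
  arrive (fun y => f y + g y) x = arrive f x + arrive g x.
Proof.
move=> [mf f0 _] [mg g0 _]; rewrite /arrive ge0_integralD//;
  exact: measurable_cons1.
Qed.

Lemma kern_le (f g : seq R -> \bar R) x : regular f -> regular g ->
  (forall y, f y <= g y) -> kern f x <= kern g x.
Proof.
move=> rf rg fg; apply: lee_wpmul2l => //.
apply: leeD; first exact: fg.
by apply: lee_wpmul2l => //; exact: arrive_le.
Qed.

Lemma kernD (f g : seq R -> \bar R) x : regular f -> regular g ->
  kern (fun y => f y + g y) x = kern f x + kern g x.
Proof.
move=> rf rg; have [_ f0 _] := rf; have [_ g0 _] := rg.
have Af0 := @arrive_ge0 _ f x f0; have Ag0 := @arrive_ge0 _ g x g0.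
rewrite /kern -ge0_muleDr; last 2 first.
- by apply: adde_ge0; [exact: f0|exact: mule_ge0].
- by apply: adde_ge0; [exact: g0|exact: mule_ge0].
congr (_ * _); rewrite /evolve arriveD// [in LHS]ge0_muleDr//.
by rewrite /depart addeACA.
Qed.

Lemma kernZ (c : R) (f : seq R -> \bar R) x : (0 <= c)%R -> regular f ->
  kern (fun y => c%:E * f y) x = c%:E * kern f x.
Proof.
move=> c0 rf; have [mf f0 _] := rf.
rewrite /kern muleCA; congr (_ * _); rewrite /evolve arriveZ//.
rewrite [RHS]ge0_muleDr; [|exact: f0|by apply: mule_ge0 => //; exact: arrive_ge0].
by rewrite [in RHS]muleCA.
Qed.

Lemma kern_cst (c : R) x : (0 <= c)%R -> kern (fun=> c%:E) x = c%:E.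
Proof.
move=> c0; rewrite /kern /evolve /depart /arrive integral_prob_cst /=.
transitivity (((1 + rho)^-1 * (c + rho * c))%R%:E) => //; congr EFin.
by field; rewrite gt_eqF ?lam_gt0.
Qed.

Lemma regular_iter_kern n f : regular f -> regular (iter n kern f).
Proof. by move=> rf; elim: n => //= n; exact: regular_kern. Qed.

Lemma iter_kern_ge0 n f x : regular f -> 0 <= iter n kern f x.
Proof. by move=> /(regular_iter_kern n)[]. Qed.

Lemma iter_kern_le n (f g : seq R -> \bar R) x : regular f -> regular g ->
  (forall y, f y <= g y) -> iter n kern f x <= iter n kern g x.
Proof.
move=> rf rg fg; elim: n x => //= n IH x.
by apply: kern_le => //; exact: regular_iter_kern.
Qed.

Lemma iter_kernD n (f g : seq R -> \bar R) x : regular f -> regular g ->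
  iter n kern (fun y => f y + g y) x = iter n kern f x + iter n kern g x.
Proof.
move=> rf rg; elim: n x => //= n IH x.
rewrite (_ : iter n kern _ = fun y => iter n kern f y + iter n kern g y).
  by rewrite kernD//; exact: regular_iter_kern.
by apply/funext.
Qed.

Lemma iter_kernZ n (c : R) (f : seq R -> \bar R) x : (0 <= c)%R -> regular f ->
  iter n kern (fun y => c%:E * f y) x = c%:E * iter n kern f x.
Proof.
move=> c0 rf; elim: n x => //= n IH x.
rewrite (_ : iter n kern _ = fun y => c%:E * iter n kern f y).
  by rewrite kernZ//; exact: regular_iter_kern.
by apply/funext.
Qed.

Lemma iter_kern_cst n (c : R) x : (0 <= c)%R -> iter n kern (fun=> c%:E) x = c%:E.
Proof.
move=> c0; elim: n x => //= n IH x.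
rewrite (_ : iter n kern _ = fun=> c%:E); first exact: kern_cst.
by apply/funext.
Qed.

Lemma iter_kern_le1 n f x : regular f -> (forall y, f y <= 1) -> iter n kern f x <= 1.
Proof.
move=> rf f1; rewrite -(iter_kern_cst n x (@ler01 R)).
by apply: iter_kern_le => //; apply: regular_cst; rewrite lee_fin.
Qed.

Lemma iter_evolve n f x : regular f ->
  iter n (evolve rho) f x = ((1 + rho) ^+ n)%:E * iter n kern f x.
Proof.
move=> rf; elim: n x => [|n IH] x; first by rewrite expr0 mul1e.
rewrite 2!iterS (_ : iter n (evolve rho) f = fun y => ((1 + rho) ^+ n)%:E * iter n kern f y).
  have rk := regular_iter_kern n rf.
  have c0 : (0 <= (1 + rho) ^+ n)%R by rewrite exprn_ge0// ltW// lam_gt0.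
  rewrite exprS EFinM -muleA -kernZ// [kern (fun y => _ * _) _]/kern muleA -EFinM.
  by rewrite mulfV ?mul1e// gt_eqF ?lam_gt0.
by apply/funext.
Qed.

Definition increasing (f : seq R -> \bar R) := forall x y, subseq x y -> f x <= f y.

(** Sorting preserves inclusion of lists. If the tops agree, both are removed; otherwise the smaller
    list already embeds below the top of the larger one. *)
Lemma depart_increasing f : increasing f -> increasing (depart f).
Proof.
move=> incf x y xy; apply: incf.
have := subseq_sort (@higher_total R) (@higher_trans R) xy.
move: (sort _ x) (sort _ y) => {xy}x {}y.
elim: y x => [|b y IH] [|a x] //=; first by move=> _; exact: sub0seq.
case: eqP => // _ H; apply: subseq_trans H; exact: subseq_cons.
Qed.

Lemma kern_increasing f : regular f -> increasing f -> increasing (kern f).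
Proof.
move=> rf incf x y xy; have [mf f0 _] := rf.
apply: lee_wpmul2l => //.
apply: leeD; first exact: depart_increasing.
apply: lee_wpmul2l => //.
apply: ge0_le_integral => //; try exact: measurable_cons1.
by move=> u _; apply: incf; rewrite /= eqxx.
Qed.

Lemma iter_kern_increasing n f : regular f -> increasing f -> increasing (iter n kern f).
Proof.
move=> rf incf; elim: n => //= n IH; apply: kern_increasing => //.
exact: regular_iter_kern.
Qed.

(** The empty list is the least state and is fixed by a departure, so one step from it cannot lower
    the mean of an increasing function. *)
Lemma kern_nil_ge f : regular f -> increasing f -> f [::] <= kern f [::].
Proof.
move=> rf incf; have [mf f0 _] := rf.
rewrite /kern /evolve /depart /=.
have Af : f [::] <= arrive f [::].
  rewrite -[leLHS](integral_prob_cst (unif R)); apply: ge0_le_integral => //.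
  - exact: measurable_cons1.
  - by move=> u _; apply: incf; exact: sub0seq.
apply: (@le_trans _ _ (((1 + rho)^-1)%:E * (f [::] + rho%:E * f [::]))); last first.
  by apply: lee_wpmul2l => //; apply: leeD => //; exact: lee_wpmul2l.
rewrite -[X in _ * (X + _)]mul1e -ge0_muleDl// muleA -EFinM.
by rewrite mulVf ?mul1e// gt_eqF ?lam_gt0.
Qed.

Lemma iter_kern_nil_nondecreasing f : regular f -> increasing f ->
  nondecreasing_seq (fun n => iter n kern f [::]).
Proof.
move=> rf incf; apply/nondecreasing_seqP => n /=.
by apply: kern_nil_ge; [exact: regular_iter_kern|exact: iter_kern_increasing].
Qed.

End kernel.

(** * Counts of customers with priority in a set *)

Section counts.
Local Open Scope ereal_scope.
Context (R : realType).
Implicit Types (B : set R) (x : seq R).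

Definition cnt B x := count (fun u => u \in B) x.

Definition ind (b : seq R -> bool) (x : seq R) : \bar R := ((b x)%:R)%:E.

Definition top_in B x := has (fun u => u \in B) (take 1 (sort (@higher R) x)).

Definition tail B k := ind (fun x => k <= cnt B x)%N.

Definition level B k := ind (fun x => cnt B x == k).

(** The states in which the next departure lowers the count in [B] from [k] to [k - 1]. *)
Definition top_level B k := ind (fun x => (cnt B x == k) && top_in B x).

Definition cntE B x : \bar R := ((cnt B x)%:R)%:E.

Definition mass B : R := fine (unif R B).

Lemma unif_mass B : measurable B -> unif R B = (mass B)%:E.
Proof. by move=> mB; rewrite fineK// fin_num_measure. Qed.

Lemma measurable_mem B : measurable B -> measurable_fun setT (fun u : R => u \in B).
Proof.
move=> mB; apply: (measurable_fun_bool true) => //.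
rewrite setTI (_ : _ @^-1` _ = B)//.
by apply/seteqP; split=> u /=; [exact: set_mem|exact: mem_set].
Qed.

Lemma measurable_cnt B : measurable B -> measurable_fun setT (cnt B).
Proof.
move=> mB.
have H : measurable_fun setT (fun p : unit * seq R => cnt B p.2).
  apply: (measurable_fun_on_seq (F := fun _ : unit => cnt B)).
  elim=> [_|Y Xs IH mXs]; first exact: measurable_cst.
  pose G n (p : unit * seq R) := ((Y p \in B) + n)%N.
  rewrite (_ : (fun p => _) = (fun p => G (cnt B [seq X p | X <- Xs]) p))//.
  apply: (@measurable_fun_glue _ _ _ _ _ G).
    by apply: IH => Z HZ; apply: mXs; right.
  move=> n; rewrite /G.
  apply: (@measurableT_comp _ _ _ _ _ _ (fun c : bool => (c + n)%N)) => //.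
  apply: (measurableT_comp (measurable_mem mB)).
  by apply: mXs; left.
apply: (measurableT_comp H (g := fun l => (tt, l))).
exact: measurable_fun_pair.
Qed.

Lemma cnt_perm B x y : perm_eq x y -> cnt B x = cnt B y.
Proof. by move=> /permP; apply. Qed.

Lemma top_in_perm B x y : perm_eq x y -> top_in B x = top_in B y.
Proof. by move=> xy; rewrite /top_in (sort_higher_perm xy). Qed.

Lemma measurable_top_in B : measurable B -> measurable_fun setT (top_in B).
Proof.
move=> mB.
rewrite (_ : top_in B = (fun s => (0 < size s)%N && (nth point s 0 \in B)) \o sort (@higher R)).
  apply: measurableT_comp (@measurable_sort_higher R).
  apply: measurable_and.
    exact: (measurableT_comp (f := fun n => (0 < n)%N) _ (@measurable_size _ R)).
  exact: (measurableT_comp (measurable_mem mB) (@measurable_nth _ R 0)).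
by apply/funext => x; rewrite /top_in /=; case: (sort _ x) => //= a s; rewrite take0 orbF.
Qed.

Lemma regular_ind (b : seq R -> bool) : measurable_fun setT b ->
  (forall x y, perm_eq x y -> b x = b y) -> regular (ind b).
Proof.
move=> mb bsym; split.
- by apply: (@measurableT_comp _ _ _ _ _ _ (fun c : bool => (c%:R : R)%:E)).
- by move=> x; rewrite lee_fin.
- by move=> x y xy; rewrite /ind (bsym _ _ xy).
Qed.

Lemma regular_tail B k : measurable B -> regular (tail B k).
Proof.
move=> mB; apply: regular_ind => [|x y xy]; last by rewrite (cnt_perm B xy).
apply: (@measurableT_comp _ _ _ _ _ _ (fun n : nat => (k <= n)%N)) => //.
exact: measurable_cnt.
Qed.

Lemma regular_level B k : measurable B -> regular (level B k).
Proof.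
move=> mB; apply: regular_ind => [|x y xy]; last by rewrite (cnt_perm B xy).
apply: (@measurableT_comp _ _ _ _ _ _ (fun n : nat => n == k)) => //.
exact: measurable_cnt.
Qed.

Lemma regular_top_in B : measurable B -> regular (ind (top_in B)).
Proof.
by move=> mB; apply: regular_ind; [exact: measurable_top_in|exact: top_in_perm].
Qed.

Lemma regular_top_level B k : measurable B -> regular (top_level B k).
Proof.
move=> mB; apply: regular_ind => [|x y xy].
  apply: measurable_and; last exact: measurable_top_in.
  apply: (@measurableT_comp _ _ _ _ _ _ (fun n : nat => n == k)) => //.
  exact: measurable_cnt.
by rewrite (cnt_perm B xy) (top_in_perm B xy).
Qed.

Lemma regular_cntE B : measurable B -> regular (cntE B).
Proof.
move=> mB; split.
- apply: (@measurableT_comp _ _ _ _ _ _ (fun n : nat => (n%:R : R)%:E)) => //.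
  exact: measurable_cnt.
- by move=> x; rewrite lee_fin.
- by move=> x y xy; rewrite /cntE (cnt_perm B xy).
Qed.

Lemma ind_le1 b x : ind b x <= 1.
Proof. by rewrite lee_fin; case: (b x). Qed.

Lemma cnt_subseq B x y : subseq x y -> (cnt B x <= cnt B y)%N.
Proof. by move=> xy; apply: leq_count_subseq. Qed.

Lemma tail_increasing B k : increasing (tail B k).
Proof.
move=> x y xy; rewrite lee_fin ler_nat; case: (leqP k (cnt B x)) => // kx.
by rewrite (leq_trans kx (cnt_subseq B xy)).
Qed.

Lemma cntE_increasing B : increasing (cntE B).
Proof. by move=> x y xy; rewrite lee_fin ler_nat cnt_subseq. Qed.

Lemma tailS B k x : tail B k x = tail B k.+1 x + level B k x.
Proof.
rewrite /tail /level /ind -EFinD -natrD; congr (_%:R%:E).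
by case: ltngtP.
Qed.

Lemma arrive_mem B (c c' : R) : measurable B -> (0 <= c)%R -> (c <= c')%R ->
  \int[unif R]_u (if u \in B then c' else c)%:E = (c + (c' - c) * mass B)%:E.
Proof.
move=> mB c0 cc'.
rewrite (eq_integral (fun u : R => c%:E + (c' - c)%:E * (\1_B u)%:E)); last first.
  move=> u _; rewrite indicE /=; case: ifP => _; rewrite ?mule1 ?mule0 ?adde0//.
  by rewrite -EFinD addrC subrK.
have m1 : measurable_fun setT (fun u : R => (\1_B u)%:E : \bar R).
  exact/measurable_EFinP.
have c'c : 0 <= (c' - c)%:E by rewrite lee_fin subr_ge0.
have intB : \int[unif R]_u (\1_B u)%:E = (mass B)%:E.
  by rewrite integral_indic// setIT; exact: unif_mass.
rewrite ge0_integralD//.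
- by rewrite integral_prob_cst ge0_integralZl// intB.
- by move=> u _; rewrite mule_ge0// lee_fin.
- exact: measurable_funeM.
Qed.

Lemma arrive_tail B k x : measurable B ->
  arrive (tail B k.+1) x = tail B k.+1 x + (mass B)%:E * level B k x.
Proof.
move=> mB; rewrite /arrive.
rewrite (eq_integral (fun u : R => (if u \in B then (k <= cnt B x)%N%:R
    else (k < cnt B x)%N%:R)%:E)); last first.
  by move=> u _; rewrite /tail /ind /= /cnt /=; case: (u \in B).
rewrite arrive_mem//; last by rewrite ler_nat; case: ltngtP.
rewrite /tail /level /ind -EFinM -EFinD; congr (_%:E).
by case: ltngtP => _; rewrite ?subrr ?subr0 /=; ring.
Qed.

Lemma arrive_cntE B x : measurable B ->
  arrive (cntE B) x = cntE B x + (mass B)%:E.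
Proof.
move=> mB; rewrite /arrive.
rewrite (eq_integral (fun u : R => (if u \in B then (cnt B x).+1%:R
    else (cnt B x)%:R)%:E)); last first.
  by move=> u _; rewrite /cntE /= /cnt /=; case: (u \in B).
rewrite arrive_mem//; last by rewrite ler_nat.
rewrite /cntE -EFinD; congr (_%:E).
by rewrite -natr1; ring.
Qed.

Lemma cnt_sort B x : cnt B (sort (@higher R) x) = cnt B x.
Proof. exact: count_sort. Qed.

Lemma depart_tail B k x :
  depart (tail B k.+1) x + top_level B k.+1 x = tail B k.+1 x.
Proof.
rewrite /depart /top_level /tail /ind /top_in -EFinD -natrD -(cnt_sort B x).
congr (_%:R%:E).
case: (sort _ x) => [|u s] //=; rewrite /cnt /= take0 /= orbF.
by case: (u \in B); rewrite ?andbF ?andbT ?addn0 ?add0n ?add1n ?eqSS ?ltnS//; case: ltngtP.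
Qed.

Lemma depart_cntE B x : depart (cntE B) x + ind (top_in B) x = cntE B x.
Proof.
rewrite /depart /ind /cntE /top_in -EFinD -natrD -(cnt_sort B x).
congr (_%:R%:E).
by case: (sort _ x) => [|u s] //=; rewrite /cnt /= take0 /= orbF addnC.
Qed.

Context (rho : R) (rho_gt0 : (0 < rho)%R).

(** The count passes from [k] to [k.+1] by an arrival in [B], and back when the customer in service
    belongs to [B]. The terms are arranged so that no subtraction of extended reals occurs. *)
Lemma kern_tail B k x : measurable B ->
  (1 + rho)%:E * kern rho (tail B k.+1) x + top_level B k.+1 x =
  (1 + rho)%:E * tail B k.+1 x + (rho * mass B)%:E * level B k x.
Proof.
move=> mB; rewrite /kern muleA -EFinM mulfV ?mul1e; last first.
  by rewrite gt_eqF// lam_gt0.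
rewrite /evolve arrive_tail// addeAC depart_tail.
by rewrite /tail /level /ind -?EFinM -?EFinD -?EFinM -?EFinD; congr EFin; ring.
Qed.

(** The drift of the count: arrivals in [B] at rate [rho * mass B], departures at rate 1 while the
    top customer is in [B]. *)
Lemma kern_cntE B x : measurable B ->
  (1 + rho)%:E * kern rho (cntE B) x + ind (top_in B) x =
  (1 + rho)%:E * cntE B x + (rho * mass B)%:E.
Proof.
move=> mB; rewrite /kern muleA -EFinM mulfV ?mul1e; last first.
  by rewrite gt_eqF// lam_gt0.
rewrite /evolve arrive_cntE// addeAC depart_cntE.
by rewrite /cntE -?EFinM -?EFinD -?EFinM -?EFinD; congr EFin; ring.
Qed.

End counts.

(** * Tail probabilities from the empty system and their limits *)

Section limits.
Context (R : realType) (rho : R) (rho_gt0 : 0 < rho).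
Implicit Types (B : set R).

(** Used for functions bounded by 1, on which [fine] loses nothing. *)
Definition emean n (f : seq R -> \bar R) : R := fine (iter n (kern rho) f [::]).

Lemma emeanE n f : regular f -> (forall x, f x <= 1)%E ->
  iter n (kern rho) f [::] = (emean n f)%:E.
Proof.
move=> rf f1; rewrite fineK// ge0_fin_numE ?iter_kern_ge0//.
by rewrite (le_lt_trans (iter_kern_le1 rho_gt0 n [::] rf f1))// ltry.
Qed.

Lemma emean_ge0 n f : regular f -> 0 <= emean n f.
Proof. by move=> rf; rewrite fine_ge0// iter_kern_ge0. Qed.

Lemma emean_le1 n f : regular f -> (forall x, f x <= 1)%E -> emean n f <= 1.
Proof. by move=> rf f1; rewrite -lee_fin -emeanE// iter_kern_le1. Qed.

Lemma emean_le n f g : regular f -> regular g -> (forall x, f x <= g x)%E ->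
  (forall x, g x <= 1)%E -> emean n f <= emean n g.
Proof.
move=> rf rg fg g1; rewrite -lee_fin -!emeanE//; first exact: iter_kern_le.
by move=> x; exact: le_trans (fg x) (g1 x).
Qed.

Definition occ B k n : R := emean n (tail B k).

Definition limocc B k : R := limn (occ B k).

Lemma occ_le1 B k n : measurable B -> occ B k n <= 1.
Proof. by move=> mB; apply: emean_le1; [exact: regular_tail|move=> x; exact: ind_le1]. Qed.

Lemma occ_nondecreasing B k : measurable B -> nondecreasing_seq (occ B k).
Proof.
move=> mB n m nm; rewrite -lee_fin -!emeanE;
  try exact: regular_tail; try by move=> x; exact: ind_le1.
apply: iter_kern_nil_nondecreasing => //; first exact: regular_tail.
exact: tail_increasing.
Qed.

Lemma cvg_occ B k : measurable B -> occ B k @ \oo --> limocc B k.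
Proof.
move=> mB; apply: nondecreasing_is_cvgn; first exact: occ_nondecreasing.
by exists 1 => _ [n _ <-]; exact: occ_le1.
Qed.

Lemma occ_le_lim B k n : measurable B -> occ B k n <= limocc B k.
Proof.
move=> mB; apply: nondecreasing_cvgn_le; first exact: occ_nondecreasing.
by apply: cvgP; exact: cvg_occ.
Qed.

Lemma limocc_ge0 B k : measurable B -> 0 <= limocc B k.
Proof.
move=> mB; apply: le_trans (occ_le_lim k 0 mB).
by apply: emean_ge0; exact: regular_tail.
Qed.

Lemma limocc_le1 B k : measurable B -> limocc B k <= 1.
Proof.
move=> mB; apply: limr_le; first by apply: cvgP; exact: cvg_occ.
by near=> n; exact: occ_le1.
Unshelve. all: end_near. Qed.

Lemma occ0 B n : occ B 0 n = 1.
Proof.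
rewrite /occ /emean (_ : tail B 0 = fun=> 1%E).
  by rewrite iter_kern_cst.
by apply/funext => x.
Qed.

Lemma limocc0 B : measurable B -> limocc B 0 = 1.
Proof.
move=> mB; apply/cvg_lim => //.
by rewrite (_ : occ B 0 = fun=> 1); [exact: cvg_cst|apply/funext => n; exact: occ0].
Qed.

Lemma emean_level B k n : measurable B ->
  emean n (level B k) = occ B k n - occ B k.+1 n.
Proof.
move=> mB; apply/eqP; rewrite eq_sym subr_eq addrC; apply/eqP.
apply: EFin_inj; rewrite EFinD -!emeanE;
  try (exact: regular_tail || exact: regular_level); try by move=> x; exact: ind_le1.
rewrite -iter_kernD; [|by []|exact: regular_tail|exact: regular_level].
by congr (iter n (kern rho) _ [::]); apply/funext => x; exact: tailS.
Qed.

Lemma occ_step B k n : measurable B ->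
  (1 + rho) * occ B k.+1 n.+1 + emean n (top_level B k.+1) =
  (1 + rho) * occ B k.+1 n + rho * mass B * (occ B k n - occ B k.+1 n).
Proof.
move=> mB; rewrite -emean_level//.
have rt := regular_tail k.+1 mB; have rl := regular_level k mB.
have rtl := regular_top_level k.+1 mB.
have rk := regular_kern rho_gt0 rt.
have lam0 : 0 <= 1 + rho by rewrite ltW// lam_gt0.
have rm0 : 0 <= rho * mass B by rewrite mulr_ge0 ?(ltW rho_gt0)// fine_ge0.
rewrite /occ; apply: EFin_inj; rewrite 2!EFinD 3!EFinM -!emeanE//; try by move=> x; exact: ind_le1.
rewrite iterSr -!iter_kernZ// -!iter_kernD//; try exact: regularZ.
by congr (iter n (kern rho) _ [::]); apply/funext => x; rewrite kern_tail.
Qed.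

(** Since the tail probabilities converge, their increments in [occ_step] vanish in the limit; what
    is left equates the flow down from [k.+1] with the flow up from [k]. *)
Lemma cvg_top_level B k : measurable B ->
  emean n (top_level B k.+1) @[n --> \oo] -->
  rho * mass B * (limocc B k - limocc B k.+1).
Proof.
move=> mB.
rewrite (_ : (fun n => _) = (fun n => (1 + rho) * (occ B k.+1 n - occ B k.+1 n.+1) +
  rho * mass B * (occ B k n - occ B k.+1 n))); last first.
  by apply/funext => n; have := occ_step k n mB; lra.
rewrite -[X in _ --> X]add0r; apply: cvgD.
  rewrite -(mulr0 (1 + rho)) -(subrr (limocc B k.+1)).
  apply: cvgMr; apply: cvgB; first exact: cvg_occ.
  by rewrite (cvg_shiftS (occ B k.+1)); exact: cvg_occ.
by apply: cvgMr; apply: cvgB; exact: cvg_occ.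
Qed.

End limits.

(** * Limiting tails on rays and below the critical priority *)

Section stationary.
Context (R : realType) (rho : R) (rho_gt0 : 0 < rho).
Implicit Types (B : set R).

(** Unbounded above so that rays form a generating pi-system of the Borel sets of the line; the
    uniform law puts no mass beyond 1. *)
Definition ray (p : R) : set R := `[p, +oo[%classic.

Lemma measurable_ray p : measurable (ray p).
Proof. exact: measurable_itv. Qed.

Lemma mem_ray p u : (u \in ray p) = (p <= u).
Proof. by rewrite /ray mem_setE in_itv/= andbT. Qed.

Lemma mass_ge0 B : 0 <= mass B.
Proof. exact: fine_ge0. Qed.

(** A ray is closed upwards, so a customer in it forces the top customer into it. The count on a ray
    is therefore a birth-death chain of its own, unaffected by lower priorities. *)
Lemma top_in_ray p x : top_in (ray p) x = (0 < cnt (ray p) x)%N.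
Proof.
rewrite -(cnt_sort (ray p) x) /top_in.
have := sort_sorted (@higher_total R) x; case: (sort _ x) => //= a s.
rewrite take0 /= orbF /cnt /= => /(order_path_min (@higher_trans R)) as_.
case pa : (a \in ray p) => //=; rewrite add0n -has_count; apply/esym/hasPn => u us.
move: pa => /negbT; rewrite !mem_ray -!ltNge => pa; apply: le_lt_trans pa.
exact: (allP as_).
Qed.

Lemma top_in_below B q x : B `<=` ~` ray q -> top_in B x -> cnt (ray q) x = 0%N.
Proof.
move=> Bq tB; apply/eqP; rewrite -leqn0 leqNgt -top_in_ray; apply/negP => tq.
move: tB tq; rewrite /top_in; case: (sort _ x) => //= a s.
by rewrite take0 /= !orbF => /set_mem /Bq /= aq /set_mem.
Qed.

Lemma top_level_ray p k : top_level (ray p) k.+1 = level (ray p) k.+1.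
Proof.
apply/funext => x; rewrite /top_level /level /ind top_in_ray.
by case: eqP => //= ->.
Qed.

Definition load p := rho * mass (ray p).

Lemma load_ge0 p : 0 <= load p.
Proof. by rewrite mulr_ge0 ?mass_ge0 ?ltW. Qed.

(** On a ray [top_level] and [level] coincide at positive counts, so the limit given by the flow
    balance is itself the next level probability. *)
Lemma limocc_ray_rec p k :
  limocc rho (ray p) k.+1 - limocc rho (ray p) k.+2 =
  load p * (limocc rho (ray p) k - limocc rho (ray p) k.+1).
Proof.
have mB := measurable_ray p.
have c1 := cvg_top_level rho_gt0 (k := k) mB.
have c2 : emean rho n (top_level (ray p) k.+1) @[n --> \oo] -->
    limocc rho (ray p) k.+1 - limocc rho (ray p) k.+2.
  rewrite (top_level_ray p k); under eq_fun do rewrite emean_level//.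
  by apply: cvgB; exact: cvg_occ.
by rewrite -(cvg_lim _ c2)// (cvg_lim _ c1).
Qed.

Lemma limocc_ray_geom p k : limocc rho (ray p) k - limocc rho (ray p) k.+1 =
  load p ^+ k * (1 - limocc rho (ray p) 1).
Proof.
elim: k => [|k IH]; first by rewrite expr0 mul1r limocc0//; exact: measurable_ray.
by rewrite limocc_ray_rec IH exprS mulrA.
Qed.

Lemma limocc_ray_sum p k : limocc rho (ray p) k =
  1 - (\sum_(j < k) load p ^+ j) * (1 - limocc rho (ray p) 1).
Proof.
elim: k => [|k IH].
  by rewrite big_ord0 mul0r subr0 limocc0//; exact: measurable_ray.
rewrite big_ord_recr /= mulrDl opprD addrA -IH -limocc_ray_geom.
by rewrite opprB addrC subrK.
Qed.

(** All level probabilities are at least the limiting probability of an empty ray. Were it positive,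
    finitely many levels would already carry more than the total mass 1. *)
Lemma limocc_ray_ge p k : 1 <= load p -> limocc rho (ray p) k = 1.
Proof.
move=> a1; have mB := measurable_ray p.
suff pi0 : limocc rho (ray p) 1 = 1 by rewrite limocc_ray_sum pi0 subrr mulr0 subr0.
apply/eqP; rewrite eq_le limocc_le1//= -subr_le0 leNgt; apply/negP => pi_gt0.
(* With this many levels the sum exceeds 1, so the formula makes the [n]-th tail negative. *)
pose n := Num.bound (1 - limocc rho (ray p) 1)^-1.
have /negP := limocc_ge0 rho_gt0 n mB; apply; apply/negP; rewrite -ltNge.
rewrite limocc_ray_sum subr_lt0.
apply: (@lt_le_trans _ _ (n%:R * (1 - limocc rho (ray p) 1))).
  rewrite -ltr_pdivrMr// mul1r; apply: archi_boundP.
  by rewrite invr_ge0 ltW.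
rewrite ler_wpM2r ?(ltW pi_gt0)// -[n in n%:R]card_ord -sum1_card natr_sum.
by apply: ler_sum => j _; exact: exprn_ege1.
Qed.

Definition muE n B : \bar R := iter n (kern rho) (cntE B) [::].

Lemma muE_step n B : measurable B ->
  ((1 + rho)%:E * muE n.+1 B + (emean rho n (ind (top_in B)))%:E =
   (1 + rho)%:E * muE n B + (rho * mass B)%:E)%E.
Proof.
move=> mB; have rc := regular_cntE mB; have rti := regular_top_in mB.
have rk := regular_kern rho_gt0 rc.
have lam0 : 0 <= 1 + rho by rewrite ltW// lam_gt0.
have rm0 : 0 <= rho * mass B by rewrite mulr_ge0 ?mass_ge0 ?ltW.
rewrite -emeanE//; last by move=> x; exact: ind_le1.
rewrite /muE iterSr -!iter_kernZ// -iter_kernD//; last exact: (regularZ lam0).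
rewrite -(iter_kern_cst rho_gt0 n [::] rm0) -iter_kernD//; last exact: (regularZ lam0).
by congr (iter n (kern rho) _ [::]); apply/funext => x; rewrite kern_cntE.
Qed.

Lemma muE_ge0 n B : measurable B -> (0 <= muE n B)%E.
Proof. by move=> mB; apply: iter_kern_ge0 => //; exact: regular_cntE. Qed.

Lemma muE_fin n B : measurable B -> muE n B \is a fin_num.
Proof.
move=> mB; elim: n => [//|n IH].
have := muE_step n mB; rewrite -(fineK IH) -EFinM -EFinD.
have := muE_ge0 n.+1 mB; case: (muE n.+1 B) => //.
by rewrite gt0_muley ?lte_fin ?lam_gt0.
Qed.

Lemma muE_nondecreasing B : measurable B -> nondecreasing_seq (muE ^~ B).
Proof.
move=> mB; apply: iter_kern_nil_nondecreasing => //; first exact: regular_cntE.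
exact: cntE_increasing.
Qed.

(** From the empty system the mean count never decreases, so its drift is nonnegative at every
    step. *)
Lemma emean_top_le n B : measurable B -> emean rho n (ind (top_in B)) <= rho * mass B.
Proof.
move=> mB; have := muE_step n mB.
have := @muE_nondecreasing _ mB n n.+1 (leqnSn n).
rewrite -(fineK (muE_fin n mB)) -(fineK (muE_fin n.+1 mB)) -!EFinM -!EFinD lee_fin.
move=> nn [] H.
have : (1 + rho) * fine (muE n B) <= (1 + rho) * fine (muE n.+1 B).
  by rewrite ler_wpM2l// ltW// lam_gt0.
by move: H; lra.
Qed.

(** The recursion leaves the value at 1 free. The drift bound [emean_top_le] gives [load p] as an
    upper bound, since a nonempty ray has its top customer in service; nonnegativity of all tails
    gives the lower bound. *)
Lemma limocc_ray_lt p k : load p < 1 -> limocc rho (ray p) k = load p ^+ k.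
Proof.
move=> a1; have mB := measurable_ray p; have a0 := load_ge0 p.
have F1 : limocc rho (ray p) 1 <= load p.
  apply: limr_le; first by apply: cvgP; exact: cvg_occ.
  near=> n; rewrite /occ (_ : tail (ray p) 1 = ind (top_in (ray p))).
    exact: emean_top_le.
  by apply/funext => x; rewrite /tail /ind top_in_ray.
have sumE j : (1 - load p) * (\sum_(i < j) load p ^+ i) = 1 - load p ^+ j.
  by rewrite -(opprB (load p) 1) mulNr -subrX1 opprB.
suff F1E : limocc rho (ray p) 1 = load p.
  by rewrite limocc_ray_sum F1E mulrC sumE opprB addrC subrK.
apply/eqP; rewrite eq_le F1 /= -subr_le0.
(* Nonnegativity of the [j]-th tail says that the first [j] geometric terms, times the limiting
   probability of an empty ray, sum to at most 1. *)
have H j : (load p - limocc rho (ray p) 1) <= load p ^+ j.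
  have := limocc_ge0 rho_gt0 j mB; rewrite limocc_ray_sum subr_ge0 => Hj.
  have H2 : (1 - load p ^+ j) * (1 - limocc rho (ray p) 1) <= 1 - load p.
    by rewrite -sumE -mulrA ler_piMr// subr_ge0 ltW.
  have : load p ^+ j * (1 - limocc rho (ray p) 1) <= load p ^+ j.
    rewrite ler_piMr ?exprn_ge0// lerBlDr lerDl.
    exact: limocc_ge0.
  by move: H2; rewrite mulrBl mul1r; lra.
have c : (fun j => load p ^+ j) @ \oo --> (0 : R).
  by apply: cvg_expr; rewrite ger0_norm.
rewrite -(cvg_lim _ c)//; apply: limr_ge; first by apply: cvgP; exact: c.
by near=> j; exact: H.
Unshelve. all: end_near. Qed.

(** Customers in [B] are served only when [ray q] is empty, an event of vanishing probability. No
    flow goes down in the limit, so none goes up either, and with arrivals at positive rate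
    consecutive tails must be equal. *)
Lemma limocc_below B q k : measurable B -> B `<=` ~` ray q -> 1 <= load q ->
  0 < mass B -> limocc rho B k = 1.
Proof.
move=> mB Bq a1 B0; elim: k => [|k IH]; first exact: limocc0.
have mr := measurable_ray q.
have c1 := cvg_top_level rho_gt0 (k := k) mB.
have c2 : (fun n => 1 - occ rho (ray q) 1 n) @ \oo --> (0 : R).
  rewrite (_ : 0 = 1 - limocc rho (ray q) 1); last by rewrite limocc_ray_ge// subrr.
  by apply: cvgB; [exact: cvg_cst|exact: cvg_occ].
(* Squeezed by the probability that [ray q] is empty, written as the level 0 of that ray. *)
have c3 : emean rho n (top_level B k.+1) @[n --> \oo] --> (0 : R).
  apply: (squeeze_cvgr _ (cvg_cst 0) c2); near=> n.
  rewrite emean_ge0//=; last exact: regular_top_level.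
  rewrite -(occ0 rho_gt0 (ray q) n) -emean_level//; apply: emean_le => //.
  - exact: regular_top_level.
  - exact: regular_level.
  - move=> x; rewrite /top_level /level /ind lee_fin ler_nat.
    case tB : (top_in B x); last by rewrite andbF.
    by rewrite (top_in_below Bq tB) eqxx; case: (_ == _).
  - by move=> x; exact: ind_le1.
have : rho * mass B * (limocc rho B k - limocc rho B k.+1) = 0.
  by rewrite -(cvg_lim _ c3)// (cvg_lim _ c1).
by move=> /eqP; rewrite !mulf_eq0 (gt_eqF rho_gt0) (gt_eqF B0) /= subr_eq0 IH => /eqP <-.
Unshelve. all: end_near. Qed.

Lemma limocc_null B k : measurable B -> mass B = 0 -> limocc rho B k.+1 = 0.
Proof.
move=> mB B0.
have occ_eq0 n : occ rho B k.+1 n = 0.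
  elim: n => [|n IH]; first by rewrite /occ /emean /=.
  have := occ_step rho_gt0 k n mB; rewrite IH B0 !(mulr0, mul0r, add0r).
  have o1 : 0 <= occ rho B k.+1 n.+1 by apply: emean_ge0 => //; exact: regular_tail.
  have o2 : 0 <= emean rho n (top_level B k.+1).
    by apply: emean_ge0 => //; exact: regular_top_level.
  move=> H; apply/eqP; rewrite eq_le o1 andbT.
  rewrite -(pmulr_rle0 _ (lam_gt0 rho_gt0)); lra.
apply/cvg_lim => //; rewrite (_ : occ rho B k.+1 = fun=> 0); first exact: cvg_cst.
by apply/funext => n; exact: occ_eq0.
Qed.

End stationary.

(** * The limiting mean as a measure in the set of priorities *)

(** Series are integrals against the counting measure, so this is monotone convergence. *)
Lemma lim_nneseries (R : realType) (u : nat -> nat -> \bar R) :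
  (forall n k, 0 <= u n k)%E -> (forall k, nondecreasing_seq (u ^~ k)) ->
  (limn (fun n => \sum_(k <oo) u n k) = \sum_(k <oo) limn (u ^~ k))%E.
Proof.
move=> u0 nu.
under eq_fun do rewrite -ge0_integral_count//.
rewrite -ge0_integral_count; last first.
  move=> k; apply: lime_ge; first exact: ereal_nondecreasing_is_cvgn.
  by near=> n; exact: u0.
rewrite monotone_convergence// => k _ n m nm; exact: nu.
Unshelve. all: end_near. Qed.

Section mean_measure.
Context (R : realType) (rho : R) (rho_gt0 : 0 < rho).
Local Open Scope ereal_scope.
Implicit Types (B : set R).

Lemma kern_nneseries (f : nat -> seq R -> \bar R) x : (forall n, regular (f n)) ->
  kern rho (fun y => \sum_(n <oo) f n y) x = \sum_(n <oo) kern rho (f n) x.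
Proof.
move=> rf; have f0 n y : 0 <= f n y by case: (rf n).
have mf n : measurable_fun setT (f n) by case: (rf n).
have rho0 : 0 <= rho%:E by rewrite lee_fin ltW.
have A0 n y : 0 <= arrive (f n) y by exact: arrive_ge0.
rewrite /kern ge0_nneseriesZl; last 2 first.
- by rewrite lee_fin invr_ge0 ltW// lam_gt0.
- by move=> n; apply: adde_ge0; [exact: f0|exact: mule_ge0].
congr (_ * _); rewrite /evolve nneseriesD; last 2 first.
- by move=> n _ _; exact: f0.
- by move=> n _ _; exact: mule_ge0.
by rewrite arrive_nneseries// ge0_nneseriesZl.
Qed.

Lemma iter_kern_nneseries (f : nat -> seq R -> \bar R) m x : (forall n, regular (f n)) ->
  iter m (kern rho) (fun y => \sum_(n <oo) f n y) x =
  \sum_(n <oo) iter m (kern rho) (f n) x.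
Proof.
move=> rf; elim: m x => //= m IH x.
rewrite (_ : iter m _ _ = fun y => \sum_(n <oo) iter m (kern rho) (f n) y).
  by rewrite kern_nneseries// => n; exact: regular_iter_kern.
by apply/funext.
Qed.

Lemma cntE_tail B x : cntE B x = \sum_(k <oo) tail B k.+1 x.
Proof.
rewrite (nneseries_split 0 (cnt B x)); last by move=> k _; rewrite lee_fin.
rewrite add0n [X in _ + X]eseries0 ?adde0; last first.
  by move=> k xk _; rewrite /tail /ind ltnNge xk.
rewrite big_nat (eq_bigr (fun=> 1)); last by move=> k /andP[_ kx]; rewrite /tail /ind kx.
rewrite -big_nat big_const_nat subn0 /cntE.
by elim: (cnt B x) => //= n <-; rewrite -EFinD -natr1 addrC.
Qed.

Lemma cntE_bigcup (F : (set R)^nat) x : trivIset setT F ->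
  cntE (\bigcup_i F i) x = \sum_(i <oo) cntE (F i) x.
Proof.
move=> tF; elim: x => [|u x IH].
  by rewrite /cntE /= eseries0.
have cntES B : cntE B (u :: x) = \d_u B + cntE B x.
  by rewrite /cntE /cnt /= natrD EFinD diracE.
rewrite cntES IH; under [RHS]eq_eseriesr do rewrite cntES.
rewrite nneseriesD; last 2 first.
- by move=> i _ _; rewrite diracE lee_fin.
- by move=> i _ _; rewrite lee_fin.
congr (_ + _).
rewrite diracE; case: (pselect ((\bigcup_i F i) u)) => [[i _ Fiu]|nu].
  rewrite mem_set; last by exists i.
  rewrite (nneseriesD1 (n := i))// diracE mem_set// eseries0 ?adde0// => j _ /= ji.
  rewrite diracE memNset// => Fju; move/eqP: ji; apply.
  by apply: (tF j i) => //; exists u.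
rewrite memNset// eseries0// => i _ _; rewrite diracE memNset// => Fiu.
by apply: nu; exists i.
Qed.

Lemma muE_occ n B : measurable B -> muE rho n B = \sum_(k <oo) (occ rho B k.+1 n)%:E.
Proof.
move=> mB; rewrite /muE (_ : cntE B = fun x => \sum_(k <oo) tail B k.+1 x); last first.
  by apply/funext => x; exact: cntE_tail.
rewrite iter_kern_nneseries; last by move=> k; exact: regular_tail.
apply: eq_eseriesr => k _; apply: emeanE => //; first exact: regular_tail.
by move=> x; exact: ind_le1.
Qed.

(** A supremum is nonnegative on every set, measurable or not, as the measure structure demands; on
    measurable sets it is the limit of a nondecreasing sequence. *)
Definition mean_measure B := ereal_sup (range (fun n => muE rho n B)).

Lemma mean_measure_lim B : measurable B -> mean_measure B = limn (fun n => muE rho n B).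
Proof.
move=> mB; apply/esym/cvg_lim => //; apply: ereal_nondecreasing_cvgn.
exact: muE_nondecreasing.
Qed.

Lemma mean_measure_occ B : measurable B ->
  mean_measure B = \sum_(k <oo) (limocc rho B k.+1)%:E.
Proof.
move=> mB; rewrite mean_measure_lim//.
rewrite (_ : (fun n => _) = fun n => \sum_(k <oo) (occ rho B k.+1 n)%:E); last first.
  by apply/funext => n; exact: muE_occ.
rewrite (lim_nneseries (u := fun n k => (occ rho B k.+1 n)%:E)); last 2 first.
- by move=> n k; rewrite lee_fin emean_ge0//; exact: regular_tail.
- by move=> k n m nm; rewrite lee_fin; exact: occ_nondecreasing.
apply: eq_eseriesr => k _; apply/cvg_lim => //.
by apply: cvg_EFin; [exact: nearW|exact: cvg_occ].
Qed.

Let mean_measure0 : mean_measure set0 = 0.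
Proof.
rewrite mean_measure_occ// eseries0// => k _ _.
by rewrite limocc_null// /mass measure0.
Qed.

Let mean_measure_ge0 B : 0 <= mean_measure B.
Proof.
apply: (@le_trans _ _ (muE rho 0 B)); first by rewrite lee_fin.
by apply: ereal_sup_ubound; exists 0%N.
Qed.

(** For fixed [n] additivity is inherited from the counts, because [kern] commutes with nonnegative
    series; monotonicity in [n] then lets the limit pass through the series. *)
Let mean_measure_sigma_additive : semi_sigma_additive mean_measure.
Proof.
move=> F mF tF mUF; apply: cvg_toP.
  apply: ereal_nondecreasing_is_cvgn => m n mn.
  by apply: lee_sum_nneg_natr => // k _ _; exact: mean_measure_ge0.
rewrite mean_measure_lim//.
rewrite (_ : (fun n => muE rho n _) = fun n => \sum_(i <oo) muE rho n (F i)); last first.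
  apply/funext => n; rewrite /muE -iter_kern_nneseries.
    by congr (iter n (kern rho) _ [::]); apply/funext => x; exact: cntE_bigcup.
  by move=> i; exact: regular_cntE.
rewrite lim_nneseries.
- by apply: eq_eseriesr => i _; exact: mean_measure_lim.
- by move=> n k; exact: muE_ge0.
- by move=> k; exact: muE_nondecreasing.
Qed.

HB.instance Definition _ := isMeasure.Build _ _ _ mean_measure
  mean_measure0 mean_measure_ge0 mean_measure_sigma_additive.

End mean_measure.

(** * The density and its integrals over rays *)

Section density_of_mean.
Context (R : realType) (rho : R) (rho_gt0 : 0 < rho).
Implicit Types (B : set R).

Lemma unif_lebesgue B : measurable B ->
  unif R B = lebesgue_measure (B `&` `[0%R, 1%R]).
Proof.
move=> mB; rewrite -[LHS]/(unif R B).
transitivity (\int[unif R]_u (\1_B u)%:E)%E.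
  by rewrite integral_indic// setIT.
rewrite integral_unif//; last exact/measurable_EFinP.
by rewrite integral_indic.
Qed.

Lemma mass_ray (p : R) : 0 <= p -> p <= 1 -> mass (ray p) = 1 - p.
Proof.
move=> p0 p1; rewrite /mass unif_lebesgue; last exact: measurable_ray.
rewrite (_ : ray p `&` `[0%R, 1%R] = `[p, 1%R]%classic).
  rewrite lebesgue_measure_itv /= lte_fin; case: ltP => // p1'.
  by rewrite /= (_ : p = 1) ?subrr//; apply/eqP; rewrite eq_le p1 p1'.
rewrite /ray; apply/seteqP; split=> u /=; rewrite !in_itv/= ?andbT.
  by move=> [-> /andP[_ ->]].
by move=> /andP[pu ->]; rewrite pu (le_trans p0 pu).
Qed.

Lemma mass_ray_gt1 (p : R) : 1 < p -> mass (ray p) = 0.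
Proof.
move=> p1; rewrite /mass unif_lebesgue; last exact: measurable_ray.
rewrite (_ : ray p `&` _ = set0) ?measure0//.
rewrite /ray; apply/seteqP; split=> u //=; rewrite !in_itv/= andbT => -[pu /andP[_]].
by move=> u1; have := lt_le_trans p1 pu; rewrite ltNge u1.
Qed.

Lemma mean_measure_ray (p : R) : load rho p < 1 ->
  mean_measure rho (ray p) = (load rho p / (1 - load rho p))%:E.
Proof.
move=> a1; have mr := measurable_ray p; have a0 := load_ge0 rho_gt0 p.
rewrite mean_measure_occ//.
under eq_eseriesr do rewrite (limocc_ray_lt rho_gt0)//.
apply/cvg_lim => //.
rewrite (_ : (fun n => _) = EFin \o series (geometric (load rho p) (load rho p))).
  apply: cvg_EFin; first exact: nearW.
  by apply: cvg_geometric_series; rewrite ger0_norm.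
apply/funext => n /=; rewrite sumEFin; congr EFin.
by rewrite /series /=; apply: eq_bigr => k _; rewrite exprS.
Qed.

Definition densityR (p : R) : R := rho / (1 - (1 - p) * rho) ^+ 2.

Lemma mean_density_ge0 p : (0 <= mean_density rho p)%E.
Proof.
rewrite /mean_density; case: ifP => // _.
by rewrite lee_fin divr_ge0 ?sqr_ge0// ltW.
Qed.

Lemma measurable_mean_density : measurable_fun setT (mean_density rho).
Proof.
have m1 : measurable_fun setT (fun p : R => (1 - p) * rho).
  by apply: measurable_funM => //; exact: measurable_funB.
(* On the finite branch the base is positive, so the inverse square can be written with [ln] and
   [expR], whose measurability is at hand. *)
rewrite (_ : mean_density rho = fun p => if (1 - p) * rho < 1
    then (rho * expR (- (ln (1 - (1 - p) * rho)) *+ 2))%:E else +oo%E); last first.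
  apply/funext => p; rewrite /mean_density; case: ifP => // pr.
  by rewrite -mulr_natr expRM_natr expRN lnK ?exprVn// posrE subr_gt0.
apply: measurable_fun_ifT; last exact: measurable_cst.
  by apply: measurable_fun_ltr => //.
apply/measurable_EFinP; apply: measurable_funM => //.
apply: measurableT_comp (@measurable_expR R) _.
have mN : measurable_fun setT (fun p : R => - ln (1 - (1 - p) * rho)).
  apply: measurable_funN; apply: measurableT_comp (@measurable_ln R) _.
  exact: measurable_funB.
by under eq_fun do rewrite mulr2n; exact: measurable_funD.
Qed.

(** Cut down to [[0, 1]] so as to be comparable with [mean_measure] on rays and on all Borel sets of
    the line. *)
Definition density_measure B : \bar R :=
  (\int[lebesgue_measure]_(p in B `&` `[0%R, 1%R]) mean_density rho p)%E.

Let density_measure0 : density_measure set0 = 0%E.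
Proof. by rewrite /density_measure set0I integral_set0. Qed.

Let density_measure_ge0 B : (0 <= density_measure B)%E.
Proof. by apply: integral_ge0 => p _; exact: mean_density_ge0. Qed.

Let density_measure_sigma_additive : semi_sigma_additive density_measure.
Proof.
move=> F mF tF mUF; apply: cvg_toP.
  apply: ereal_nondecreasing_is_cvgn => m n mn.
  by apply: lee_sum_nneg_natr => // k _ _; exact: density_measure_ge0.
rewrite /density_measure setI_bigcupl ge0_integral_bigcup//.
- by move=> n; apply: measurableI => //; exact: mF.
- by apply: measurable_funTS; exact: measurable_mean_density.
- by move=> p _; exact: mean_density_ge0.
- exact: trivIset_setIr.
Qed.

HB.instance Definition _ := isMeasure.Build _ _ _ density_measure
  density_measure0 density_measure_ge0 density_measure_sigma_additive.

Lemma density_measure_ray (p : R) : 0 <= p -> p <= 1 -> (1 - p) * rho < 1 ->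
  density_measure (ray p) = ((1 - p) * rho / (1 - (1 - p) * rho))%:E.
Proof.
move=> p0 p1 a1; rewrite /density_measure.
rewrite (_ : ray p `&` `[0%R, 1%R] = `[p, 1%R]%classic); last first.
  rewrite /ray; apply/seteqP; split=> u /=; rewrite !in_itv/= ?andbT.
    by move=> [-> /andP[_ ->]].
  by move=> /andP[pu ->]; rewrite pu (le_trans p0 pu).
move: p1; rewrite le_eqVlt => /predU1P[->|p1].
  by rewrite set_itv1 integral_set1 subrr !mul0r.
have pos x : p <= x -> 0 < 1 - (1 - x) * rho.
  move=> px; rewrite subr_gt0 (le_lt_trans _ a1)// ler_wpM2r ?(ltW rho_gt0)//.
  by rewrite lerB.
rewrite (eq_integral (fun x : measurableTypeR R => (densityR x)%:E)); last first.
  move=> x; rewrite inE /= in_itv/= => /andP[px _].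
  by rewrite /mean_density -subr_gt0 pos.
(* A primitive of the density. With [a = (1 - p) * rho] it takes the values [- 1 / (1 - a)] at [p]
   and [- 1] at 1, whose difference is [a / (1 - a)]. *)
have d1 (x : R) : p <= x -> is_derive x 1 (fun z : R => - (1 - (1 - z) * rho)^-1) (densityR x).
  move=> px; have := pos _ px => xpos.
  have d2 : is_derive x 1 (fun z : R => 1 - (1 - z) * rho) rho.
    rewrite (_ : (fun z : R => _) = cst (1 - rho) + rho \*: (@id R)); last first.
      by apply/funext => z; transitivity (1 - rho + rho * z); [ring|by []].
    apply: is_derive_eq.
    by rewrite add0r /GRing.scale/= mulr1.
  have xN0 : 1 - (1 - x) * rho != 0 by rewrite gt_eqF.
  have := is_deriveN (is_deriveV (f := fun z : R => 1 - (1 - z) * rho) xN0 d2).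
  by congr is_derive; rewrite /GRing.scale/= /densityR mulNr opprK mulrC.
rewrite (continuous_FTC2 (F := fun z : R => - (1 - (1 - z) * rho)^-1) p1).
- rewrite subrr mul0r subr0 invr1 -EFinB; congr EFin.
  have := pos _ (lexx p); set y := (1 - p) * rho => y0.
  by field; rewrite gt_eqF.
- apply/continuous_within_itvP => //.
  have cd x : p <= x -> {for x, continuous densityR}.
    move=> px; apply: cvgM; first exact: cvg_cst.
    apply: cvgV; first by rewrite sqrf_eq0 gt_eqF// pos.
    apply: (@continuous_comp _ _ _ (fun z : R => 1 - (1 - z) * rho) (fun y => y ^+ 2)).
      apply: cvgB; first exact: cvg_cst.
      apply: cvgM; last exact: cvg_cst.
      by apply: cvgB; [exact: cvg_cst|].
    exact: exprn_continuous.
  split.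
  + by move=> x; rewrite in_itv/= => /andP[px _]; apply: cd; exact: ltW.
  + exact/cvg_at_right_filter/cd.
  + by apply/cvg_at_left_filter/cd; exact: ltW.
- have cF (x : R) : p <= x -> {for x, continuous (fun z : R => - (1 - (1 - z) * rho)^-1)}.
    move=> px; apply: differentiable_continuous; apply/derivable1_diffP.
    by case: (d1 _ px).
  split.
  + by move=> x; rewrite in_itv/= => /andP[/ltW/d1[]].
  + exact/cvg_at_right_filter/cF.
  + by apply/cvg_at_left_filter/cF; exact: ltW.
- by move=> x; rewrite in_itv/= => /andP[/ltW/d1[dd <-] _]; rewrite derive1E.
Qed.

End density_of_mean.

(** * Identification of the limiting mean *)

Section mean_is_density.
Context (R : realType) (rho : R) (rho_gt0 : 0 < rho).
Implicit Types (B : set R).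

Lemma rayI p p' : ray p `&` ray p' = ray (Num.max p p') :> set R.
Proof.
apply/seteqP; rewrite /ray; split=> u /=; rewrite !in_itv/= !andbT ge_max.
  by move=> [-> ->].
by move=> /andP[].
Qed.

Lemma load_ray (p : R) : 0 <= p -> p <= 1 -> load rho p = (1 - p) * rho.
Proof. by move=> p0 p1; rewrite /load mass_ray// mulrC. Qed.

Lemma mean_density_ray (p : R) : 0 <= p -> (1 - p) * rho < 1 ->
  mean_measure rho (ray p) = density_measure rho (ray p).
Proof.
move=> p0 a1; have [p1|p1] := leP p 1.
  by rewrite mean_measure_ray ?load_ray// density_measure_ray.
have l0 : load rho p = 0 by rewrite /load mass_ray_gt1// mulr0.
rewrite mean_measure_ray ?l0 ?ltr01// mul0r /density_measure.
rewrite (_ : ray p `&` _ = set0) ?integral_set0//.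
rewrite /ray; apply/seteqP; split=> u //=; rewrite !in_itv/= andbT => -[pu /andP[_]].
by move=> u1; have := lt_le_trans p1 pu; rewrite ltNge u1.
Qed.

Lemma density_ray_lty (p : R) : 0 <= p -> (1 - p) * rho < 1 ->
  (mean_measure rho (ray p) < +oo)%E.
Proof.
move=> p0 a1; have [p1|p1] := leP p 1.
  by rewrite mean_measure_ray ?load_ray// ltry.
rewrite mean_measure_ray ?ltry// /load mass_ray_gt1// mulr0.
exact: ltr01.
Qed.

(** Restricted to [ray p0] both measures are finite, and they agree on rays since two rays intersect
    in a ray; uniqueness on a pi-system does the rest. *)
Lemma mean_density_above (p0 : R) B : 0 <= p0 -> (1 - p0) * rho < 1 -> measurable B ->
  mean_measure rho (B `&` ray p0) = density_measure rho (B `&` ray p0).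
Proof.
move=> p00 a1 mB; have mr := measurable_ray p0.
have maxr p : 0 <= Num.max p p0 /\ (1 - Num.max p p0) * rho < 1.
  split; first by rewrite le_max p00 orbT.
  by rewrite (le_lt_trans _ a1)// ler_wpM2r ?(ltW rho_gt0)// lerB// le_max lexx orbT.
apply: (@measure_unique _ R R (@RGenCInfty.G R) (fun n => ray (- n%:R))
  _ _ _ _ (mrestr (mean_measure rho) mr) (mrestr (density_measure rho) mr)) => //.
- exact: RGenCInfty.measurableE.
- by move=> _ _ [x ->] [y ->]; exists (Num.max x y); exact: rayI.
- by move=> n; exists (- n%:R).
- apply/seteqP; split=> // z _; exists (Num.bound `|z|) => //=.
  rewrite /ray /= in_itv/= andbT lerNl (le_trans (ler_norm _))// normrN.
  by apply: ltW; exact: archi_boundP.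
- move=> _ [p ->].
  change (mean_measure rho (ray p `&` ray p0) = density_measure rho (ray p `&` ray p0)).
  rewrite rayI.
  by have [m0 m1] := maxr p; exact: mean_density_ray.
- move=> n; change (mean_measure rho (ray (- n%:R) `&` ray p0) < +oo)%E; rewrite rayI.
  by have [m0 m1] := maxr (- n%:R); exact: density_ray_lty.
Qed.

Definition light B := B `&` [set p | (1 - p) * rho < 1].
Definition heavy B := B `&` [set p | 1 <= (1 - p) * rho].

(** The root in [p] of [(1 - p) * rho = 1]. It is negative for [rho < 1], and then no priority in
    [[0, 1]] is heavy. *)
Definition crit : R := 1 - rho^-1.

Lemma heavyE B : heavy B = B `&` `]-oo, crit].
Proof.
congr (_ `&` _); apply/seteqP; split=> p /=; rewrite in_itv/= /crit.
  by rewrite lerBrDr -lerBrDl -ler_pdivrMr// mul1r.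
by move=> pc; rewrite -ler_pdivrMr// mul1r; move: pc; rewrite lerBrDr -lerBrDl.
Qed.

Lemma lightE B : light B = B `&` `]crit, +oo[.
Proof.
congr (_ `&` _); apply/seteqP; split=> p /=; rewrite in_itv/= andbT /crit.
  by rewrite -ltr_pdivlMr// mul1r ltrBlDr -ltrBlDl.
by move=> pc; rewrite -ltr_pdivlMr// mul1r ltrBlDr -ltrBlDl.
Qed.

Lemma measurable_light B : measurable B -> measurable (light B).
Proof. by move=> mB; rewrite lightE; apply: measurableI => //; exact: measurable_itv. Qed.

Lemma measurable_heavy B : measurable B -> measurable (heavy B).
Proof. by move=> mB; rewrite heavyE; apply: measurableI => //; exact: measurable_itv. Qed.

Lemma light_heavy B : B = light B `|` heavy B.
Proof.
rewrite /light /heavy -setIUr; apply/esym/setIidPl => p _ /=.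
by case: (ltP ((1 - p) * rho) 1) => H; [left|right].
Qed.

(** The measures may be infinite near [crit], so equality is proved above levels decreasing to it
    and passes to the union by continuity from below. *)
Lemma mean_density_light B : measurable B -> B `<=` `[0, 1] ->
  mean_measure rho (light B) = density_measure rho (light B).
Proof.
move=> mB B01.
(* The second entry is where [(1 - p) * rho] equals [1 - 1 / j.+1]; the maximum with 0 keeps the
   level nonnegative, as the formulas for rays require. *)
pose p j : R := Num.max 0 (crit + (rho * j.+1%:R)^-1).
have pj j : 0 <= p j /\ (1 - p j) * rho < 1.
  split; first by rewrite le_max lexx.
  rewrite -ltr_pdivlMr// mul1r ltrBlDr -ltrBlDl -/crit /p lt_max ltrDl.
  by rewrite invr_gt0 mulr_gt0// orbT.
have p_dec i j : (i <= j)%N -> p j <= p i.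
  move=> ij; rewrite /p ge_max le_max lexx /= le_max lerD2l lef_pV2 ?posrE ?mulr_gt0//.
  by rewrite ler_pM2l// ler_nat ltnS ij orbT.
have lightU : light B = \bigcup_j (B `&` ray (p j)).
  apply/seteqP; split=> [x|x [j _ [Bx]]].
    rewrite lightE => -[Bx]; rewrite /= in_itv/= andbT => cx.
    exists (Num.bound ((x - crit) * rho)^-1) => //; split=> //.
    rewrite /ray /= in_itv/= andbT ge_max; apply/andP; split.
      by have := B01 _ Bx; rewrite /= in_itv/= => /andP[].
    have x0 : 0 < x - crit by rewrite subr_gt0.
    have := archi_boundP (_ : 0 <= ((x - crit) * rho)^-1).
    rewrite invr_ge0 mulr_ge0 ?(ltW x0) ?(ltW rho_gt0)// => /(_ isT) H.
    rewrite -lerBrDl -[leLHS]mul1r ler_pdivrMr ?mulr_gt0// mulrA.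
    rewrite -ler_pdivrMl ?mulr_gt0// mulr1 (le_trans (ltW H))// ler_nat.
    exact: leqnSn.
  rewrite /ray /= in_itv/= andbT ge_max => /andP[_ px]; rewrite lightE; split=> //=.
  by rewrite in_itv/= andbT; apply: lt_le_trans px; rewrite ltrDl invr_gt0 mulr_gt0.
have mU j : measurable (B `&` ray (p j)) by apply: measurableI => //; exact: measurable_ray.
have ndU : nondecreasing_seq (fun j => B `&` ray (p j)).
  move=> i j ij; apply/subsetPset => x [Bx px]; split=> //; move: px.
  by rewrite /ray /= !in_itv/= !andbT; exact: le_trans (p_dec _ _ ij).
have mL : measurable (\bigcup_j (B `&` ray (p j))) by rewrite -lightU; exact: measurable_light.
have c1 := nondecreasing_cvg_mu (mu := mean_measure rho) mU mL ndU.
have c2 := nondecreasing_cvg_mu (mu := density_measure rho) mU mL ndU.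
rewrite lightU -(cvg_lim _ (c1 rho_gt0))// -(cvg_lim _ (c2 rho_gt0))//; apply: (congr1 (fun f : nat -> \bar R => limn f)).
by apply/funext => j /=; have [? ?] := pj j; exact: mean_density_above.
Qed.

Lemma mean_density_eq B : measurable B -> B `<=` `[0, 1] ->
  mean_measure rho B = density_measure rho B.
Proof.
move=> mB B01; have mL := measurable_light mB; have mH := measurable_heavy mB.
have dLH : [disjoint light B & heavy B]%classic.
  apply/disj_setPS => p [[_ /= pl] [_ /= ph]].
  by move: pl; rewrite ltNge ph.
have LH0 : light B `&` heavy B = set0 by apply/disj_set2P.
have split_mu (mu : {measure set R -> \bar R}) :
    mu B = (mu (light B) + mu (heavy B))%E.
  by rewrite -measureU// -light_heavy.
have S1 := split_mu (mean_measure rho); have S2 := split_mu (density_measure rho).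
refine (etrans (S1 rho_gt0) (etrans _ (esym (S2 rho_gt0)))).
rewrite /= mean_density_light//; congr (_ + _)%E.
have heavy01 : heavy B `&` `[0%R, 1%R] = heavy B.
  by apply/setIidPl => p [/B01].
have uE := unif_lebesgue mH; rewrite heavy01 in uE.
(* The density is constantly infinite here. The product is 0 when the heavy part is null, in
   agreement with [limocc_null]. *)
have dE : density_measure rho (heavy B) = (+oo * lebesgue_measure (heavy B))%E.
  rewrite /density_measure heavy01 -integral_cst//; apply: eq_integral => p.
  by rewrite inE => -[_ /= ph]; rewrite /mean_density ltNge ph.
have [H0|H0] := eqVneq (mass (heavy B)) 0.
  rewrite dE -uE unif_mass// H0 mule0 mean_measure_occ// eseries0// => k _ _.
  by rewrite limocc_null.
have {}H0 : 0 < mass (heavy B) by rewrite lt_neqAle eq_sym H0 mass_ge0.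
rewrite dE -uE unif_mass// gt0_mulye ?lte_fin//.
(* The point [crit] belongs to [ray crit]; removing it costs no mass and puts the set strictly below
   that ray. *)
pose B1 := heavy B `\ crit.
have mB1 : measurable B1 by exact: measurableD.
have B1u : unif R B1 = unif R (heavy B).
  rewrite /B1 measureD//; last by rewrite -ge0_fin_numE// fin_num_measure.
  suff E0 : unif R (heavy B `&` [set crit]) = 0%E.
    by refine (etrans (congr1 (fun y => (_ - y)%E) E0) _); rewrite sube0.
  rewrite unif_lebesgue; last exact: measurableI.
  apply/eqP; rewrite eq_le measure_ge0 andbT -(lebesgue_measure_set1 crit).
  apply: le_measure; rewrite ?inE//; first by apply: measurableI => //; exact: measurableI.
  by move=> x [[]].
(* A point of the heavy part lies between 0 and [crit]. Hence [crit] is a priority level in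
   [[0, 1]], with load exactly 1. *)
have c0 : 0 <= crit.
  have [p Hp] : heavy B !=set0.
    apply/set0P/eqP => H; by move: H0; rewrite H /mass measure0 /= ltxx.
  have /B01 : B p by case: Hp.
  rewrite /= in_itv/= => /andP[p00 _].
  by move: Hp; rewrite heavyE => -[_]; rewrite /= in_itv/=; exact: le_trans.
have l1 : load rho crit = 1.
  rewrite load_ray// /crit ?opprB.
    by rewrite addrCA subrr addr0 mulVf// gt_eqF.
  by rewrite lerBlDr lerDl invr_ge0 ltW.
have B1o k : limocc rho B1 k = 1.
  apply: (limocc_below rho_gt0 k mB1 (_ : B1 `<=` ~` ray crit)); last 2 first.
  - by rewrite l1.
  - by rewrite /mass B1u.
  move=> p [hp pc]; rewrite /ray /= in_itv/= andbT => cp; apply: pc; apply/eqP.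
  by move: hp; rewrite heavyE eq_le cp andbT => -[_]; rewrite /= in_itv.
apply/eqP; rewrite -leye_eq; apply: (@le_trans _ _ (mean_measure rho B1)); last first.
  apply: le_measure; rewrite ?inE//; exact: subDsetl.
rewrite mean_measure_occ//; under eq_eseriesr do rewrite B1o.
rewrite leye_eq; apply/eqP; apply: cvg_lim => //.
rewrite (_ : (fun n => _) = (fun n => n%:R%:E)); first exact/cvgeryP/cvgr_idn.
by apply/funext => n; rewrite sumEFin sumr_const_nat subn0.
Qed.

End mean_is_density.

(** * Convergence from an arbitrary initial law *)

Section averages.
Local Open Scope ring_scope.
Context (R : realType).

(** The exceptional set [D] may depend on [i], so the lemma serves two opposite situations: fixed
    weights with terms converging one by one, and a fixed convergent sequence whose weights drift to
    infinity. *)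
Lemma cvg_average (I : Type) (F : set_system I) (FF : Filter F) (a b : I -> nat -> R) (L : R) :
  0 <= L <= 1 ->
  (\forall i \near F, [/\ forall m, 0 <= a i m, (\sum_(m <oo) (a i m)%:E = 1)%E &
    forall m, 0 <= b i m <= 1]) ->
  (forall e : R, 0 < e -> \forall i \near F, exists D : pred nat,
    (\sum_(m <oo) (a i m * (D m)%:R)%:E <= e%:E)%E /\
    forall m, ~~ D m -> `|b i m - L| <= e) ->
  (\sum_(m <oo) (a i m * b i m)%:E)%E @[i --> F] --> L%:E.
Proof.
move=> /andP[L0 L1] Fab FD.
have est (e : R) : 0 < e -> \forall i \near F,
    (\sum_(m <oo) (a i m * b i m)%:E)%E \is a fin_num /\
    `|L - fine (\sum_(m <oo) (a i m * b i m)%:E)%E| <= e + e.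
  move=> e0; have e0' := ltW e0; near=> i.
  have [a0 a1 b01] : [/\ forall m, 0 <= a i m, (\sum_(m <oo) (a i m)%:E = 1)%E &
    forall m, 0 <= b i m <= 1] by near: i.
  have [D [De Db]] : exists D : pred nat,
    (\sum_(m <oo) (a i m * (D m)%:R)%:E <= e%:E)%E /\
    forall m, ~~ D m -> `|b i m - L| <= e by near: i; exact: FD.
  have ab0 m : (0 <= (a i m * b i m)%:E)%E.
    by rewrite lee_fin mulr_ge0//; case/andP: (b01 m).
  have ac (c : R) : 0 <= c -> (\sum_(m <oo) (a i m * c)%:E = c%:E)%E.
    move=> c0; under eq_eseriesr do rewrite EFinM.
    by rewrite ge0_nneseriesZr ?lee_fin// a1 mul1e.
  have aD0 m : (0 <= (a i m * (D m)%:R)%:E)%E by rewrite lee_fin mulr_ge0.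
  (* On [D] the bound by 1 is used and off [D] the error [e]; as a 0-1 summand, [D] lets both cases
     be summed at once. *)
  have le1 m : b i m <= (L + e) + (D m)%:R.
    have [Dm|Dm] := boolP (D m).
      by case/andP: (b01 m) => _ /= bm; rewrite (le_trans bm)// lerDr addr_ge0.
    by have := Db _ Dm; rewrite /= addr0 ler_norml => /andP[_]; lra.
  have le2 m : L <= b i m + (e + (D m)%:R).
    have [Dm|Dm] := boolP (D m).
      by case/andP: (b01 m) => /= bm _; rewrite (le_trans L1)//; lra.
    by have := Db _ Dm; rewrite /= addr0 ler_norml => /andP[+ _]; lra.
  set S := (\sum_(m <oo) (a i m * b i m)%:E)%E.
  have S0 : (0 <= S)%E by exact: nneseries_ge0.
  have SL : (S <= (L + e + e)%:E)%E.
    apply: (@le_trans _ _ (\sum_(m <oo) ((a i m * (L + e))%:E + (a i m * (D m)%:R)%:E))%E).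
      by apply: lee_nneseries => // m _; rewrite -EFinD lee_fin -mulrDr ler_wpM2l.
    rewrite nneseriesD//; last by move=> m _; rewrite lee_fin mulr_ge0// addr_ge0.
    by rewrite ac ?addr_ge0// (EFinD (L + e) e); exact: leeD2l.
  have LS : (L%:E <= S + (e + e)%:E)%E.
    rewrite -[in leLHS](ac L)//.
    apply: (@le_trans _ _ (\sum_(m <oo)
        ((a i m * b i m)%:E + ((a i m * e)%:E + (a i m * (D m)%:R)%:E)))%E).
      apply: lee_nneseries => m _; first by rewrite lee_fin mulr_ge0.
      by rewrite -!EFinD lee_fin -!mulrDr ler_wpM2l.
    have ae0 m : (0 <= (a i m * e)%:E)%E by rewrite lee_fin mulr_ge0.
    rewrite !nneseriesD//; last by move=> m _; rewrite adde_ge0.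
    by rewrite ac// (EFinD e e) leeD2l// leeD2l.
  have Sfin : S \is a fin_num by rewrite ge0_fin_numE// (le_lt_trans SL)// ltry.
  split=> //; move: SL LS; rewrite -(fineK Sfin) -EFinD !lee_fin => SL LS.
  by rewrite ler_norml; apply/andP; split; lra.
apply/fine_cvgP; split.
  by have := est 1 ltr01; apply: filterS => i [].
apply/cvgrPdist_le => e e0 /=.
have := est (e / 2) (divr_gt0 e0 (@ltr0Sn _ 1)); apply: filterS => i [_].
by rewrite -splitr.
Unshelve. all: by end_near.
Qed.

End averages.

Section initial_states.
Context (R : realType) (rho : R) (rho_gt0 : 0 < rho).

Let c := rho / (1 + rho).

Let c0 : 0 <= c.
Proof. by rewrite divr_ge0 ?ltW// addr_gt0. Qed.

Let c1 : c <= 1.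
Proof. by rewrite ler_pdivrMr ?addr_gt0// mul1r lerDr. Qed.

Lemma regular_iter_arrive m (f : seq R -> \bar R) :
  regular f -> regular (iter m (@arrive R) f).
Proof. by move=> rf; elim: m => //= m; exact: regular_arrive. Qed.

Lemma iter_arrive_ge m (f : seq R -> \bar R) (a : R) x : 0 <= a -> regular f ->
  (forall y, a%:E <= f y)%E -> (a%:E <= iter m (@arrive R) f x)%E.
Proof.
move=> a0 rf af; rewrite -(iter_arrive_cst m a%:E x).
elim: m x => [|m IH] x //=; apply: arrive_le => //; last exact: regular_iter_arrive.
by apply: regular_iter_arrive; apply: regular_cst; rewrite lee_fin.
Qed.

(* The first [m] steps are all arrivals with probability [c ^+ m]. *)
Lemma iter_kern_ge_arrive m (f : seq R -> \bar R) (a : R) x : 0 <= a -> regular f ->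
  (forall y, a%:E <= f y)%E ->
  ((c ^+ m)%:E * iter m (@arrive R) f x + ((1 - c ^+ m) * a)%:E
   <= iter m (kern rho) f x)%E.
Proof.
move=> a0 rf af; elim: m x => [|m IH] x.
  by rewrite /= expr0 mul1e subrr mul0r adde0.
have cm0 k : 0 <= c ^+ k by rewrite exprn_ge0.
have cm1 k : 0 <= 1 - c ^+ k by rewrite subr_ge0 exprn_ile1.
have ge_a y : (a%:E <= iter m (kern rho) f y)%E.
  apply: le_trans (IH y).
  rewrite [leLHS](_ : _ = ((c ^+ m)%:E * a%:E + ((1 - c ^+ m) * a)%:E)%E); last first.
    by rewrite -EFinM -EFinD; congr EFin; ring.
  by rewrite leeD2r// lee_wpmul2l ?lee_fin//; exact: iter_arrive_ge.
have rA := regular_iter_arrive m rf.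
have [mA A0 _] := rA; have [_ A10 _] := regular_arrive rA.
have rK := regular_iter_kern rho_gt0 m rf.
have arr : ((c ^+ m)%:E * iter m.+1 (@arrive R) f x + ((1 - c ^+ m) * a)%:E
    <= arrive (iter m (kern rho) f) x)%E.
  have rb : regular (fun _ : seq R => ((1 - c ^+ m) * a)%:E).
    by apply: regular_cst; rewrite lee_fin mulr_ge0.
  have rcA := regularZ (cm0 m) rA.
  rewrite [leLHS](_ : _ = arrive (fun y => (c ^+ m)%:E * iter m (@arrive R) f y
      + ((1 - c ^+ m) * a)%:E)%E x); last first.
    rewrite arriveD// arriveZ ?lee_fin//.
    by rewrite [X in (_ + X)%E = _](_ : _ = arrive (fun=> ((1 - c ^+ m) * a)%:E) x) //; exact/esym/integral_prob_cst.
  by apply: arrive_le => //; exact: regularD.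
rewrite iterS /kern /evolve.
apply: (@le_trans _ _ ((1 + rho)^-1%:E * (a%:E + rho%:E *
    ((c ^+ m)%:E * iter m.+1 (@arrive R) f x + ((1 - c ^+ m) * a)%:E)))%E); last first.
  apply: lee_wpmul2l; first by rewrite lee_fin invr_ge0 addr_ge0// ltW.
  apply: leeD; first exact: ge_a.
  by apply: lee_wpmul2l arr; rewrite lee_fin ltW.
have lam0 : 1 + rho != 0 by rewrite gt_eqF// addr_gt0.
(* A finite value reduces the claim to an identity between reals; an infinite one makes the
   right-hand side infinite. *)
have := A10 x; rewrite -iterS; case: (iter m.+1 _ f x) => [u u0|_|//].
  rewrite -?(EFinM, EFinD) lee_fin le_eqVlt; apply/orP; left.
  by apply/eqP; rewrite exprS /c; field.
have c_gt0 k : 0 < c ^+ k by rewrite exprn_gt0// divr_gt0// addr_gt0.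
by rewrite [X in (_ <= _ * X)%E](_ : _ = +oo%E) ?gt0_muley ?leey// ?lte_fin ?invr_gt0 ?addr_gt0//.
Qed.

End initial_states.

Section time_limit.
Context (R : realType) (rho : R) (rho_gt0 : 0 < rho).
Implicit Types (B : set R).

Definition later m B k n : R :=
  fine (iter m (@arrive R) (iter n (kern rho) (tail B k)) [::]).

Lemma iter_arrive_le1 m (f : seq R -> \bar R) x : regular f ->
  (forall y, f y <= 1)%E -> (iter m (@arrive R) f x <= 1)%E.
Proof.
move=> rf f1; rewrite -(iter_arrive_cst m 1%E x).
elim: m x => [|m IH] x //=; apply: arrive_le => //; first exact: regular_iter_arrive.
by apply: regular_iter_arrive; apply: regular_cst; rewrite lee_fin.
Qed.

Lemma laterE m B k n : measurable B ->
  iter m (@arrive R) (iter n (kern rho) (tail B k)) [::] = (later m B k n)%:E.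
Proof.
move=> mB; have rK := regular_iter_kern rho_gt0 n (regular_tail k mB).
rewrite fineK// ge0_fin_numE; last by have [_ + _] := regular_iter_arrive m rK; exact.
apply: (@le_lt_trans _ _ 1%E); last exact: ltry.
apply: iter_arrive_le1 => // y; apply: iter_kern_le1 => //; first exact: regular_tail.
by move=> z; exact: ind_le1.
Qed.

Lemma later01 m B k n : measurable B -> 0 <= later m B k n <= 1.
Proof.
move=> mB; have rK := regular_iter_kern rho_gt0 n (regular_tail k mB).
rewrite -!lee_fin -laterE//; apply/andP; split.
  by have [_ + _] := regular_iter_arrive m rK; exact.
apply: iter_arrive_le1 => // y; apply: iter_kern_le1 => //; first exact: regular_tail.
by move=> z; exact: ind_le1.
Qed.

Lemma occ_le_iter_kern B k n y : measurable B ->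
  ((occ rho B k n)%:E <= iter n (kern rho) (tail B k) y)%E.
Proof.
move=> mB; rewrite -emeanE//; [|exact: regular_tail|by move=> z; exact: ind_le1].
by apply: iter_kern_increasing; [exact: rho_gt0|exact: regular_tail
  |exact: tail_increasing|exact: sub0seq].
Qed.

Lemma cvg_later m B k : measurable B -> later m B k @ \oo --> limocc rho B k.
Proof.
move=> mB; have occ_cvg : occ rho B k @ \oo --> limocc rho B k by exact: cvg_occ.
have occ_ge0 n : 0 <= occ rho B k n by apply: emean_ge0 => //; exact: regular_tail.
have rT := regular_tail k mB; have rK n := regular_iter_kern rho_gt0 n rT.
pose c := (rho / (1 + rho)) ^+ m.
have c0 : 0 < c by rewrite exprn_gt0// divr_gt0// addr_gt0.
(* The upper bound is [iter_kern_ge_arrive] solved for [later]. It involves [occ] alone, at the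
   times [n + m] and [n], so it has the same limit as the lower bound. *)
apply: (@squeeze_cvgr _ _ _ _ (occ rho B k)
  (fun n => c^-1 * (occ rho B k (n + m)%N - (1 - c) * occ rho B k n))) => //.
  near=> n; apply/andP; split.
    by rewrite -lee_fin -laterE//; apply: iter_arrive_ge => // y; exact: occ_le_iter_kern.
  have := iter_kern_ge_arrive rho_gt0 m [::] (occ_ge0 n) (rK n)
    (fun y => occ_le_iter_kern k n y mB).
  rewrite laterE// -iterD -/c emeanE//; last by move=> z; exact: ind_le1.
  rewrite -EFinM -EFinD lee_fin => H.
  by rewrite ler_pdivlMl// lerBrDr addnC.
rewrite [X in _ --> X](_ : _ = c^-1 * (limocc rho B k - (1 - c) * limocc rho B k)); last first.
  by field; rewrite gt_eqF.
apply: cvgMr; apply: cvgB; last exact: cvgMr.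
by rewrite cvg_shiftn.
Unshelve. all: by end_near.
Qed.

End time_limit.

Section time_limit_queue.
Context (R : realType) d (T : measurableType d) (P : probability T R).
Context (rho : R) (rho_gt0 : 0 < rho).
Context (q : queue_input P) (q_laws : queue_laws rho q).
Implicit Types (B : set R).

Let weight m : R := fine (P (init_num q @^-1` [set m])).

Let m_init m : measurable (init_num q @^-1` [set m]).
Proof. exact: measurable_funPTI. Qed.

Let weightE m : P (init_num q @^-1` [set m]) = (weight m)%:E.
Proof. by rewrite fineK// fin_num_measure. Qed.

Let weight_sum : (\sum_(m <oo) (weight m)%:E = 1)%E.
Proof.
have := init_mean_cst q (@lee01 R); rewrite /init_mean => <-.
by apply: eq_eseriesr => m _; rewrite iter_arrive_cst mule1 weightE.
Qed.

Lemma cvg_init_mean B k : measurable B ->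
  init_mean q (iter n (kern rho) (tail B k)) @[n --> \oo] --> (limocc rho B k)%:E.
Proof.
move=> mB.
rewrite (_ : (fun n => _) = (fun n => \sum_(m <oo) (weight m * later rho m B k n)%:E)%E); last first.
  by apply/funext => n; apply: eq_eseriesr => m _; rewrite weightE laterE.
have w0 m : 0 <= weight m by exact: fine_ge0.
apply: (@cvg_average _ _ _ _ (fun=> weight) (fun n m => later rho m B k n)).
- by rewrite limocc_ge0 ?limocc_le1.
- by near=> n; split=> // m; exact: later01.
move=> e e0.
have [N HN] : exists N, (\sum_(N <= m <oo) (weight m)%:E <= e%:E)%E.
  have : (\sum_(0 <= m <oo | xpredT m) (weight m)%:E < +oo)%E by rewrite weight_sum ltry.
  move=> /nneseries_tail_cvg /(_ (fun m _ => _)) tl.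
  have {}tl : (\sum_(N <= m <oo) (weight m)%:E)%E @[N --> \oo] --> 0%E.
    by apply: tl => m; rewrite lee_fin.
  have /fine_cvgP[fin /cvgrPdist_le /(_ _ e0) H] := tl.
  near \oo => N; exists N.
  have Nf : (\sum_(N <= m <oo) (weight m)%:E)%E \is a fin_num by near: N.
  have : `|0 - fine (\sum_(N <= m <oo) (weight m)%:E)%E| <= e by near: N.
  by rewrite sub0r normrN -{2}(fineK Nf) lee_fin; exact: le_trans (ler_norm _).
(* Large initial numbers carry little weight; for the finitely many others the convergence is
   simultaneous. *)
near=> n; exists (fun m => N <= m)%N; split.
  apply: le_trans HN; rewrite [leRHS]eseries_cond [leRHS]eseries_mkcond.
  apply: lee_nneseries => m _; first by rewrite lee_fin mulr_ge0.
  by rewrite /=; case: ifP => _; rewrite ?mulr1 ?mulr0.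
move=> m; rewrite -ltnNge => mN.
have : forall i : 'I_N, `|later rho i B k n - limocc rho B k| <= e.
  near: n; apply: filter_forall => i.
  have : later rho i B k @ \oo --> limocc rho B k by exact: cvg_later.
  move=> /cvgrPdist_le /(_ _ e0).
  by apply: filterS => n; rewrite distrC.
by move=> /(_ (Ordinal mN)).
Unshelve. all: by end_near.
Qed.

Lemma init_meanZ (a : \bar R) h : (0 <= a)%E -> measurable_fun setT h ->
  (forall x, 0 <= h x)%E ->
  init_mean q (fun x => a * h x)%E = (a * init_mean q h)%E.
Proof.
move=> a0 mh h0; rewrite /init_mean -ge0_nneseriesZl//; last first.
  by move=> m; rewrite mule_ge0// iter_arrive_ge0.
by apply: eq_eseriesr => m _; rewrite iter_arriveZ// muleCA.
Qed.

(** The next term of the exponential series, [tpow M.+1 s], is at most [expR s]. The bound is crude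
    but shows that each Poisson weight vanishes as the mean grows. *)
Lemma tpow_le (M : nat) (s : R) : 0 < s -> expR (- s) * tpow M s <= M.+1%:R / s.
Proof.
move=> s0; have tS : tpow M s * (s / M.+1%:R) = tpow M.+1 s.
  rewrite /tpow exprS factS natrM.
  have : M`!%:R != 0 :> R by rewrite pnatr_eq0 -lt0n fact_gt0.
  have : M.+1%:R != 0 :> R by rewrite pnatr_eq0.
  by move: (M.+1%:R) (M`!%:R) => y z y0 z0; field; rewrite y0 z0.
have te : tpow M.+1 s <= expR s.
  rewrite -lee_fin -(nneseries_tpow (ltW s0)).
  apply: le_trans (@nneseries_lim_ge _ _ xpredT 0 M.+2 _); last first.
    by move=> j _ _; rewrite lee_fin tpow_ge0// ltW.
  rewrite big_nat_recr//= leeDr// sume_ge0// => j _.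
  by rewrite lee_fin tpow_ge0// ltW.
rewrite expRN ler_pdivrMl ?expR_gt0//.
rewrite mulrA ler_pdivlMr// -ler_pdivrMr// -mulrA tS//.
Qed.

Lemma init_mean_heat f t : 0 <= t -> regular f ->
  init_mean q (heat rho t f) =
  (\sum_(M <oo) (expR (- ((1 + rho) * t)) * tpow M ((1 + rho) * t))%:E
    * init_mean q (iter M (kern rho) f))%E.
Proof.
move=> t0 rf; have rK M := regular_iter_kern rho_gt0 M rf.
have s0 : 0 <= (1 + rho) * t by rewrite mulr_ge0// addr_ge0// ltW.
have a0 M : 0 <= expR (- ((1 + rho) * t)) * tpow M ((1 + rho) * t).
  by rewrite mulr_ge0 ?expR_ge0 ?tpow_ge0.
transitivity (init_mean q (fun x => \sum_(M <oo) (expR (- ((1 + rho) * t)) * tpow M ((1 + rho) * t))%:E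
    * iter M (kern rho) f x)%E).
  congr init_mean; apply/funext => x; rewrite /heat -ge0_nneseriesZl ?lee_fin ?expR_ge0//.
    apply: eq_eseriesr => M _; rewrite iter_evolve// !muleA -!EFinM.
    by congr (_%:E * _)%E; rewrite -mulrA /tpow exprMn; congr (_ * _); ring.
  move=> M; rewrite mule_ge0 ?lee_fin ?tpow_ge0//.
  by have [_ + _] := regular_iter_evolve rho_gt0 M rf; exact.
rewrite init_mean_nneseries//; last 2 first.
- by move=> M; have [mK _ _] := rK M; exact: measurable_funeM.
- by move=> M x; rewrite mule_ge0 ?lee_fin// iter_kern_ge0.
by apply: eq_eseriesr => M _; have [? ? _] := rK M; rewrite init_meanZ ?lee_fin.
Qed.

Lemma cvg_init_mean_heat B k : measurable B ->
  init_mean q (heat rho t (tail B k)) @[t --> +oo] --> (limocc rho B k)%:E.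
Proof.
move=> mB; have rT := regular_tail k mB; have rK M := regular_iter_kern rho_gt0 M rT.
have lam0 : 0 < 1 + rho by rewrite addr_gt0.
pose v M := fine (init_mean q (iter M (kern rho) (tail B k))).
have im_ge0 M : (0 <= init_mean q (iter M (kern rho) (tail B k)))%E.
  apply: nneseries_ge0 => m _ _; rewrite mule_ge0//.
  by have [_ + _] := regular_iter_arrive m (rK M); exact.
have im_le1 M : (init_mean q (iter M (kern rho) (tail B k)) <= 1)%E.
  rewrite -weight_sum; apply: lee_nneseries => m _.
    by rewrite mule_ge0//; have [_ + _] := regular_iter_arrive m (rK M); exact.
  rewrite weightE laterE// -EFinM lee_fin ler_piMr ?fine_ge0//.
  by case/andP: (later01 rho_gt0 m k M mB).
have vE M : init_mean q (iter M (kern rho) (tail B k)) = (v M)%:E.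
  by rewrite fineK// ge0_fin_numE// (le_lt_trans (im_le1 M))// ltry.
have v01 M : 0 <= v M <= 1 by rewrite -!lee_fin -vE im_ge0 im_le1.
have vL : v @ \oo --> limocc rho B k by apply/fine_cvg; exact: cvg_init_mean.
pose a t M : R := expR (- ((1 + rho) * t)) * tpow M ((1 + rho) * t).
apply: (@cvg_trans _ ((\sum_(M <oo) (a t M * v M)%:E)%E @[t --> +oo])).
  apply: near_eq_cvg; near=> t; rewrite init_mean_heat//.
  by apply: eq_eseriesr => M _; rewrite vE.
apply: cvg_average.
- by rewrite limocc_ge0 ?limocc_le1.
- near=> t; have s0 : 0 <= (1 + rho) * t by rewrite mulr_ge0// ltW.
  split=> // [M|]; last exact: nneseries_poisson.
  by rewrite mulr_ge0 ?expR_ge0 ?tpow_ge0.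
move=> e e0; have /cvgrPdist_le /(_ _ e0) [N _ HN] := vL.
(* Now the small step numbers are exceptional: the Poisson weights leave every finite set as [t]
   grows. *)
near=> t; exists (fun M => M < N)%N; split; last first.
  by move=> M; rewrite -leqNgt => /HN /=; rewrite distrC.
have t0 : 0 < t by [].
have s0 : 0 < (1 + rho) * t by rewrite mulr_gt0.
have a0 M : 0 <= a t M by rewrite mulr_ge0 ?expR_ge0 ?tpow_ge0// ltW.
rewrite (@nneseries_split _ _ 0 N); last by move=> M _; rewrite lee_fin mulr_ge0.
rewrite [X in (_ + X)%E]eseries0 ?adde0; last first.
  by move=> M; rewrite add0n => NM _; rewrite ltnNge NM mulr0.
rewrite add0n.
(* Each of the [N] weights is at most [N / ((1 + rho) * t)] by [tpow_le], since [M.+1 <= N]. *)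
apply: (@le_trans _ _ (\sum_(0 <= M < N) (N%:R / ((1 + rho) * t))%:E)%E).
  rewrite !big_mkord; apply: lee_sum => M _; rewrite lee_fin ltn_ord mulr1.
  apply: (le_trans (tpow_le _ s0)); rewrite ler_pM2r ?invr_gt0// ler_nat.
  exact: ltn_ord.
rewrite sumEFin lee_fin big_const_nat subn0 iter_addr_0 -[leLHS]mulr_natr.
by rewrite mulrAC ler_pdivrMr// mulrA -ler_pdivrMl ?mulr_gt0//.
Unshelve. all: by end_near.
Qed.

End time_limit_queue.

(** * Weak convergence of extended natural numbers *)

Section extended_naturals.
Local Open Scope ring_scope.
Context (R : realType) (f : \bar R -> R).

Let fn (k : nat) : R := f k%:R%:E.

(** Summation by parts for [f] stopped at [K]: a finite combination of indicators of tail events, so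
    its mean depends only on finitely many tail probabilities. *)
Definition truncated (K : nat) (y : \bar R) : R :=
  fn 0 + \sum_(k < K) (fn k.+1 - fn k) * ((k.+1%:R%:E <= y)%E)%:R.

Lemma truncated_nat K n : truncated K n%:R%:E = fn (minn K n).
Proof.
rewrite /truncated; elim: K => [|K IH]; first by rewrite big_ord0 addr0 min0n.
rewrite big_ord_recr /= addrA IH lee_fin ler_nat.
case Kn : (K < n)%N.
  by rewrite (minn_idPl Kn) (minn_idPl (ltnW Kn)) mulr1 addrC subrK.
move/negbT: Kn; rewrite -leqNgt => Kn.
by rewrite (minn_idPr Kn) (minn_idPr (leqW Kn)) mulr0 addr0.
Qed.

Lemma truncatedy K : truncated K +oo = fn K.
Proof.
rewrite /truncated; elim: K => [|K IH]; first by rewrite big_ord0 addr0.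
by rewrite big_ord_recr /= addrA IH leey mulr1 addrC subrK.
Qed.

Hypothesis f_cont : {within @extended_nats R, continuous f}.

(** Finite points being isolated among the extended naturals, continuity there amounts to this
    limit. *)
Lemma cvg_fn : fn @ \oo --> f +oo%E.
Proof.
have := f_cont; rewrite subspace_continuousP => /(_ +oo%E (or_introl erefl)) H.
apply: (@cvg_comp _ _ _ (fun n : nat => n%:R%:E : \bar R) f _ _ _ _ H).
move=> S /= [M [_ HM]].
exists (Num.bound `|M|) => // n /= Mn; apply: HM; last by right; exists n.
rewrite lte_fin (le_lt_trans (ler_norm _))// (lt_le_trans (archi_boundP _))//.
by rewrite ler_nat.
Qed.

(** Truncation changes [f] only beyond [K], where all values, including the one at infinity, are
    within [e / 2] of the limit. The error is uniform in [y]. *)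
Lemma truncated_approx (e : R) : 0 < e -> exists N, forall K y, (N <= K)%N ->
  extended_nats y -> `|f y - truncated K y| <= e.
Proof.
move=> e0; have /cvgrPdist_le /(_ _ (divr_gt0 e0 (@ltr0Sn _ 1))) [N _ HN] := cvg_fn.
exists N => K y NK [->|[n ->]].
  rewrite truncatedy (le_trans (HN _ NK))// ler_pdivrMr// ler_peMr// ?ler1n//.
  exact: ltW.
rewrite truncated_nat; have [nK|Kn] := leqP n K.
  by rewrite -/(fn n) subrr normr0 ltW.
rewrite -/(fn n) (le_trans (ler_distD (f +oo%E) _ _))// [leRHS]splitr lerD//.
  by rewrite distrC; apply: HN; rewrite /= (leq_trans NK)// ltnW.
exact: HN.
Qed.

Lemma cvg_truncated y : extended_nats y -> truncated K y @[K --> \oo] --> f y.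
Proof.
move=> ey; apply/cvgrPdist_le => e e0; have [N HN] := truncated_approx e0.
by exists N => // K NK; exact: HN.
Qed.

End extended_naturals.

Section bounded_expectations.
Local Open Scope ring_scope.
Context (R : realType) d (T : measurableType d) (P : probability T R).

Lemma bounded_integrable (h : T -> R) (M : R) : measurable_fun setT h ->
  (forall w, `|h w| <= M) -> P.-integrable setT (EFin \o h).
Proof.
move=> mh hM; apply: measurable_bounded_integrable => //.
  exact: le_lt_trans (probability_le1 P measurableT) (ltry 1).
exists M; split; first exact: num_real.
by move=> x Mx w _ /=; exact: le_trans (hM w) (ltW Mx).
Qed.

Lemma expectation_Rintegral (h : T -> R) (M : R) : measurable_fun setT h ->
  (forall w, `|h w| <= M) -> 'E_P[h]%E = (\int[P]_w h w)%:E.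
Proof.
move=> mh hM; rewrite unlock fineK//; apply: integrable_fin_num => //.
exact: bounded_integrable hM.
Qed.

Lemma Rintegral_dist (h1 h2 : T -> R) (e : R) : P.-integrable setT (EFin \o h1) ->
  P.-integrable setT (EFin \o h2) -> (forall w, `|h1 w - h2 w| <= e) ->
  `|\int[P]_w h1 w - \int[P]_w h2 w| <= e.
Proof.
move=> i1 i2 he; rewrite -RintegralB//.
have i12 : P.-integrable setT (EFin \o (fun w => h1 w - h2 w)).
  by apply: (@eq_integrable _ _ _ _ _ measurableT ((EFin \o h1) \- (EFin \o h2))%E) => //; exact: integrableB.
apply: (le_trans (le_normr_Rintegral _ i12)) => //.
have -> : e = \int[P]_(w in setT) e.
  by rewrite /Rintegral integral_prob_cst.
apply: le_Rintegral => //; first exact: (integrable_abse i12).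
apply: (@bounded_integrable _ `|e|) => //.
Qed.

Context (X : T -> \bar R) (X_rv : extended_nat_rv X) (f : \bar R -> R).

Let mX : measurable_fun setT X := X_rv.1.

Let m_ge k : measurable [set w | (k%:R%:E <= X w)%E].
Proof.
rewrite -[X in measurable X]setTI; exact: emeasurable_fun_c_infty.
Qed.

Let m_step k : measurable_fun setT (fun w => ((k%:R%:E <= X w)%E%:R : R)).
Proof.
rewrite (_ : (fun w => _) = \1_[set w | (k%:R%:E <= X w)%E]).
  exact: measurable_indic.
by apply/funext => w; rewrite indicE; congr (_%:R); apply/esym; rewrite mem_setE.
Qed.

Lemma measurable_truncated K : measurable_fun setT (fun w => truncated f K (X w)).
Proof.
rewrite /truncated; apply: measurable_funD => //.
by apply: measurable_sum => k; exact: measurable_funM.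
Qed.

Lemma truncated_bounded K : exists M, forall w, `|truncated f K (X w)| <= M.
Proof.
exists (`|f 0%:R%:E| + \sum_(k < K) `|f k.+1%:R%:E - f k%:R%:E|) => w.
rewrite /truncated (le_trans (ler_normD _ _))// lerD2l.
apply: (le_trans (ler_norm_sum _ _ _)); apply: ler_sum => k _.
by rewrite normrM ler_piMr//; case: (_ <= _)%E; rewrite ?normr1 ?normr0.
Qed.

Lemma integrable_truncated K : P.-integrable setT (EFin \o (fun w => truncated f K (X w))).
Proof.
have [M HM] := truncated_bounded K; apply: bounded_integrable HM.
exact: measurable_truncated.
Qed.

Lemma Rintegral_truncated K : \int[P]_w truncated f K (X w) =
  f 0%:R%:E + \sum_(k < K) (f k.+1%:R%:E - f k%:R%:E) *
    fine (P [set w | (k.+1%:R%:E <= X w)%E]).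
Proof.
elim: K => [|K IH].
  rewrite big_ord0 addr0 /truncated.
  under eq_Rintegral do rewrite big_ord0 addr0.
  by rewrite /Rintegral integral_prob_cst.
rewrite big_ord_recr /= addrA -IH.
under eq_Rintegral do rewrite /truncated big_ord_recr /= addrA -/(truncated f K _).
have i1 : P.-integrable setT (EFin \o (fun w => ((K.+1%:R%:E <= X w)%E%:R : R))).
  apply: (@bounded_integrable _ 1) => // w.
  by case: (_ <= _)%E; rewrite ?normr1 ?normr0.
rewrite RintegralD//; last 2 first.
- exact: integrable_truncated.
- rewrite (_ : _ \o _ = fun w => ((f K.+1%:R%:E - f K%:R%:E)%:E * ((K.+1%:R%:E <= X w)%E%:R)%:E)%E)//.
  exact: integrableZl.
rewrite RintegralZl//; congr (_ + _ * _).
rewrite /Rintegral -(setIT [set w | _]) -integral_indic//; congr fine.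
by apply: eq_integral => w _; rewrite indicE; congr (_%:R%:E); apply/esym; rewrite mem_setE.
Qed.

End bounded_expectations.

Section weak_limit.
Local Open Scope ring_scope.
Context (R : realType) d (T : measurableType d) d' (T' : measurableType d').
Context (P : probability T R) (Q : probability T' R).

(** Truncation costs [e / 3] on either side, uniformly in [t], and the truncated means converge
    because they are finite combinations of tails. *)
Lemma tails_converge_weakly (X : R -> T -> \bar R) (Y : T' -> \bar R) :
  (forall t, 0 <= t -> extended_nat_rv (X t)) -> extended_nat_rv Y ->
  (forall k : nat, fine (P [set w | (k%:R%:E <= X t w)%E]) @[t --> +oo] -->
    fine (Q [set w | (k%:R%:E <= Y w)%E])) ->
  converges_weakly P X Q Y.
Proof.
move=> eX eY cXY; split=> // f f_cont [M fM].
(* Continuity is relative to the extended naturals, so measurability of the composition is obtained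
   from the pointwise limit of truncations. *)
have mf d0 (T0 : measurableType d0) (P0 : probability T0 R) (Z : T0 -> \bar R) :
    extended_nat_rv Z -> measurable_fun setT (f \o Z).
  move=> eZ; apply: (measurable_fun_cvg (h := fun K w => truncated f K (Z w))).
    by move=> K; exact: measurable_truncated.
  by move=> w _; apply: cvg_truncated => //; exact: eZ.2.
have fZ d0 (T0 : measurableType d0) (P0 : probability T0 R) (Z : T0 -> \bar R) :
    extended_nat_rv Z -> 'E_P0[f \o Z]%E = (\int[P0]_w f (Z w))%:E.
  move=> eZ; apply: (@expectation_Rintegral _ _ _ _ _ M) => //; first exact: mf.
  by move=> w; apply: fM; exact: eZ.2.
have iZ d0 (T0 : measurableType d0) (P0 : probability T0 R) (Z : T0 -> \bar R) :
    extended_nat_rv Z -> P0.-integrable setT (EFin \o (fun w => f (Z w))).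
  move=> eZ; apply: (@bounded_integrable _ _ _ _ _ M); first exact: mf eZ.
  by move=> w; apply: fM; exact: eZ.2.
rewrite fZ//; apply: (@cvg_trans _ ((\int[P]_w f (X t w))%:E @[t --> +oo])).
  by apply: near_eq_cvg; near=> t; rewrite fZ//; exact: eX.
apply: cvg_EFin; first by near=> t.
apply/cvgrPdist_le => e e0.
have e3 : 0 < e / 3 by rewrite divr_gt0.
have [K HK] := truncated_approx f_cont e3.
have trunc_cvg : \int[P]_w truncated f K (X t w) @[t --> +oo] -->
    \int[Q]_w truncated f K (Y w).
  rewrite Rintegral_truncated//.
  apply: (@cvg_trans _ ((f 0%:R%:E + \sum_(k < K) (f k.+1%:R%:E - f k%:R%:E) *
    fine (P [set w | (k.+1%:R%:E <= X t w)%E])) @[t --> +oo])).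
    by apply: near_eq_cvg; near=> t; rewrite Rintegral_truncated//; exact: eX.
  apply: cvgD; first exact: cvg_cst.
  elim: {HK} K => [|K IH].
    by rewrite big_ord0; under eq_cvg do rewrite big_ord0; exact: cvg_cst.
  rewrite big_ord_recr; under eq_cvg do rewrite big_ord_recr.
  by apply: cvgD => //; apply: cvgMr; exact: cXY.
move/cvgrPdist_le : trunc_cvg => /(_ _ e3) trunc_cvg.
near=> t.
have t0 : 0 <= t by [].
have D1 : `|\int[Q]_w f (Y w) - \int[Q]_w truncated f K (Y w)| <= e / 3.
  apply: Rintegral_dist; [exact: iZ|exact: integrable_truncated|].
  by move=> w; apply: HK => //; exact: eY.2.
have D2 : `|\int[P]_w f (X t w) - \int[P]_w truncated f K (X t w)| <= e / 3.
  apply: Rintegral_dist; [exact/iZ/eX|exact/integrable_truncated/eX|].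
  by move=> w; apply: HK => //; exact: (eX _ t0).2.
have D3 : `|\int[Q]_w truncated f K (Y w) - \int[P]_w truncated f K (X t w)| <= e / 3.
  by near: t.
change (`|\int[Q]_w f (Y w) - \int[P]_w f (X t w)| <= e).
move: D1 D2 D3; rewrite !ler_norml => /andP[? ?] /andP[? ?] /andP[? ?].
by apply/andP; split; lra.
Unshelve. all: by end_near.
Qed.

End weak_limit.

(** * A variable with the limiting tails *)

Section limit_variable.
Local Open Scope ring_scope.
Context (R : realType) (rho : R) (rho_gt0 : 0 < rho).
Context (B : set R) (mB : measurable B).

Let l k := limocc rho B k.

(* Its law has the tails [limocc rho B]. *)
Definition limit_count (u : R) : \bar R := (\sum_(k <oo) ((u < l k.+1)%R%:R)%:E)%E.

Lemma limocc_nonincreasing k j : (k <= j)%N -> l j <= l k.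
Proof.
elim: j => [|j IH]; first by rewrite leqn0 => /eqP ->.
rewrite leq_eqVlt => /predU1P[->//|/IH]; apply: le_trans.
apply: (@ler_cvg_to _ (nbhs \oo) _ _ (occ rho B j.+1) (occ rho B j)).
- exact: cvg_occ.
- exact: cvg_occ.
near=> n; rewrite -subr_ge0 -emean_level//; apply: emean_ge0 => //.
exact: regular_level.
Unshelve. all: by end_near.
Qed.

(** The limiting tails are nonincreasing, so the indices [k] with [u < l k.+1] form an initial
    segment, finite or not, whose length is the value: a quantile transform. *)
Lemma limit_count_cases u : (limit_count u = +oo%E /\ forall k, u < l k.+1) \/
  exists m, limit_count u = m%:R%:E /\ forall k, (u < l k.+1) = (k < m)%N.
Proof.
have [H|/existsNP[k0 Hk0]] := pselect (forall k, u < l k.+1).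
  left; split=> //; apply: cvg_lim => //.
  rewrite (_ : (fun n => _) = (fun n => n%:R%:E)); first exact/cvgeryP/cvgr_idn.
  apply/funext => n; rewrite sumEFin (eq_bigr (fun=> 1)) ?sumr_const_nat ?subn0//.
  by move=> k _; rewrite H.
right; have ex : exists k, l k.+1 <= u by exists k0; rewrite leNgt; exact/negP.
exists (ex_minn ex); case: ex_minnP => m lm Hm.
have key k : (u < l k.+1) = (k < m)%N.
  apply/idP/idP => [uk|km]; last by rewrite ltNge; apply/negP => /Hm; rewrite leqNgt km.
  rewrite ltnNge; apply/negP => mk; move: uk; rewrite ltNge.
  by rewrite (le_trans _ lm)// limocc_nonincreasing.
split=> //; rewrite /limit_count (@nneseries_split _ _ 0 m)// add0n.
rewrite [X in (_ + X)%E]eseries0 ?adde0; last first.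
  by move=> k mk _; rewrite key ltnNge mk.
rewrite big_mkord sumEFin (eq_bigr (fun=> 1)) ?sumr_const ?card_ord//.
by move=> k _; rewrite key ltn_ord.
Qed.

Lemma limit_count_ge k u : (k.+1%:R%:E <= limit_count u)%E = (u < l k.+1).
Proof.
have [[-> ->]|[m [-> ->]]] := limit_count_cases u; first by rewrite leey.
by rewrite lee_fin ler_nat.
Qed.

Let measurable_below k : measurable_fun setT (fun u : R => (((u < l k.+1)%R%:R : R)%:E : \bar R)).
Proof.
apply/measurable_EFinP.
apply: (@measurableT_comp _ _ _ _ _ _ (fun b : bool => (b%:R : R))) => //.
by apply: measurable_fun_ltr => //; exact: measurable_cst.
Qed.

Lemma limit_count_rv : extended_nat_rv limit_count.
Proof.
split; last first.
  by move=> u; have [[-> _]|[m [-> _]]] := limit_count_cases u; [left|right; exists m].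
exact: ge0_emeasurable_sum.
Qed.

Lemma unif_below k : unif R [set u | u < l k] = (l k)%:E.
Proof.
have lk0 : 0 <= l k by exact: limocc_ge0.
have lk1 : l k <= 1 by exact: limocc_le1.
rewrite (_ : [set u | u < l k] = `]-oo, (l k)[%classic); last first.
  by apply/seteqP; split=> u /=; rewrite in_itv.
rewrite unif_lebesgue; last exact: measurable_itv.
rewrite (_ : _ `&` _ = `[0, l k[%classic); last first.
  apply/seteqP; split=> u /=; rewrite !in_itv/=; first by move=> [-> /andP[->]].
  by move=> /andP[-> ul]; rewrite ul (ltW (lt_le_trans ul lk1)).
by rewrite lebesgue_measure_itv/= lte_fin oppr0 adde0; case: ltgtP lk0 => // <-.
Qed.

Lemma limit_count_tail k :
  fine (unif R [set u | (k%:R%:E <= limit_count u)%E]) = l k.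
Proof.
case: k => [|k]; last first.
  rewrite (_ : [set u | _] = [set u | u < l k.+1]) ?unif_below//.
  by apply/funext => u /=; rewrite limit_count_ge.
rewrite (_ : [set u | _] = setT); first by rewrite /l limocc0// probability_setT.
apply/seteqP; split=> // u _ /=.
by have [[-> _]|[m [-> _]]] := limit_count_cases u; rewrite ?leey// lee_fin.
Qed.

Lemma integral_limit_count : (\int[unif R]_u limit_count u = mean_measure rho B)%E.
Proof.
rewrite mean_measure_occ// /limit_count integral_nneseries//.
apply: eq_eseriesr => k _; rewrite -/(l k.+1) -unif_below.
rewrite -[in RHS](setIT [set u | _]) -integral_indic//; last first.
  rewrite (_ : [set u | _] = `]-oo, (l k.+1)[%classic); first exact: measurable_itv.
  by apply/seteqP; split=> u /=; rewrite in_itv.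
by apply: eq_integral => u _; rewrite indicE; congr (_%:R%:E); apply/esym; rewrite mem_setE.
Qed.

End limit_variable.

Section state_law.
Local Open Scope ring_scope.
Context (R : realType) d (T : measurableType d) (P : probability T R).
Context (rho : R) (rho_gt0 : 0 < rho).
Context (q : queue_input P) (q_laws : queue_laws rho q).
Context (B : set R) (mB : measurable B).

Lemma queue_stateE t w : queue_state q t w B = cntE B (map fst (jobs_at q t w)).
Proof.
rewrite /queue_state /cntE /cnt; elim: (jobs_at q t w) => [|c s IH].
  by rewrite big_nil.
by rewrite big_cons IH diracE -EFinD -natrD.
Qed.

Lemma queue_state_rv t : extended_nat_rv (fun w => queue_state q t w B).
Proof.
split; last by move=> w; rewrite queue_stateE; right; exists (cnt B (map fst (jobs_at q t w))).
rewrite (_ : (fun w => _) = cntE B \o (map fst \o jobs_at q t)); last first.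
  by apply/funext => w; exact: queue_stateE.
have [mC _ _] := regular_cntE mB; apply: (measurableT_comp mC).
exact: measurableT_comp (@measurable_map_fst R) (measurable_jobs_at q t).
Qed.

Lemma queue_state_tail t k : 0 <= t ->
  P [set w | (k%:R%:E <= queue_state q t w B)%E] = init_mean q (heat rho t (tail B k)).
Proof.
move=> t0; rewrite -(law_of_jobs rho_gt0 q_laws)//; last exact: regular_tail.
have [mX _] := queue_state_rv t.
rewrite -[in LHS](setIT [set w | _]) -integral_indic//; last first.
  rewrite -[X in measurable X]setTI; exact: emeasurable_fun_c_infty.
apply: eq_integral => w _; rewrite indicE /tail /ind; congr ((nat_of_bool _)%:R%:E).
apply/idP/idP => [/set_mem /=|kc].
  by rewrite queue_stateE lee_fin ler_nat.
by apply/mem_set => /=; rewrite queue_stateE lee_fin ler_nat.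
Qed.

End state_law.

Theorem corollary1 (R : realType) (d : measure_display)
    (T : measurableType d) (P : probability T R)
    (rho : R) (rho_gt0 : 0 < rho)
    (q : queue_input P) (q_laws : queue_laws rho q)
    (B : set R) (B_borel : measurable B) (B_sub : B `<=` `[0, 1]) :
  exists (d' : measure_display) (T' : measurableType d')
         (Q : probability T' R) (xB : T' -> \bar R),
    converges_weakly P (fun t w => queue_state q t w B) Q xB /\
    (\int[Q]_w xB w =
     \int[lebesgue_measure]_(p in B) mean_density rho p)%E.
Proof.
(* Weak convergence concerns the law only, so a single uniform variable suffices as the limiting
   probability space. *)
exists _, _, (unif R), (limit_count rho B); split.
  apply: tails_converge_weakly => [t _||k].
  - exact: queue_state_rv.
  - exact: limit_count_rv.
  rewrite limit_count_tail//.
  apply: (@cvg_trans _ (fine (init_mean q (heat rho t (tail B k))) @[t --> +oo])).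
    by apply: near_eq_cvg; near=> t; rewrite (queue_state_tail rho_gt0 q_laws).
  by apply: fine_cvg; exact: cvg_init_mean_heat.
rewrite integral_limit_count// mean_density_eq// /density_measure.
by rewrite (_ : B `&` _ = B)//; exact/setIidPl.
Unshelve. all: by end_near.
Qed.
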